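(* Let $n$ be a positive integer and let $\lambda$ be a partition of $n$. (1) If $\lambda\notin\{(n),(1^n)\}$, then $S^2([\lambda])$ is inhomogeneous (and in particular reducible). (2) If neither $\lambda$ nor its conjugate $\lambda^t$ is one of the partitions $(n)$, $(n-1,1)$, $(2^2)$, $(3^2)$, then $A^2([\lambda])$ is inhomogeneous (and in particular reducible).
   Context: For a partition $\lambda$ of $n$, $[\lambda]$ denotes the irreducible complex character of the symmetric group $S_n$ labelled by $\lambda$ (so $[n]$ is the trivial character and $[1^n]$ the sign character); $\lambda^t$ is the conjugate (transpose) partition. For a character $\chi$ of a finite group, $S^2(\chi)$ and $A^2(\chi)$ are the symmetric and anti-symmetric parts of $\chi^2$, given by $S^2(\chi)(g)=\tfrac12(\chi(g)^2+\chi(g^2))$ and $A^2(\chi)(g)=\tfrac12(\chi(g)^2-\chi(g^2))$. Partitions of the form $(n)$ or $(1^n)$ are called linear. A character is homogeneous if it is a multiple of a single irreducible character, and inhomogeneous if it has at least two distinct irreducible constituents. Exponents denote repeated parts: $(2^2)=(2,2)$, $(3^2)=(3,3)$. *)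

(* Defs.v *)
From mathcomp Require Import all_boot all_order all_algebra all_fingroup.
From mathcomp Require Import all_solvable all_field all_character.

Set Implicit Arguments.
Unset Strict Implicit.
Unset Printing Implicit Defensive.

Import GroupScope GRing.Theory Num.Theory.
Local Open Scope ring_scope.

Definition is_partition (n : nat) (la : seq nat) : bool :=
  [&& sorted geq la, 0%N \notin la & sumn la == n].

Definition conj_part (la : seq nat) : seq nat :=
  [seq count (fun p => (j < p)%N) la | j <- iota 0 (head 0%N la)].

(* The cells of the diagram of la, a partition of n, are numbered by 'I_n row
   by row from left to right: the cell i lies in row reshape_index la i and in
   column reshape_offset la i. *)
Definition row_stab (n : nat) (la : seq nat) : {set 'S_n} :=
  [set s : 'S_n | [forall i, reshape_index la (s i) == reshape_index la i]].

Definition col_stab (n : nat) (la : seq nat) : {set 'S_n} :=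
  [set s : 'S_n | [forall i, reshape_offset la (s i) == reshape_offset la i]].

(* The Young symmetrizer, the sum of sgn(c) r c over r in the row stabilizer
   and c in the column stabilizer, as an element of the group algebra of 'S_n;
   the latter is the space of the regular representation, where x in 'S_n is
   the basis vector of index gring_index _ x. *)
Definition young_symmetrizer (n : nat) (la : seq nat) :
    'rV[algC]_(#|[set: 'S_n]|) :=
  \sum_(r in row_stab n la) \sum_(c in col_stab n la)
    (-1) ^+ c *: delta_mx 0 (gring_index [set: 'S_n]%G (r * c)%g).

(* The irreducible character [la] of 'S_n: the character of the Specht module,
   i.e. of the right ideal generated by the Young symmetrizer in the group
   algebra. *)
Definition specht_char (n : nat) (la : seq nat) : 'CF([set: 'S_n]) :=
  cfRepr (submod_repr
    (cyclic_mx_module (regular_repr algC [set: 'S_n]%G)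
       (young_symmetrizer n la))).

Fact cfSym2_subproof (gT : finGroupType) (G : {group gT}) (phi : 'CF(G)) :
  is_class_fun <<G>>
    [ffun g => if g \in G then (phi g ^+ 2 + phi (g ^+ 2)%g) / 2 else 0].
Proof.
rewrite genGid; apply: intro_class_fun => [x y Gx Gy | x /negPf-> //].
by rewrite groupJr // -conjXg !cfunJ.
Qed.

Definition cfSym2 (gT : finGroupType) (G : {group gT}) (phi : 'CF(G)) : 'CF(G) :=
  Cfun 0 (cfSym2_subproof phi).

Fact cfAlt2_subproof (gT : finGroupType) (G : {group gT}) (phi : 'CF(G)) :
  is_class_fun <<G>>
    [ffun g => if g \in G then (phi g ^+ 2 - phi (g ^+ 2)%g) / 2 else 0].
Proof.
rewrite genGid; apply: intro_class_fun => [x y Gx Gy | x /negPf-> //].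
by rewrite groupJr // -conjXg !cfunJ.
Qed.

Definition cfAlt2 (gT : finGroupType) (G : {group gT}) (phi : 'CF(G)) : 'CF(G) :=
  Cfun 0 (cfAlt2_subproof phi).

Definition inhomogeneous (gT : finGroupType) (G : {group gT}) (phi : 'CF(G)) :
    Prop :=
  exists i j : Iirr G,
    [/\ i \in irr_constt phi, j \in irr_constt phi & i != j].

Definition reducible (gT : finGroupType) (G : {group gT}) (phi : 'CF(G)) :
    Prop :=
  phi \notin irr G.

(* Main.v *)
Require Import Defs.
From mathcomp Require Import all_boot all_order all_algebra all_fingroup.
From mathcomp Require Import all_solvable all_field all_character.
From mathcomp Require Import ring zify.

(** Let chi be an irreducible character of the symmetric group on a set of n
    points, pi the natural permutation character and rho = pi - 1 the reflection
    character. Neither the branching rule nor the hook formula enters; the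
    argument rests on inner products of the squares with pi and its Schur
    functors.

    Every permutation is conjugate to its inverse by a permutation, a flip, that
    can be chosen to fix a given point, or to stabilize a given pair of points
    [perm_flip]. The trick of Gelfand then shows that restriction to the
    stabilizer of a point or of a pair is multiplicity free, and that all
    Frobenius-Schur indicators are 1 [gelfand_mult, cfFS_Sym]. Hence the trivial
    character occurs exactly once in S^2(chi), and S^2(chi) is homogeneous only
    if chi(1)(chi(1) + 1)/2 = 1, that is, if chi is linear
    [Sym2_inhomogeneous].

    The same facts say that A^2(chi) is orthogonal to 1, pi and S^2(pi), so that
    its product with A^2(rho) is the multiplicity of the trivial character in
    the alternating square of the restriction of chi to the stabilizer K of two
    points [Alt2_Alt2Ref]. Suppose that A^2(chi) is homogeneous.

    If the restriction of chi to a point stabilizer is reducible, two of its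
    constituents share a constituent on K, by Mackey's formula, and A^2(chi)
    contains the irreducible character A^2(rho) [Alt2_Res2_gt0]. So A^2(chi) is
    a multiple of A^2(rho). This hypothesis passes to the constituents of the
    restriction to a point stabilizer, and an induction shows that chi is one of
    1, sgn, rho and rho * sgn [irr_Alt2_Ref].

    If that restriction is irreducible, as it is for rectangular partitions,
    then the restriction to K is reducible unless chi is linear
    [irr_Res2_linear], and A^2(chi) is a multiple of A^3(rho) instead
    [Alt2_Alt3Ref_gt0]. Evaluation at 1, at a transposition and at a 3-cycle
    gives three equations for n, the factor and the three values of chi. Besides,
    the sum of the transpositions moving a given point acts as a scalar, by
    Schur's lemma, which is a fourth one [irr_Res_transposition_sum]. The only
    solutions have n = 4, or n = 6 and chi(1) = 5 [rect_numerology].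

    It remains to recognize the partition. The Specht character is irreducible,
    has a vector fixed by the row stabilizer, and a vector on which the column
    stabilizer acts by the sign [specht_irr, specht_Res_row, specht_Res_col].
    For chi = rho the sign of the column stabilizer occurs in pi, so that one
    cell belongs to all pairs of cells in a common column, which leaves the shapes
    (n) and (n-1, 1); the twist rho * sgn is the same with rows. For n = 6 each
    admissible shape contains four cells in one row or column, which a character
    of degree 5 with irreducible restriction to S_5 excludes, or is (3, 2, 1),
    where three cells in a row and three in a column give contradictory signs of
    the value at a transposition. *)

Module SpechtSquares.

Set Implicit Arguments.
Unset Strict Implicit.
Unset Printing Implicit Defensive.

Import GroupScope Order.TTheory GRing.Theory Num.Theory.
Local Open Scope ring_scope.

(** * Tensor powers as representations of G x S_k *)

Section TensorPower.

Variables (gT : finGroupType) (G : {group gT}) (d : nat).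
Variable rG : mx_representation algC G d.
Variable k : nat.

Local Notation I_ := {ffun 'I_k -> 'I_d}.
Local Notation D := (setX_group G [set: 'S_k]%G).

Let ev (a : 'I_#|{: I_}|) : I_ := enum_val a.

Let sum_ev (F : I_ -> algC) : \sum_a F (ev a) = \sum_a F a.
Proof. by rewrite [RHS](reindex ev) //; apply/onW_bij/enum_val_bij. Qed.

(** The index a stands for the basis vector of the k-th tensor power of V with
    the factors ev a i; the elements of 'S_k permute the factors. *)
Definition tensor_mx (u : gT * 'S_k) : 'M[algC]_#|{: I_}| :=
  \matrix_(a, b) \prod_i rG u.1 (ev a i) (ev b (u.2 i)).

Lemma tensor_mx_repr : mx_repr D tensor_mx.
Proof.
split=> [|[g s] [h u]].
  apply/matrixP=> a b; rewrite !mxE /= repr_mx1.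
  have [<-|ab] := eqVneq a b.
    by rewrite big1 // => i _; rewrite perm1 mxE eqxx.
  have [i abi]: exists i, ev a i != ev b i.
    apply/existsP; apply: contra_neqT ab; rewrite negb_exists => /forallP e.
    by apply: enum_val_inj; apply/ffunP=> i; apply/eqP; have /negPn := e i.
  by rewrite (bigD1 i) //= perm1 mxE (negPf abi) mul0r.
rewrite !inE !andbT /= => Gg Gh; apply/matrixP=> a c; rewrite !mxE /=.
under [RHS]eq_bigr => b _ do rewrite !mxE /=.
pose F (b : I_) := (\prod_i rG g (ev a i) (b (s i))) *
                   (\prod_i rG h (b i) (ev c (u i))).
rewrite (sum_ev F) /F repr_mxM //.
under eq_bigr => i _ do rewrite mxE permM.
rewrite bigA_distr_bigA /= (reindex (fun b : I_ => [ffun i => b (s i)])) /=.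
  apply: eq_bigr => b _.
  rewrite [X in _ = _ * X](reindex_inj (@perm_inj _ s)) /= -big_split /=.
  by apply: eq_bigr => i _; rewrite !ffunE.
exists (fun b : I_ => [ffun i => b ((s^-1)%g i)]) => b _; apply/ffunP=> i;
  by rewrite !ffunE ?permK ?permKV.
Qed.

Canonical tensor_repr := MxRepresentation tensor_mx_repr.

(** The trace of (g, s): a product of traces of powers of g, one for each cycle
    of s. *)
Definition tensor_trace g (s : 'S_k) : algC :=
  \sum_(a : I_) \prod_i rG g (a i) (a (s i)).

Lemma tensor_reprE g s : g \in G ->
  cfRepr tensor_repr (g, s) = tensor_trace g s.
Proof.
move=> Gg; rewrite cfunE inE Gg inE mulr1n /mxtrace.
under eq_bigr => a _ do rewrite mxE /=.
by rewrite (sum_ev (fun a => \prod_i rG g (a i) (a (s i)))).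
Qed.

(** This number is the multiplicity of the character (g, s) |-> psi g * kap s
    in the k-th tensor power. *)
Lemma schur_functor_nat (psi : 'CF(G)) (kap : 'CF([set: 'S_k])) :
    psi \is a character -> kap \is a character ->
  (#|G| * k`!)%:R^-1 *
    (\sum_(g in G) \sum_s tensor_trace g s * (psi g * kap s)^* ) \in Num.nat.
Proof.
move=> /char_reprP[[n1 r1] ->] /char_reprP[[n2 r2] ->] /=.
have r1P : mx_repr D (fun u => r1 u.1).
  split=> [|[g s] [h u]]; first exact: repr_mx1.
  by rewrite !inE !andbT => Gg Gh; rewrite repr_mxM.
have r2P : mx_repr D (fun u => r2 u.2).
  split=> [|[g s] [h u] _ _]; first exact: repr_mx1.
  by rewrite repr_mxM // inE.
pose R1 := MxRepresentation r1P; pose R2 := MxRepresentation r2P.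
have := Cnat_cfdot_char (cfRepr_char tensor_repr)
          (rpredM (cfRepr_char R1) (cfRepr_char R2)).
rewrite cfdotE cardsX cardsT card_Sn pair_big_dep /=.
set S1 := (X in _ * X \in _); set S2 := (X in _ -> _ * X \in _).
suff -> : S1 = S2 by [].
rewrite {}/S1 {}/S2.
apply: eq_big => -[g s]; rewrite !inE ?andbT //= => Gg.
by rewrite tensor_reprE //= cfunE !cfunE !inE Gg.
Qed.

End TensorPower.

(** * Symmetric and alternating powers of class functions *)

Section PowerMaps.

Variables (gT : finGroupType) (G : {group gT}).
Implicit Types phi psi : 'CF(G).

Fact cfPow_subproof k phi :
  is_class_fun <<G>> [ffun g => if g \in G then phi (g ^+ k)%g else 0].
Proof.
rewrite genGid; apply: intro_class_fun => [x y Gx Gy | x /negPf-> //].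
by rewrite groupJr // -conjXg !cfunJ.
Qed.

Definition cfPow k phi : 'CF(G) := Cfun 0 (cfPow_subproof k phi).

Lemma cfPowE k phi g : g \in G -> cfPow k phi g = phi (g ^+ k)%g.
Proof. by move=> Gg; rewrite cfunE Gg. Qed.

Definition cfAlt3 phi : 'CF(G) :=
  6^-1 *: (phi ^+ 3 - (phi * cfPow 2 phi) *+ 3 + cfPow 3 phi *+ 2).

Definition cfSym3 phi : 'CF(G) :=
  6^-1 *: (phi ^+ 3 + (phi * cfPow 2 phi) *+ 3 + cfPow 3 phi *+ 2).

(** The Schur functor of shape (2, 1). *)
Definition cfHook3 phi : 'CF(G) := 3^-1 *: (phi ^+ 3 - cfPow 3 phi).

Lemma cfAlt2_val phi g : g \in G ->
  cfAlt2 phi g = (phi g ^+ 2 - phi (g ^+ 2)%g) / 2.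
Proof. by move=> Gg; rewrite cfunE Gg. Qed.

Lemma cfSym2_val phi g : g \in G ->
  cfSym2 phi g = (phi g ^+ 2 + phi (g ^+ 2)%g) / 2.
Proof. by move=> Gg; rewrite cfunE Gg. Qed.

Lemma cfAlt3_val phi g : g \in G ->
  cfAlt3 phi g =
    (phi g ^+ 3 - 3 * phi g * phi (g ^+ 2)%g + 2 * phi (g ^+ 3)%g) / 6.
Proof. by move=> Gg; rewrite !cfunE /= Gg; ring. Qed.

Lemma cfSym3_val phi g : g \in G ->
  cfSym3 phi g =
    (phi g ^+ 3 + 3 * phi g * phi (g ^+ 2)%g + 2 * phi (g ^+ 3)%g) / 6.
Proof. by move=> Gg; rewrite !cfunE /= Gg; ring. Qed.

Lemma cfHook3_val phi g : g \in G ->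
  cfHook3 phi g = (phi g ^+ 3 - phi (g ^+ 3)%g) / 3.
Proof. by move=> Gg; rewrite !cfunE /= Gg; ring. Qed.

Lemma cfAlt2E phi : cfAlt2 phi = 2^-1 *: (phi ^+ 2 - cfPow 2 phi).
Proof.
by apply/cfun_inP=> g Gg; rewrite cfAlt2_val // !cfunE /= Gg; ring.
Qed.

Lemma cfSym2E phi : cfSym2 phi = 2^-1 *: (phi ^+ 2 + cfPow 2 phi).
Proof.
by apply/cfun_inP=> g Gg; rewrite cfSym2_val // !cfunE /= Gg; ring.
Qed.

Lemma cfSym2_Alt2 phi : cfSym2 phi + cfAlt2 phi = phi ^+ 2.
Proof.
by apply/cfun_inP=> g Gg; rewrite !(cfunE, Gg) /=; field.
Qed.

Lemma cfAlt2D phi psi :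
  cfAlt2 (phi + psi) = cfAlt2 phi + cfAlt2 psi + phi * psi.
Proof.
by apply/cfun_inP=> g Gg; rewrite !(cfunE, Gg) /=; field.
Qed.

Lemma cfAlt2_0 : cfAlt2 (0 : 'CF(G)) = 0.
Proof. by apply/cfun_inP=> g Gg; rewrite cfAlt2_val // !cfunE; ring. Qed.

Lemma cfAlt2_1 : cfAlt2 (1 : 'CF(G)) = 0.
Proof.
apply/cfun_inP=> g Gg; rewrite cfAlt2_val // !cfun1E groupX ?Gg // cfunE.
by rewrite expr1n subrr mul0r.
Qed.

Lemma cfAlt2D1 phi : cfAlt2 (1 + phi) = cfAlt2 phi + phi.
Proof. by rewrite cfAlt2D cfAlt2_1 add0r mul1r. Qed.

Lemma cfAlt3_0 : cfAlt3 (0 : 'CF(G)) = 0.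
Proof. by apply/cfun_inP=> g Gg; rewrite cfAlt3_val // !cfunE; ring. Qed.

Lemma cfAlt3D1 phi : cfAlt3 (1 + phi) = cfAlt3 phi + cfAlt2 phi.
Proof.
apply/cfun_inP=> g Gg; have [G2 G3] := (groupX 2 Gg, groupX 3 Gg).
rewrite [RHS]cfunE !cfAlt3_val // cfAlt2_val // !cfunE !cfun1E Gg G2 G3 /=.
by field.
Qed.

Lemma cfSym2D1 phi : cfSym2 (1 + phi) = cfSym2 phi + phi + 1.
Proof.
apply/cfun_inP=> g Gg; have G2 := groupX 2 Gg.
rewrite [RHS]cfunE [X in _ = X + _]cfunE !cfSym2_val // !cfunE !cfun1E Gg G2 /=.
by field.
Qed.

(** The Pieri decompositions of S^2(V) * V and A^2(V) * V. *)
Lemma cfSym2_mul phi : cfSym2 phi * phi = cfSym3 phi + cfHook3 phi.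
Proof.
apply/cfun_inP=> g Gg; rewrite cfunE [RHS]cfunE cfSym3_val // cfHook3_val //.
by rewrite cfSym2_val //; field.
Qed.

Lemma cfAlt2_mul phi : cfAlt2 phi * phi = cfAlt3 phi + cfHook3 phi.
Proof.
apply/cfun_inP=> g Gg; rewrite cfunE [RHS]cfunE cfAlt3_val // cfHook3_val //.
by rewrite cfAlt2_val //; field.
Qed.

End PowerMaps.

Section Restriction.

Variables (gT : finGroupType) (G H : {group gT}) (phi : 'CF(G)).
Hypothesis sHG : H \subset G.

Lemma cfRes_Alt2 : 'Res[H] (cfAlt2 phi) = cfAlt2 ('Res[H] phi).
Proof.
apply/cfun_inP=> h Hh; have Gh := subsetP sHG h Hh.
by rewrite cfResE // !cfAlt2_val // !cfResE ?groupX.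
Qed.

Lemma cfRes_Sym2 : 'Res[H] (cfSym2 phi) = cfSym2 ('Res[H] phi).
Proof.
apply/cfun_inP=> h Hh; have Gh := subsetP sHG h Hh.
by rewrite cfResE // !cfSym2_val // !cfResE ?groupX.
Qed.

Lemma cfRes_Alt3 : 'Res[H] (cfAlt3 phi) = cfAlt3 ('Res[H] phi).
Proof.
apply/cfun_inP=> h Hh; have Gh := subsetP sHG h Hh.
by rewrite cfResE // !cfAlt3_val // !cfResE ?groupX.
Qed.

End Restriction.

Section Sign.

Variables (T : finType) (G : {group {perm T}}).

Fact sign_mx_repr :
  mx_repr G (fun s : {perm T} => ((-1) ^+ s)%:M : 'M[algC]_1).
Proof.
split=> [|s t _ _]; first by rewrite odd_perm1.
by rewrite -scalar_mxM odd_permM signr_addb.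
Qed.

Definition cfSgn : 'CF(G) := cfRepr (MxRepresentation sign_mx_repr).

Lemma cfSgnE s : s \in G -> cfSgn s = (-1) ^+ s.
Proof. by move=> Gs; rewrite cfunE Gs mxtrace_scalar. Qed.

Lemma cfSgn_lin : cfSgn \is a linear_char.
Proof. by rewrite qualifE /= cfRepr_char cfRepr1 /=. Qed.

Lemma cfSgn_char : cfSgn \is a character.
Proof. exact: lin_charW cfSgn_lin. Qed.

Lemma cfSgn_sqr : cfSgn * cfSgn = 1.
Proof.
by apply/cfun_inP=> s Gs; rewrite cfunE cfSgnE // cfun1E Gs -signr_addb addbb.
Qed.

End Sign.

Lemma cfRes_Sgn (T : finType) (G H : {group {perm T}}) :
  H \subset G -> 'Res[H] (cfSgn G) = cfSgn H.
Proof.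
by move=> sHG; apply/cfun_inP=> h Hh; rewrite cfResE // !cfSgnE ?(subsetP sHG).
Qed.

Lemma cfAlt2_Sgn (T : finType) (G : {group {perm T}}) (phi : 'CF(G)) :
  cfAlt2 (phi * cfSgn G) = cfAlt2 phi.
Proof.
have E s : s \in G -> (phi * cfSgn G) s = phi s * (-1) ^+ s.
  by move=> Gs; rewrite cfunE cfSgnE.
apply/cfun_inP=> g Gg; rewrite !cfAlt2_val // !E ?groupX // exprMn sqrr_sign mulr1.
by rewrite odd_permM addbb mulr1.
Qed.

Lemma char_natP (gT : finGroupType) (G : {group gT}) (phi : 'CF(G)) :
  (forall psi, psi \is a character -> '[phi, psi] \in Num.nat) ->
  phi \is a character.
Proof. by move=> N; apply/forallP=> i; rewrite coord_cfdot N ?irr_char. Qed.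

Section SchurFunctors.

Variables (gT : finGroupType) (G : {group gT}) (d : nat).
Variable rG : mx_representation algC G d.
Local Notation phi := (cfRepr rG).

Let rGX g k : g \in G -> phi (g ^+ k)%g = \tr (rG (g ^+ k)%g).
Proof. by move=> Gg; rewrite cfunE groupX. Qed.

Let trM2 g : g \in G -> \sum_x \sum_y rG g x y * rG g y x = phi (g ^+ 2)%g.
Proof.
move=> Gg; rewrite rGX // expgS expg1 repr_mxM //.
by apply: eq_bigr => x _; rewrite mxE.
Qed.

Let trM3 g : g \in G ->
  \sum_x \sum_y \sum_z rG g x y * rG g y z * rG g z x = phi (g ^+ 3)%g.
Proof.
move=> Gg; rewrite rGX // expgSr expgS expg1 !repr_mxM ?groupM //.
apply: eq_bigr => x _; rewrite mxE exchange_big /=.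
apply: eq_bigr => z _; rewrite mxE mulr_suml.
by apply: eq_bigr.
Qed.

Lemma sum_ffun2 (F : {ffun 'I_2 -> 'I_d} -> algC) :
  \sum_a F a = \sum_x \sum_y F [ffun i => if i == ord0 then x else y].
Proof.
rewrite pair_big /= (reindex (fun u : 'I_d * 'I_d =>
   [ffun i : 'I_2 => if i == ord0 then u.1 else u.2])) //.
exists (fun a : {ffun 'I_2 -> 'I_d} => (a ord0, a ord_max)) => [[x y]|a] _ /=.
  by rewrite !ffunE.
by apply/ffunP=> -[[|[|//]] i]; rewrite ffunE /=; congr (a _); apply: val_inj.
Qed.

Lemma sum_ffun3 (F : {ffun 'I_3 -> 'I_d} -> algC) :
  \sum_a F a = \sum_x \sum_y \sum_z
     F [ffun i => if i == ord0 then x else if i == ord_max then z else y].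
Proof.
under [RHS]eq_bigr => x _ do rewrite pair_big /=.
rewrite pair_big /= (reindex (fun u : 'I_d * ('I_d * 'I_d) =>
   [ffun i : 'I_3 => if i == ord0 then u.1
                     else if i == ord_max then u.2.2 else u.2.1])) //.
exists (fun a : {ffun 'I_3 -> 'I_d} => (a ord0, (a (inord 1), a ord_max)))
  => [[x [y z]]|a] _ /=.
  by rewrite !ffunE -!val_eqE /= inordK.
by apply/ffunP=> -[[|[|[|//]]] i]; rewrite ffunE /=; congr (a _);
   apply: val_inj; rewrite /= ?inordK.
Qed.

(** * Schur functors of degree 2 and 3 *)

Let o0 : 'I_3 := ord0.
Let o1 : 'I_3 := inord 1.
Let o2 : 'I_3 := ord_max.

Let o3E : ((o0 == o1) = false) * ((o0 == o2) = false) * ((o1 == o2) = false)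
        * ((o1 == o0) = false) * ((o2 == o0) = false) * ((o2 == o1) = false).
Proof. by rewrite -!val_eqE /= inordK. Qed.

Lemma sum_ord3 (R : nmodType) (F : 'I_3 -> R) :
  \sum_i F i = F o0 + F o1 + F o2.
Proof.
rewrite !big_ord_recl big_ord0 addr0 addrA.
by congr (_ + F _ + F _); apply: val_inj; rewrite /= ?inordK.
Qed.

Lemma prod_ord3 (F : 'I_3 -> algC) :
  \prod_i F i = F o0 * F o1 * F o2.
Proof.
rewrite !big_ord_recl big_ord0 mulr1 mulrA.
by congr (_ * F _ * F _); apply: val_inj; rewrite /= ?inordK.
Qed.

Fact perm_mx3_repr : mx_repr [set: 'S_3] (@perm_mx algC 3).
Proof. by split=> [|s t _ _]; rewrite ?perm_mx1 ?perm_mxM. Qed.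

(** The two-dimensional irreducible character of 'S_3. *)
Definition std3 : 'CF([set: 'S_3]) :=
  cfRepr (MxRepresentation perm_mx3_repr) - 1.

Lemma std3E s :
  std3 s = (s o0 == o0)%:R + (s o1 == o1)%:R + (s o2 == o2)%:R - 1.
Proof.
rewrite !cfunE !inE /mxtrace sum_ord3 !mxE mulr1n.
by rewrite cfun1E inE.
Qed.

Let sel3 (R : Type) (x y z : R) (i : 'I_3) :=
  if i == o0 then x else if i == o2 then z else y.

Lemma tensor_trace3 g (s : 'S_3) :
  tensor_trace rG g s = \sum_x \sum_y \sum_z
    rG g x (sel3 x y z (s o0)) * rG g y (sel3 x y z (s o1))
      * rG g z (sel3 x y z (s o2)).
Proof.
rewrite /tensor_trace sum_ffun3; do 3!apply: eq_bigr => ? _.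
by rewrite prod_ord3 !ffunE !o3E !eqxx.
Qed.

Let t3E :
  (tperm o0 o1 o0 = o1) * (tperm o0 o1 o1 = o0) * (tperm o0 o1 o2 = o2) *
  (tperm o0 o2 o0 = o2) * (tperm o0 o2 o1 = o1) * (tperm o0 o2 o2 = o0) *
  (tperm o1 o2 o0 = o0) * (tperm o1 o2 o1 = o2) * (tperm o1 o2 o2 = o1).
Proof. by rewrite !tpermL !tpermR !tpermD ?o3E. Qed.

Lemma sum_S3 (R : nmodType) (F : 'S_3 -> R) :
  \sum_s F s = F 1%g + F (tperm o0 o1) + F (tperm o0 o2) + F (tperm o1 o2)
    + F (tperm o0 o1 * tperm o0 o2)%g + F (tperm o0 o2 * tperm o0 o1)%g.
Proof.
pose L : seq 'S_3 := [:: 1%g; tperm o0 o1; tperm o0 o2; tperm o1 o2;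
  (tperm o0 o1 * tperm o0 o2)%g; (tperm o0 o2 * tperm o0 o1)%g].
have uL : uniq L.
  apply: (@map_uniq _ _ (fun s : 'S_3 => (s o0, s o1))).
  by rewrite /= !inE !permM !perm1 !t3E !xpair_eqE !eqxx !o3E.
have memL s : s \in L.
  have e : #|L| = #|{: 'S_3}| by rewrite (card_uniqP uL) card_Sn.
  by rewrite (subset_cardP e (subset_predT _)).
rewrite (eq_bigl (fun s => s \in L)) => [|s]; last by rewrite memL.
by rewrite -big_uniq //= !big_cons big_nil addr0 !addrA.
Qed.

Lemma tensor_traces3 g : g \in G ->
  [/\ tensor_trace rG g (1 : 'S_3)%g = phi g ^+ 3,
      [/\ tensor_trace rG g (tperm o0 o1) = phi g * phi (g ^+ 2)%g,
          tensor_trace rG g (tperm o0 o2) = phi g * phi (g ^+ 2)%g &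
          tensor_trace rG g (tperm o1 o2) = phi g * phi (g ^+ 2)%g],
      tensor_trace rG g (tperm o0 o1 * tperm o0 o2)%g = phi (g ^+ 3)%g &
      tensor_trace rG g (tperm o0 o2 * tperm o0 o1)%g = phi (g ^+ 3)%g].
Proof.
move=> Gg; rewrite -trM2 // -trM3 //.
have -> : phi g = \sum_x rG g x x by rewrite cfunE Gg.
rewrite !tensor_trace3 !permM !perm1 !t3E /sel3 !o3E !eqxx; split.
- rewrite !exprS expr0 mulr1 mulr_suml; apply: eq_bigr => x _.
  rewrite mulr_suml mulr_sumr; apply: eq_bigr => y _.
  by rewrite !mulr_sumr; apply: eq_bigr => z _; rewrite mulrA.
- split.
  + rewrite mulrC mulr_suml; apply: eq_bigr => x _; rewrite mulr_suml.
    by apply: eq_bigr => y _; rewrite mulr_sumr.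
  + rewrite mulrC mulr_suml; apply: eq_bigr => x _; rewrite exchange_big mulr_suml.
    apply: eq_bigr => z _; rewrite mulr_sumr.
    by apply: eq_bigr => y _; rewrite mulrAC.
  + rewrite mulr_suml; apply: eq_bigr => x _; rewrite mulr_sumr.
    apply: eq_bigr => y _; rewrite mulr_sumr.
    by apply: eq_bigr => z _; rewrite mulrA.
- by [].
apply: eq_bigr => x _; rewrite exchange_big; apply: eq_bigr => z _.
by apply: eq_bigr => y _; rewrite mulrAC.
Qed.

Lemma tensor_traces2 g : g \in G ->
  tensor_trace rG g (1 : 'S_2)%g = phi g ^+ 2 /\
  tensor_trace rG g (tperm ord0 ord_max : 'S_2) = phi (g ^+ 2)%g.
Proof.
move=> Gg; rewrite -trM2 //.
have -> : phi g = \sum_x rG g x x by rewrite cfunE Gg.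
rewrite /tensor_trace !sum_ffun2; split.
  rewrite expr2 mulr_suml; apply: eq_bigr => x _; rewrite mulr_sumr.
  apply: eq_bigr => y _.
  by rewrite !big_ord_recl big_ord0 mulr1 !perm1 !ffunE.
apply: eq_bigr => x _; apply: eq_bigr => y _.
rewrite !big_ord_recl big_ord0 mulr1 tpermL.
by rewrite [lift _ _](_ : _ = ord_max) ?tpermR ?ffunE //; apply: val_inj.
Qed.

Lemma sum_S2 (R : nmodType) (F : 'S_2 -> R) :
  \sum_s F s = F 1%g + F (tperm ord0 ord_max).
Proof.
pose L : seq 'S_2 := [:: 1%g; tperm ord0 ord_max].
have uL : uniq L.
  apply: (@map_uniq _ _ (fun s : 'S_2 => s ord0)).
  by rewrite /= inE perm1 tpermL.
have memL s : s \in L.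
  have e : #|L| = #|{: 'S_2}| by rewrite (card_uniqP uL) card_Sn.
  by rewrite (subset_cardP e (subset_predT _)).
rewrite (eq_bigl (fun s => s \in L)) => [|s]; last by rewrite memL.
by rewrite -big_uniq //= !big_cons big_nil addr0.
Qed.

(** Phi is the character of Hom_'S_k(kap, V^k), so its multiplicities are those
    of the products of irreducible characters with kap in the tensor power. *)
Lemma schur_functor_char k (kap : 'CF([set: 'S_k])) (Phi : 'CF(G)) :
    kap \is a character ->
    (forall g, g \in G ->
      Phi g = (k`!)%:R^-1 * \sum_s tensor_trace rG g s * (kap s)^*) ->
  Phi \is a character.
Proof.
move=> Nk E; apply: char_natP => psi Npsi.
have := schur_functor_nat rG Npsi Nk.
rewrite cfdotE natrM invfM -mulrA mulr_sumr.
set S1 := (X in _ * X \in _); set S2 := (X in _ -> _ * X \in _).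
suff -> : S1 = S2 by [].
rewrite {}/S1 {}/S2; apply: eq_bigr => g Gg; rewrite E // -mulrA; congr (_ * _).
by rewrite mulr_suml; apply: eq_bigr => s _; rewrite rmorphM /=; ring.
Qed.

Let kapE (xi : 'CF([set: 'S_2])) g : g \in G ->
  \sum_s tensor_trace rG g s * (xi s)^* =
    phi g ^+ 2 * (xi 1%g)^* + phi (g ^+ 2)%g * (xi (tperm ord0 ord_max))^*.
Proof. by move=> Gg; rewrite sum_S2; have [-> ->] := tensor_traces2 Gg. Qed.

Let fact2 : 2`! = 2%N. Proof. by []. Qed.
Let fact3 : 3`! = 6%N. Proof. by []. Qed.

Lemma cfSym2_repr_char : cfSym2 phi \is a character.
Proof.
apply: (schur_functor_char (cfun1_char [set: 'S_2]%G)) => g Gg.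
by rewrite kapE // cfSym2_val // fact2 !cfun1E !inE rmorph1 !mulr1 mulrC.
Qed.

Lemma cfAlt2_repr_char : cfAlt2 phi \is a character.
Proof.
apply: (schur_functor_char (cfSgn_char [set: 'S_2]%G)) => g Gg.
rewrite kapE // cfAlt2_val // fact2 !cfSgnE ?inE // odd_perm1 odd_tperm /=.
by rewrite expr0 expr1 rmorphN !rmorph1; field.
Qed.

Let kapE3 (xi : 'CF([set: 'S_3])) g : g \in G ->
  \sum_s tensor_trace rG g s * (xi s)^* =
    phi g ^+ 3 * (xi 1%g)^*
    + phi g * phi (g ^+ 2)%g * (xi (tperm o0 o1))^*
    + phi g * phi (g ^+ 2)%g * (xi (tperm o0 o2))^*
    + phi g * phi (g ^+ 2)%g * (xi (tperm o1 o2))^*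
    + phi (g ^+ 3)%g * (xi (tperm o0 o1 * tperm o0 o2)%g)^*
    + phi (g ^+ 3)%g * (xi (tperm o0 o2 * tperm o0 o1)%g)^*.
Proof.
by move=> Gg; rewrite sum_S3; have [-> [-> -> ->] -> ->] := tensor_traces3 Gg.
Qed.

Lemma cfSym3_repr_char : cfSym3 phi \is a character.
Proof.
apply: (schur_functor_char (cfun1_char [set: 'S_3]%G)) => g Gg.
by rewrite kapE3 // fact3 cfSym3_val // !cfun1E !inE rmorph1 !mulr1; field.
Qed.

Lemma cfAlt3_repr_char : cfAlt3 phi \is a character.
Proof.
apply: (schur_functor_char (cfSgn_char [set: 'S_3]%G)) => g Gg.
rewrite kapE3 // fact3 cfAlt3_val // !cfSgnE ?inE // odd_perm1 !odd_permM !odd_tperm.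
by rewrite !o3E /= expr0 expr1 rmorphN !rmorph1; field.
Qed.

Lemma std3_char : std3 \is a character.
Proof.
have N := cfRepr_char (MxRepresentation perm_mx3_repr).
have [|chi Nchi E] := constt_charP 0 N _; last first.
  by rewrite /std3 E irr0 addrC addKr.
rewrite inE irr0 -(subrK 1 (cfRepr _)) -/std3 cfdotDl cfnorm1.
rewrite cfdotE (eq_bigl _ _ (in_set _)) sum_S3 !cfun1E !inE !rmorph1 !mulr1.
rewrite !std3E !permM !perm1 !t3E !eqxx !o3E /= [X in _ * X](_ : _ = 0) ?mulr0.
  by rewrite add0r oner_eq0.
by ring.
Qed.

Lemma cfHook3_repr_char : cfHook3 phi \is a character.
Proof.
apply: (schur_functor_char std3_char) => g Gg.
rewrite kapE3 // fact3 cfHook3_val // !std3E.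
by rewrite !permM !perm1 !t3E !eqxx !o3E /=; field.
Qed.

End SchurFunctors.

Section SchurFunctorChars.

Variables (gT : finGroupType) (G : {group gT}) (phi : 'CF(G)).
Hypothesis Nphi : phi \is a character.

Lemma cfSym2_char : cfSym2 phi \is a character.
Proof. by have /char_reprP[[d rG] ->] := Nphi; exact: cfSym2_repr_char. Qed.

Lemma cfAlt2_char : cfAlt2 phi \is a character.
Proof. by have /char_reprP[[d rG] ->] := Nphi; exact: cfAlt2_repr_char. Qed.

Lemma cfSym3_char : cfSym3 phi \is a character.
Proof. by have /char_reprP[[d rG] ->] := Nphi; exact: cfSym3_repr_char. Qed.

Lemma cfAlt3_char : cfAlt3 phi \is a character.
Proof. by have /char_reprP[[d rG] ->] := Nphi; exact: cfAlt3_repr_char. Qed.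

Lemma cfHook3_char : cfHook3 phi \is a character.
Proof. by have /char_reprP[[d rG] ->] := Nphi; exact: cfHook3_repr_char. Qed.

End SchurFunctorChars.

(** * Frobenius-Schur indicators and restriction without multiplicities *)

Section FrobeniusSchur.

Variables (gT : finGroupType) (G : {group gT}).
Implicit Type phi : 'CF(G).

(** The Frobenius-Schur indicator. *)
Definition cfFS phi : algC := '[cfPow 2 phi, 1].

Lemma cfFSE phi : cfFS phi = #|G|%:R^-1 * \sum_(g in G) phi (g ^+ 2)%g.
Proof.
rewrite /cfFS cfdotE; congr (_ * _); apply: eq_bigr => g Gg.
by rewrite cfPowE // cfun1E Gg rmorph1 mulr1.
Qed.

Lemma cfdot_mul1 phi psi : '[phi * psi, 1] = '[phi, psi^*%CF].
Proof.
rewrite !cfdotE; congr (_ * _); apply: eq_bigr => g Gg.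
by rewrite !cfunE cfun1E Gg rmorph1 mulr1 conjCK.
Qed.

Lemma cfdot_mulA phi psi xi : '[phi * psi, xi] = '[phi, xi * psi^*%CF].
Proof.
rewrite !cfdotE; congr (_ * _); apply: eq_bigr => g Gg.
by rewrite !cfunE rmorphM /= conjCK -mulrA [X in _ * X]mulrC.
Qed.

Lemma cfFS_sum phi :
  phi \is a character -> cfFS phi = \sum_i '[phi, 'chi_i] * cfFS 'chi_i.
Proof.
move=> Nphi; rewrite !cfFSE mulr_sumr.
under [RHS]eq_bigr => i _ do rewrite cfFSE mulrCA mulr_sumr mulr_sumr.
rewrite exchange_big /=; apply: eq_bigr => g Gg.
rewrite {1}[phi]cfun_sum_cfdot sum_cfunE mulr_sumr.
by apply: eq_bigr => i _; rewrite cfunE.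
Qed.

Lemma cfSym2_dot1 phi : '[cfSym2 phi, 1] = ('[phi, phi^*%CF] + cfFS phi) / 2.
Proof. by rewrite cfSym2E cfdotZl cfdotDl expr2 cfdot_mul1 mulrC. Qed.

Lemma cfAlt2_dot1 phi : '[cfAlt2 phi, 1] = ('[phi, phi^*%CF] - cfFS phi) / 2.
Proof. by rewrite cfAlt2E cfdotZl cfdotBl expr2 cfdot_mul1 mulrC. Qed.

(** The symmetric and the alternating square of an irreducible character
    contain the trivial character at most once together, and the indicator is
    the difference of the two multiplicities. *)
Lemma cfFS_irr i : cfFS 'chi[G]_i \in [:: -1; 0; 1].
Proof.
have /natrP[s Es] := Cnat_cfdot_char (cfSym2_char (irr_char i)) (cfun1_char G).
have /natrP[a Ea] := Cnat_cfdot_char (cfAlt2_char (irr_char i)) (cfun1_char G).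
have E : cfFS 'chi_i = s%:R - a%:R.
  by rewrite -Es -Ea cfSym2_dot1 cfAlt2_dot1; field.
have : s%:R + a%:R = '['chi_i, ('chi_i)^*%CF].
  by rewrite -Es -Ea cfSym2_dot1 cfAlt2_dot1; field.
rewrite -conjC_IirrE cfdot_irr -natrD => /eqP; rewrite eqr_nat => /eqP sa.
have : (s + a <= 1)%N by rewrite sa leq_b1.
rewrite E; case: s {Es E sa} => [|[|s]]; case: a {Ea} => [|[|a]] //= _;
  by rewrite ?subr0 ?sub0r ?inE ?eqxx ?orbT.
Qed.

End FrobeniusSchur.

Section RealGroup.

Variables (gT : finGroupType) (G H : {group gT}).
Hypothesis sHG : H \subset G.
Hypothesis flipP : forall g, g \in G -> exists2 h, h \in H & (g ^ h = g^-1)%g.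

Lemma flip_real (phi : 'CF(G)) : phi \is a character -> (phi^*)%CF = phi.
Proof.
move=> Nphi; apply/cfun_inP=> g Gg; rewrite cfunE /= -char_inv //.
by have [h Hh <-] := flipP Gg; rewrite cfunJ // (subsetP sHG).
Qed.

Definition cfRoot2 : 'CF(G) := \sum_i cfFS 'chi[G]_i *: 'chi_i.

Lemma cfRoot2E x : x \in G ->
  cfRoot2 x = #|[set g in G | (g ^+ 2 == x)%g]|%:R.
Proof.
have sub : is_class_fun <<G>>
    [ffun x => if x \in G then #|[set g in G | (g ^+ 2 == x)%g]|%:R
               else 0 : algC].
  rewrite genGid; apply: intro_class_fun => [y z Gy Gz | y /negPf-> //].
  rewrite groupJr // Gy; congr _%:R.
  rewrite -[RHS](card_imset _ (conjg_inj z)); apply: eq_card => g.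
  apply/idP/imsetP => [|[u]]; rewrite !inE; last first.
    by case/andP=> Gu /eqP<- ->; rewrite groupJ //= -conjXg.
  case/andP=> Gg /eqP Eg; exists (g ^ z^-1)%g; last by rewrite conjgKV.
  by rewrite inE groupJ ?groupV //= -conjXg Eg conjgK.
pose r : 'CF(G) := Cfun 0 sub.
have rE y : y \in G -> r y = #|[set g in G | (g ^+ 2 == y)%g]|%:R.
  by move=> Gy; rewrite cfunE Gy.
move=> Gx; rewrite -rE //; congr (fun_of_cfun _ x).
rewrite [r]cfun_sum_cfdot; apply: eq_bigr => i _; congr (_ *: _).
rewrite cfdotC cfFSE cfdotE rmorphM /= fmorphV rmorph_nat; congr (_ * _).
rewrite rmorph_sum /= (partition_big (fun g => g ^+ 2)%g [in G]) /=; last first.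
  by move=> g Gg; rewrite groupX.
apply: eq_bigr => y Gy; rewrite rE // rmorphM /= conjCK.
rewrite mulrC -sumr_const mulr_suml; apply: eq_big => [g|g /andP[_ /eqP->]].
  by rewrite inE.
by rewrite mul1r -{1}(flip_real (irr_char i)) cfunE.
Qed.

Lemma card_flip u : u \in G ->
  #|[set h in H | (u ^ h == u^-1)%g]| = #|[set h in H | (u ^ h == u)%g]|.
Proof.
move=> /flipP[k Hk Ek]; rewrite -[RHS](card_imset _ (mulIg k)).
apply: eq_card => h; apply/idP/imsetP => [|[v]]; rewrite !inE.
  case/andP=> Hh /eqP Eh; exists (h * k^-1)%g; last by rewrite mulgKV.
  by rewrite inE groupM ?groupV //= conjgM Eh -Ek conjgK.
by case/andP=> Hv /eqP Ev ->; rewrite groupM //= conjgM Ev Ek.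
Qed.

(** Up to the factor 1/|H|, the left side counts the pairs (g, h) in G x H with
    g ^ h = g, by the second orthogonality relation. The flips turn these into
    pairs with g ^ h = g^-1, that is, with (g * h) ^ 2 = h ^ 2, and the right
    side counts the square roots of the elements h ^ 2. *)
Lemma sum_Res_norm_FS :
  \sum_i '['Res[H] 'chi[G]_i] =
    \sum_i cfFS 'chi[G]_i * cfFS ('Res[H] 'chi[G]_i).
Proof.
under eq_bigr => i _ do rewrite cfdotE.
under [RHS]eq_bigr => i _ do rewrite (cfFSE ('Res[H] _)) mulrCA mulr_sumr.
rewrite -!mulr_sumr; congr (_ * _); rewrite exchange_big [RHS]exchange_big /=.
transitivity (\sum_(h in H) #|[set g in G | (g ^ h == g)%g]|%:R : algC).
  apply: eq_bigr => h Hh; have Gh := subsetP sHG h Hh.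
  under eq_bigr => i _ do rewrite cfResE //.
  rewrite second_orthogonality_relation // class_refl mulr1n; congr _%:R.
  apply: eq_card => g; rewrite in_setI [RHS]in_set; congr (_ && _).
  by rewrite cent1E conjgC (inj_eq (mulgI h)).
transitivity (\sum_(h in H) #|[set u in G | (u ^ h == u^-1)%g]|%:R : algC).
  rewrite -!natr_sum; congr _%:R.
  under eq_bigr => h _ do rewrite -sum1dep_card big_mkcondr /=.
  under [RHS]eq_bigr => h _ do rewrite -sum1dep_card big_mkcondr /=.
  rewrite exchange_big [RHS]exchange_big /=; apply: eq_bigr => u Gu.
  by rewrite -!big_mkcondr !sum1dep_card card_flip.
apply: eq_bigr => h Hh; have Gh := subsetP sHG h Hh.
(* The square roots of h ^ 2 are the products u * h with u ^ h = u^-1. *)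
transitivity (cfRoot2 (h ^+ 2)%g); last first.
  rewrite /cfRoot2 sum_cfunE; apply: eq_bigr => i _.
  by rewrite cfunE cfResE ?groupX.
rewrite cfRoot2E ?groupX //; congr _%:R; rewrite -[RHS](card_imset _ (mulIg h^-1)%g).
apply: eq_card => u; apply/idP/imsetP => [|[v]]; rewrite !inE.
  case/andP=> Gu /eqP Eu; exists (u * h)%g; last by rewrite mulgK.
  rewrite inE groupM //= expgS expg1 [X in (X * _)%g]conjgC Eu -mulgA.
  by rewrite mulKg.
case/andP=> Gv /eqP Ev ->; rewrite groupM ?groupV //= conjgE.
rewrite invMg invgK mulgKV -(inj_eq (mulgI h)) mulKVg mulgA.
by rewrite -{1}[h]expg1 -expgSr -Ev expgSr expg1 mulgK.
Qed.

(** Both sides of [sum_Res_norm_FS] are sums over pairs of irreducible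
    characters, with multiplicity m contributing m^2 on the left and at most m
    on the right; so every multiplicity is at most 1. *)
Lemma gelfand_mult i j : j \in irr_constt ('Res[H] 'chi[G]_i) ->
  '['Res[H] 'chi[G]_i, 'chi_j] = 1 /\ cfFS 'chi_i * cfFS 'chi_j = 1.
Proof.
pose m i j := '['Res[H] 'chi[G]_i, 'chi_j].
have Nm i' j' : m i' j' \in Num.nat by rewrite Cnat_cfdot_char_irr ?cfRes_char ?irr_char.
pose e i' j' := cfFS 'chi[G]_i' * cfFS 'chi[H]_j'.
have e1 i' j' : e i' j' \in [:: -1; 0; 1].
  rewrite /e; move: (cfFS_irr i') (cfFS_irr j'); rewrite !inE.
  by do 2![case/or3P=> /eqP->]; rewrite ?(mulr0, mul0r, mulr1, mul1r, mulrNN, eqxx, orbT).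
(* A natural number m and a sign or zero e satisfy m e <= m ^ 2. *)
have ge0 i' j' : 0 <= m i' j' * (m i' j' - e i' j').
  have /natrP[k ->] := Nm i' j'; move: (e1 i' j'); rewrite !inE.
  case: k => [|k]; first by rewrite mul0r.
  case/or3P=> /eqP->; rewrite mulr_ge0 ?ler0n // subr_ge0 ?ler1n ?ler0n //.
  exact: le_trans (lerN10 _) (ler0n _ _).
have S0 : \sum_i' \sum_j' m i' j' * (m i' j' - e i' j') = 0.
  transitivity (\sum_i' ('['Res[H] 'chi[G]_i']
                   - cfFS 'chi[G]_i' * cfFS ('Res[H] 'chi[G]_i'))).
    apply: eq_bigr => i' _; have Ni := cfRes_char H (irr_char i').
    rewrite cfdot_char_r // (cfFS_sum Ni) mulr_sumr -sumrB.
    by apply: eq_bigr => j' _; rewrite /e /m; ring.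
  by rewrite sumrB sum_Res_norm_FS subrr.
have /psumr_eq0P/(_ S0 i isT) S1 i' : xpredT i' ->
    0 <= \sum_j' m i' j' * (m i' j' - e i' j') by rewrite sumr_ge0.
have /psumr_eq0P/(_ S1 j isT)/eqP : forall j', xpredT j' ->
    0 <= m i j' * (m i j' - e i j') by [].
rewrite mulf_eq0 inE -/(m i j) => /orP[-> // | /[swap] m0].
rewrite subr_eq0 => /eqP mE.
have m1 : m i j = 1.
  move: (e1 i j) (natr_ge0 (Nm i j)) m0; rewrite -mE !inE.
  by case/or3P=> /eqP->; rewrite ?eqxx // oppr_ge0 ler10.
by split; rewrite // -/(e i j) -mE m1.
Qed.

(** In the square of a multiplicity free sum of real characters, the trivial
    character comes from the squares of the summands, and by [gelfand_mult]
    these have indicator 1, so that it lies in the symmetric square. *)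
Lemma gelfand_Alt2_dot1 (chi : 'CF(G)) :
    (forall i, cfFS 'chi[G]_i = 1) -> chi \in irr G ->
  '[cfAlt2 ('Res[H] chi), 1] = 0.
Proof.
move=> FS1 /irrP[i ->]; have Ni := cfRes_char H (irr_char i).
rewrite cfAlt2_dot1 (cfAutRes _ H) flip_real ?irr_char //.
rewrite (cfFS_sum Ni) cfdot_char_r // -sumrB big1 ?mul0r // => j _.
have [-> | m0] := eqVneq '['Res[H] 'chi_i, 'chi_j] 0; first by rewrite !mul0r subrr.
by have [-> e1] := gelfand_mult m0; rewrite FS1 mul1r in e1; rewrite e1 subrr.
Qed.

End RealGroup.

(** * Flips of a permutation *)

Section Flip.

Variable T : finType.
Implicit Types (g h : {perm T}) (A : {set T}).

(** A permutation is inverted by the reflections of its cycles. In a cycle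
    choose two points r and s; the reflection sends (g ^+ i) r to (g ^- i) s.
    If x and y lie on one cycle, then r = x and s = y there, and x and y are
    exchanged; otherwise r = s = x on the cycle of x and r = s = y on that of
    y. *)
Lemma perm_flip g x y : exists h, [/\ (g ^ h = g^-1)%g,
  forall z, g z = z -> h z = z & h x = x /\ h y = y \/ h x = y /\ h y = x].
Proof.
pose r z := if x \in porbit g z then x else
            if y \in porbit g z then y else odflt z [pick w in porbit g z].
pose s z := if y \in porbit g z then y else
            if x \in porbit g z then x else odflt z [pick w in porbit g z].
have rin z : r z \in porbit g z.
  rewrite /r; do 2!case: ifP => // _.
  by case: pickP => //= _; apply: porbit_id.
have sin z : s z \in porbit g z.
  rewrite /s; do 2!case: ifP => // _.
  by case: pickP => //= _; apply: porbit_id.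
have pick_orb z w : porbit g z = porbit g w ->
    odflt z [pick u in porbit g z] = odflt w [pick u in porbit g w].
  by move=> ->; case: pickP => // /(_ w); rewrite porbit_id.
have rC z w : porbit g z = porbit g w -> r z = r w.
  by move=> E; rewrite /r (pick_orb _ _ E) E.
have sC z w : porbit g z = porbit g w -> s z = s w.
  by move=> E; rewrite /s (pick_orb _ _ E) E.
have ex z : exists i, ((g ^+ i)%g (r z) == z).
  have : z \in porbit g (r z) by rewrite porbit_sym.
  by case/porbitP=> i Ei; exists i; rewrite -Ei.
pose k z := xchoose (ex z).
have kE z : (g ^+ k z)%g (r z) = z by apply/eqP/(xchooseP (ex z)).
pose hf z := ((g^-1) ^+ k z)%g (s z).
have orbr z : porbit g (r z) = porbit g z.
  by apply/eqP; rewrite eq_porbit_mem.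
have orbs z : porbit g (s z) = porbit g z.
  by apply/eqP; rewrite eq_porbit_mem.
have orbh z : porbit g (hf z) = porbit g z.
  by rewrite -[RHS]orbs -[LHS]porbitV -[RHS]porbitV /hf porbit_perm.
have gC i j z : (g ^+ i)%g ((g ^+ j)%g z) = (g ^+ j)%g ((g ^+ i)%g z).
  by rewrite -!permM -!expgD addnC.
have hfE i z : (g ^+ i)%g (r z) = z -> hf z = ((g^-1) ^+ i)%g (s z).
  move=> Ei; rewrite /hf !expgVn.
  have /porbitP[m ->] : s z \in porbit g (r z).
    by rewrite -eq_porbit_mem orbr orbs.
  apply: (@perm_inj _ (g ^+ i * g ^+ k z)%g).
  by rewrite !permM permKV (gC _ i) permKV !(gC _ m) kE Ei.
have hinj : injective hf.
  move=> z w E; have orbE : porbit g z = porbit g w by rewrite -orbh E orbh.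
  have zE : z = (g ^+ k z)%g (r w) by rewrite -(rC _ _ orbE) kE.
  move: E; rewrite /hf (sC _ _ orbE) !expgVn => E.
  have /porbitP[m rE] : r w \in porbit g (s w).
    by rewrite -eq_porbit_mem orbr orbs.
  rewrite zE -[RHS]kE rE !(gC _ m); congr (_ _).
  have := congr1 (g ^+ k z * g ^+ k w)%g E.
  by rewrite !permM permKV (gC _ (k z)) permKV => ->.
pose h := perm hinj; have hE z : h z = hf z by rewrite permE.
exists h; split=> [|z gz|].
- apply: (mulgI h); rewrite mulgA mulgV mul1g; apply/permP=> z.
  rewrite !permM !hE.
  have orbg : porbit g (g z) = porbit g z by rewrite (porbit_perm g 1).
  rewrite (hfE (k z).+1) ?(rC _ _ orbg); last by rewrite expgSr permM kE.
  by rewrite (sC _ _ orbg) expgSr permM.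
- have fixz w : w \in porbit g z -> w = z.
    by case/porbitP=> i ->; exact: permX_fix.
  by rewrite hE; apply: fixz; rewrite -eq_porbit_mem orbh.
have rx : r x = x by rewrite /r porbit_id.
have sy : s y = y by rewrite /s porbit_id.
have hsr z : r z = z -> h z = s z.
  by move=> rz; rewrite hE (hfE 0%N) ?expg0 ?perm1.
case xy: (y \in porbit g x); [right | left].
  have sx : s x = y by rewrite /s xy.
  split; first by rewrite hsr.
  have /porbitP[i Ei] := xy.
  have ry : r y = x by rewrite /r porbit_sym xy.
  by rewrite hE (hfE i) ?ry // sy [in LHS]Ei expgVn permK.
have yx : x \in porbit g y = false by rewrite porbit_sym.
split; rewrite hsr // /s /r ?xy ?yx porbit_id //.
Qed.

End Flip.

(** * Symmetric groups of subsets and stabilizers of points and pairs *)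

(** By transitivity, each i in X contributes as much as i0 after conjugation.
    This is Frobenius reciprocity for permutation characters. *)
Lemma sum_transitive (gT : finGroupType) (G : {group gT}) (I : finType)
    (X : {set I}) (Q : gT -> I -> bool) (i0 : I) (theta : 'CF(G)) :
    (forall i, i \in X ->
       exists2 y, y \in G & forall g, g \in G -> Q (g ^ y)%g i0 = Q g i) ->
  \sum_(g in G) theta g * (\sum_(i in X) Q g i)%:R =
    #|X|%:R * \sum_(g in G | Q g i0) theta g.
Proof.
move=> trX; under eq_bigr => g _ do rewrite natr_sum mulr_sumr.
rewrite exchange_big /= -sum1_card natr_sum mulr_suml; apply: eq_bigr => i Xi.
rewrite mul1r; have [y Gy Qy] := trX i Xi.
rewrite [RHS](reindex_inj (conjg_inj y)) /= [RHS]big_mkcondr.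
rewrite [RHS](eq_bigl [in G]) => [|g]; last by rewrite groupJr.
apply: eq_bigr => g Gg.
by rewrite Qy // cfunJ //; case: ifP => _; rewrite ?mulr1 ?mulr0.
Qed.

Notation SymOn A := (perm.Sym_group A).

Section SymTheory.

Variable T : finType.
Implicit Types (A B : {set T}) (g h : {perm T}).

Lemma SymP A g : reflect (forall z, z \notin A -> g z = z) (g \in SymOn A).
Proof.
rewrite inE; apply: (iffP subsetP) => [sub z | fix_z z]; rewrite ?inE.
  by apply: contraNeq => gz; apply: sub.
by apply: contraNT => /fix_z ->.
Qed.

Lemma SymS A B : B \subset A -> SymOn B \subset SymOn A.
Proof.
move=> sBA; apply/subsetP=> g /SymP gB; apply/SymP=> z zA.
by apply: gB; apply: contra zA; apply: (subsetP sBA).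
Qed.

Lemma SymSD1 A x : SymOn (A :\ x) \subset SymOn A.
Proof. exact/SymS/subD1set. Qed.

Lemma SymD1 A x g : (g \in SymOn (A :\ x)) = (g \in SymOn A) && (g x == x).
Proof.
apply/SymP/andP => [gAx | [/SymP gA /eqP gx] z].
  split; last by apply/eqP/gAx; rewrite !inE eqxx.
  by apply/SymP=> z zA; apply: gAx; rewrite !inE negb_and zA orbT.
by rewrite !inE negb_and negbK => /orP[/eqP-> | /gA].
Qed.

Lemma Sym_stab A g x : g \in SymOn A -> (g x \in A) = (x \in A).
Proof.
move=> /SymP gA; case xA: (x \in A); last by rewrite gA ?xA.
apply: contraTT (xA) => gxA; suff <- : g x = x by [].
by apply: (@perm_inj _ g); rewrite gA.
Qed.

Lemma tperm_Sym A x y : x \in A -> y \in A -> tperm x y \in SymOn A.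
Proof.
by move=> xA yA; apply/SymP=> z zA; rewrite tpermD //; apply: contraNneq zA => <-.
Qed.

Lemma flip_Sym1 A x g : g \in SymOn A ->
  exists2 h, h \in SymOn (A :\ x) & (g ^ h = g^-1)%g.
Proof.
move=> /SymP gA; have [h [gh fixh hx]] := perm_flip g x x.
exists h => //; rewrite SymD1; apply/andP; split; last by case: hx => -[->].
by apply/SymP=> z /gA/fixh.
Qed.

Lemma flip_Sym A g : g \in SymOn A -> exists2 h, h \in SymOn A & (g ^ h = g^-1)%g.
Proof.
have [->|[x xA]] := set_0Vmem A.
  move=> gA; have /= := gA; rewrite inE => /perm_on_id-> //; last by rewrite cards0.
  by exists 1%g; rewrite ?group1 // conj1g invg1.
by case/(@flip_Sym1 A x) => h /(subsetP (SymSD1 A x)); exists h.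
Qed.

Definition pair_stab A x y : {set {perm T}} :=
  [set g in SymOn A | [set g x; g y] == [set x; y]].

Lemma in_pair_stab A x y g :
  (g \in pair_stab A x y) = (g \in SymOn A) && ([set g x; g y] == [set x; y]).
Proof. exact: in_set. Qed.

Lemma pair_stabP A x y g : reflect
  (g \in SymOn A /\ (g x = x /\ g y = y \/ g x = y /\ g y = x))
  (g \in pair_stab A x y).
Proof.
apply: (iffP setIdP) => [[Ag /eqP E]|[Ag E]]; split=> //; last first.
  by case: E => -[-> ->] //; rewrite setUC.
have: g x \in [set x; y] by rewrite -E set21.
have: g y \in [set x; y] by rewrite -E set22.
have [<-|xy] := eqVneq x y; first by rewrite !inE !orbb => /eqP-> _; left.
have: g x != g y by rewrite (inj_eq perm_inj).
by rewrite !inE => /[swap] /pred2P[]-> /[swap] /pred2P[]->; rewrite ?eqxx; auto.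
Qed.

Lemma pair_stab_group_set A x y : group_set (pair_stab A x y).
Proof.
apply/group_setP; split=> [|g h /pair_stabP[Ag gE] /pair_stabP[Ah hE]].
  by apply/pair_stabP; rewrite group1 !perm1; auto.
apply/pair_stabP; rewrite groupM // !permM; split=> //.
by case: gE => -[-> ->]; case: hE => -[-> ->]; auto.
Qed.
Canonical pair_stab_group A x y := Group (pair_stab_group_set A x y).

Lemma pair_stab_sub A x y : pair_stab A x y \subset SymOn A.
Proof. by apply/subsetP=> g /pair_stabP[]. Qed.

Lemma flip_pair A x y g : g \in SymOn A ->
  exists2 h, h \in pair_stab A x y & (g ^ h = g^-1)%g.
Proof.
move=> /SymP gA; have [h [gh fixh hE]] := perm_flip g x y.
exists h => //; apply/pair_stabP; split; last by case: hE; auto.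
by apply/SymP=> z /gA/fixh.
Qed.

Lemma char_Sym_real A (phi : 'CF(SymOn A)) :
  phi \is a character -> (phi^*)%CF = phi.
Proof. exact: flip_real (subxx _) (@flip_Sym A) _. Qed.

(** By induction on the size of A, since the restriction of an irreducible
    character to a point stabilizer has a constituent. *)
Lemma cfFS_Sym A i : cfFS 'chi[SymOn A]_i = 1.
Proof.
move: {2}#|A| (erefl #|A|) => n; elim: n A i => [|n IHn] A i cA.
  have G1 g : g \in SymOn A -> g = 1%g.
    by rewrite inE => /perm_on_id-> //; rewrite cA.
  have lin : 'chi_i \is a linear_char.
    by apply/char_abelianP/centsP => g /G1-> h /G1->.
  rewrite cfFSE (eq_bigr (fun=> 1)) => [|g /G1->].
    by rewrite sumr_const mulr_natr -mulr_natl mulrC mulVf ?neq0CG.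
  by rewrite expg1n lin_char1.
have [x xA] : exists x, x \in A by apply/set0Pn; rewrite -card_gt0 cA.
have [j ij] := constt_cfRes_irr (SymOn (A :\ x)) i.
have [_] := gelfand_mult (SymSD1 A x) (@flip_Sym1 A x) ij.
by rewrite (IHn _ j) ?mulr1 //; move: cA; rewrite (cardsD1 x) xA => -[].
Qed.

Lemma Alt2_point_dot1 A x (chi : 'CF(SymOn A)) : chi \in irr (SymOn A) ->
  '[cfAlt2 ('Res[SymOn (A :\ x)] chi), 1] = 0.
Proof.
exact: gelfand_Alt2_dot1 (SymSD1 A x) (@flip_Sym1 A x) _ (@cfFS_Sym A).
Qed.

Lemma Alt2_pair_dot1 A x y (chi : 'CF(SymOn A)) : chi \in irr (SymOn A) ->
  '[cfAlt2 ('Res[pair_stab_group A x y] chi), 1] = 0.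
Proof.
exact: gelfand_Alt2_dot1 (pair_stab_sub A x y) (@flip_pair A x y) _ (@cfFS_Sym A).
Qed.

Lemma Res_point_mult1 A x (chi : 'CF(SymOn A)) j : chi \in irr (SymOn A) ->
  j \in irr_constt ('Res[SymOn (A :\ x)] chi) ->
  '['Res[SymOn (A :\ x)] chi, 'chi_j] = 1.
Proof.
by case/irrP=> i -> /(gelfand_mult (SymSD1 A x) (@flip_Sym1 A x))[].
Qed.

Lemma Alt2_dot1 A (chi : 'CF(SymOn A)) : chi \in irr (SymOn A) ->
  '[cfAlt2 chi, 1] = 0.
Proof.
move=> chi_irr; rewrite cfAlt2_dot1 char_Sym_real ?irrWchar // irrWnorm //.
by have /irrP[i ->] := chi_irr; rewrite cfFS_Sym subrr mul0r.
Qed.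

Lemma Sym2_dot1 A (chi : 'CF(SymOn A)) : chi \in irr (SymOn A) ->
  '[cfSym2 chi, 1] = 1.
Proof.
move=> chi_irr; rewrite cfSym2_dot1 char_Sym_real ?irrWchar // irrWnorm //.
by have /irrP[i ->] := chi_irr; rewrite cfFS_Sym; field.
Qed.

End SymTheory.

(** * The natural permutation character *)

Section FixedPoints.

Variable T : finType.
Implicit Types (A B : {set T}) (g h : {perm T}).

Definition nfix A g : nat := \sum_(a in A) (g a == a).

Lemma nfixJ A g h : h \in SymOn A -> nfix A (g ^ h) = nfix A g.
Proof.
move=> Ah; rewrite /nfix (reindex_inj (@perm_inj _ h)) /=.
apply: eq_big => [a|a _]; first by rewrite Sym_stab.
by rewrite permJ (inj_eq perm_inj).
Qed.

Fact cfFix_subproof A :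
  is_class_fun <<SymOn A>>
    [ffun g => if g \in SymOn A then (nfix A g)%:R else 0 : algC].
Proof.
rewrite genGid; apply: intro_class_fun => [g h Gg Gh | g /negPf-> //].
by rewrite groupJr // nfixJ.
Qed.

(** The character of the natural permutation representation. *)
Definition cfFix A : 'CF(SymOn A) := Cfun 0 (cfFix_subproof A).

Lemma cfFixE A g : g \in SymOn A -> cfFix A g = (nfix A g)%:R.
Proof. by move=> Ag; rewrite cfunE Ag. Qed.

Lemma nfix1 A : nfix A 1 = #|A|.
Proof. by rewrite -sum1_card; apply: eq_bigr => a _; rewrite perm1 eqxx. Qed.

Lemma nfixD1 A x g : x \in A -> g x = x -> nfix A g = (nfix (A :\ x) g).+1.
Proof. by move=> xA gx; rewrite /nfix (big_setD1 x) //= gx eqxx. Qed.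

Lemma card_SymD1 A x : x \in A -> #|SymOn A| = (#|A| * #|SymOn (A :\ x)|)%N.
Proof.
by move=> xA; rewrite !perm.card_Sym (cardsD1 x A) xA add1n factS.
Qed.

Lemma cfFix_dot A x (theta : 'CF(SymOn A)) : x \in A ->
  '[theta, cfFix A] = '['Res[SymOn (A :\ x)] theta, 1].
Proof.
move=> xA; rewrite !cfdotE (card_SymD1 xA).
under eq_bigr => g Ag do rewrite cfFixE // conjC_nat.
rewrite (sum_transitive (i0 := x)) => [|a aA]; last first.
  exists (tperm a x) => [|g _]; first exact: tperm_Sym.
  have -> : (g ^ tperm a x)%g x = tperm a x (g a) by rewrite -permJ tpermL.
  by rewrite (canF_eq (tpermK a x)) tpermR.
have nz : #|A|%:R != 0 :> algC by rewrite pnatr_eq0 -lt0n (cardsD1 x) xA.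
rewrite natrM invfM mulrACA mulVf // mul1r; congr (_ * _).
apply: eq_big => [g|g /andP[Ag gx]]; first by rewrite SymD1.
have Hg : g \in SymOn (A :\ x) by rewrite SymD1 Ag.
by rewrite cfResE ?SymSD1 // cfun1E Hg conjC1 mulr1.
Qed.

Lemma cfRes_Fix A x : x \in A ->
  'Res[SymOn (A :\ x)] (cfFix A) = 1 + cfFix (A :\ x).
Proof.
move=> xA; apply/cfun_inP=> g Hg; have := Hg; rewrite SymD1 => /andP[Ag /eqP gx].
rewrite cfResE ?SymSD1 // !cfunE cfun1E Hg Ag (nfixD1 xA gx).
by rewrite -(natrD _ 1).
Qed.

Lemma cfFix_char A : cfFix A \is a character.
Proof.
have [->|[x xA]] := set_0Vmem A.
  rewrite (_ : cfFix _ = 0) ?cfun0_char //.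
  by apply/cfun_inP=> g Ag; rewrite cfFixE // /nfix big_set0 cfunE.
apply: char_natP => psi Npsi; rewrite cfdotC (cfFix_dot _ xA) conj_natr.
  by rewrite Cnat_cfdot_char ?cfRes_char ?cfun1_char.
by rewrite Cnat_cfdot_char ?cfRes_char ?cfun1_char.
Qed.

Lemma cfFix_mul_dot A x (theta phi : 'CF(SymOn A)) : x \in A ->
  '[theta, phi * cfFix A] =
    '['Res[SymOn (A :\ x)] theta, 'Res[SymOn (A :\ x)] phi].
Proof.
move=> xA; rewrite -{1}[phi]cfConjCK mulrC -cfdot_mulA (cfFix_dot _ xA).
by rewrite rmorphM /= cfdot_mul1 cfAutRes cfConjCK.
Qed.

Lemma cfFix_dot1 A x : x \in A -> '[cfFix A, 1] = 1.
Proof.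
move=> xA; rewrite cfdotC (cfFix_dot _ xA) rmorph1 /= cfnorm1.
exact: rmorph1.
Qed.

(** The reflection character. *)
Definition cfRef A : 'CF(SymOn A) := cfFix A - 1.

Lemma cfFix_Ref A : cfFix A = 1 + cfRef A.
Proof. by rewrite addrC subrK. Qed.

Lemma cfRes_Ref A x : x \in A ->
  'Res[SymOn (A :\ x)] (cfRef A) = 1 + cfRef (A :\ x).
Proof. by move=> xA; rewrite rmorphB rmorph1 /= cfRes_Fix // addrAC subrr add0r -cfFix_Ref. Qed.

Lemma cfRef_char A x : x \in A -> cfRef A \is a character.
Proof.
move=> xA; have [|chi Nchi E] := constt_charP 0 (cfFix_char A) _; last first.
  by rewrite /cfRef E irr0 addrC addKr.
by rewrite inE irr0 (cfFix_dot1 xA) oner_eq0.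
Qed.

Lemma cfRef_dot1 A x : x \in A -> '[cfRef A, 1] = 0.
Proof. by move=> xA; rewrite cfdotBl (cfFix_dot1 xA) cfnorm1 subrr. Qed.

Lemma cfRef_set1 x : cfRef [set x] = 0.
Proof.
apply/cfun_inP=> g Ag; rewrite !cfunE cfun1E Ag /nfix big_set1.
rewrite (_ : g = 1%g) ?perm1 ?eqxx ?subrr //.
by move: Ag; rewrite inE => /perm_on_id-> //; rewrite cards1.
Qed.

Lemma cfRef_irr A x y : x \in A -> y \in A :\ x -> cfRef A \in irr (SymOn A).
Proof.
move=> xA yAx; rewrite irrEchar (cfRef_char xA) /= {2}/cfRef cfdotBr.
rewrite (cfFix_dot _ xA) (cfRef_dot1 xA) subr0 cfRes_Ref // cfdotDl cfnorm1.
by rewrite (cfRef_dot1 yAx) addr0.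
Qed.

Lemma Alt2_Fix0 A x (chi : 'CF(SymOn A)) : x \in A -> chi \in irr (SymOn A) ->
  '[cfAlt2 chi, cfFix A] = 0.
Proof.
by move=> xA chi_irr; rewrite (cfFix_dot _ xA) cfRes_Alt2 ?SymSD1 // Alt2_point_dot1.
Qed.

Lemma Alt2_Ref0 A x (chi : 'CF(SymOn A)) : x \in A -> chi \in irr (SymOn A) ->
  '[cfAlt2 chi, cfRef A] = 0.
Proof.
by move=> xA chi_irr; rewrite cfdotBr (Alt2_Fix0 xA) // Alt2_dot1 // subrr.
Qed.

(** The left side counts the ordered pairs (a, b) with both a and b fixed, or
    exchanged, by g; a fixed point a gives the pair (a, a) twice. *)
Lemma pair_count A g : g \in SymOn A ->
  (nfix A g ^ 2 + nfix A (g ^+ 2)%g =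
   (nfix A g).*2 + \sum_(u in [set u | (u.1 \in A) && (u.2 \in A :\ u.1)])
                     ([set g u.1; g u.2] == [set u.1; u.2]))%N.
Proof.
move=> Ag; have swapE : nfix A (g ^+ 2)%g =
    (\sum_(a in A) \sum_(b in A) (g a == b) * (g b == a))%N.
  apply: eq_bigr => a aA; rewrite (bigD1 (g a)) ?Sym_stab //= eqxx mul1n.
  rewrite big1 ?addn0 => [|b /andP[_ /negPf bga]]; last by rewrite eq_sym bga.
  by rewrite expgS expg1 permM.
have fixE : (nfix A g ^ 2)%N =
    (\sum_(a in A) \sum_(b in A) (g a == a) * (g b == b))%N.
  by rewrite expnS expn1 {1}/nfix big_distrl; apply: eq_bigr => a _; rewrite big_distrr.
rewrite swapE fixE -big_split -muln2 /nfix big_distrl /=.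
rewrite [X in (_ + X)%N](_ : _ = \sum_(a in A) \sum_(b in A :\ a)
    ([set g a; g b] == [set a; b]))%N; last first.
  by rewrite pair_big_dep; apply: eq_bigl => u; rewrite in_set.
rewrite -big_split; apply: eq_bigr => a aA; rewrite -big_split (big_setD1 a) //=.
congr (_ + _)%N; first by case: (g a == a).
apply: eq_bigr => b; rewrite !inE => /andP[ba bA].
have E : ([set g a; g b] == [set a; b]) =
         (g a == a) && (g b == b) || (g a == b) && (g b == a).
  have := pair_stabP A a b g; rewrite in_pair_stab Ag /= => P.
  apply/P/orP => [[_ [[-> ->]|[-> ->]]]|[]/andP[/eqP ga /eqP gb]].
  - by left; rewrite !eqxx.
  - by right; rewrite !eqxx.
  - by split; auto.
  - by split; auto.
rewrite E; have [-> | _] := eqVneq (g a) a; last by rewrite mul0n add0n -mulnb.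
by rewrite (negPf (_ : a != b)) 1?eq_sym //= addn0 orbF mul1n.
Qed.

(** The difference S^2(pi) - pi is the permutation character on unordered pairs
    of points, and is induced from the stabilizer of one of them. *)
Lemma Sym2Fix_dot A x y : x \in A -> y \in A :\ x ->
  exists c, forall theta : 'CF(SymOn A),
    '[theta, cfSym2 (cfFix A) - cfFix A] =
      c * '['Res[pair_stab_group A x y] theta, 1].
Proof.
move=> xA yAx; set X := [set u | (u.1 \in A) && (u.2 \in A :\ u.1)].
pose Q g (u : T * T) := [set g u.1; g u.2] == [set u.1; u.2].
exists (2^-1 * #|SymOn A|%:R^-1 * #|X|%:R * #|pair_stab_group A x y|%:R) => theta.
have trX u : u \in X -> exists2 h, h \in SymOn A &
    forall g, g \in SymOn A -> Q (g ^ h)%g (x, y) = Q g u.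
  case: u => a b; rewrite in_set /= => /andP[aA bAa].
  have [xb bA] := setD1P bAa; have [yx yA] := setD1P yAx.
  pose h := (tperm a x * tperm (tperm a x b) y)%g.
  have ha : h a = x.
    by rewrite permM tpermL tpermD // (canF_eq (tpermK a x)) tpermR.
  have hb : h b = y by rewrite permM tpermL.
  exists h => [|g Ag]; first by rewrite groupM ?tperm_Sym // Sym_stab ?tperm_Sym.
  have set2h u v : [set h u; h v] = h @: [set u; v].
    by rewrite imsetU1 imset_set1.
  have -> : Q (g ^ h)%g (x, y) = ([set (g ^ h)%g (h a); (g ^ h)%g (h b)] == [set h a; h b]).
    by rewrite /Q ha hb.
  by rewrite !permJ !set2h (inj_eq (imset_inj (@perm_inj _ h))).
rewrite cfdotE; have L0 : #|pair_stab_group A x y|%:R != 0 :> algC := neq0CG _.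
transitivity (#|SymOn A|%:R^-1 * \sum_(g in SymOn A)
                theta g * (\sum_(u in X) Q g u)%:R * 2^-1); last first.
  rewrite -mulr_suml (sum_transitive theta trX) cfdotE.
  rewrite (eq_bigl [in pair_stab_group A x y]) => [|g]; last by rewrite -in_pair_stab.
  set S := (X in _ * X / 2); set S' := (X in _ = _ * (_ * X)).
  have -> : S' = S.
    apply: eq_bigr => g Lg; rewrite cfResE ?pair_stab_sub // cfun1E Lg.
    by rewrite conjC1 mulr1.
  by field; rewrite L0 neq0CG.
congr (_ * _); apply: eq_bigr => g Ag; rewrite -mulrA; congr (_ * _).
have -> : (cfSym2 (cfFix A) - cfFix A) g = (\sum_(u in X) Q g u)%:R / 2.
  have /(congr1 (fun n => n%:R : algC)) := pair_count Ag.
  rewrite !natrD -muln2 natrM natrX -/X -/(Q g) => E.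
  rewrite cfunE [X in _ + X]cfunE cfSym2_val // !cfFixE ?groupX //.
  apply: (mulIf (x := 2)); first by rewrite pnatr_eq0.
  rewrite mulfVK ?pnatr_eq0 // mulrBl mulfVK ?pnatr_eq0 // E.
  by rewrite addrC addKr.
by rewrite rmorphM fmorphV /= !conjC_nat.
Qed.

Lemma Alt2_Sym2Fix0 A x y (chi : 'CF(SymOn A)) :
    x \in A -> y \in A :\ x -> chi \in irr (SymOn A) ->
  '[cfAlt2 chi, cfSym2 (cfFix A)] = 0.
Proof.
move=> xA yAx chi_irr; have [c E] := Sym2Fix_dot xA yAx.
rewrite -[cfSym2 _](subrK (cfFix A)) cfdotDr (Alt2_Fix0 xA) // addr0 E.
by rewrite cfRes_Alt2 ?pair_stab_sub // Alt2_pair_dot1 // mulr0.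
Qed.

(** As A^2(chi) is orthogonal to S^2(pi), its products with A^2(pi) and with
    pi^2 agree; the latter is an inner product on the stabilizers of one and of
    two points. *)
Lemma Alt2_Alt2Fix A x y (chi : 'CF(SymOn A)) :
    x \in A -> y \in A :\ x -> chi \in irr (SymOn A) ->
  '[cfAlt2 chi, cfAlt2 (cfFix A)] =
    '[cfAlt2 ('Res[SymOn (A :\ x :\ y)] chi), 1].
Proof.
move=> xA yAx chi_irr.
rewrite -[cfAlt2 (cfFix A)](addKr (cfSym2 (cfFix A))) cfSym2_Alt2 cfdotDr.
rewrite cfdotNr (Alt2_Sym2Fix0 xA yAx) // oppr0 add0r expr2 (cfFix_mul_dot _ _ xA).
rewrite cfRes_Alt2 ?SymSD1 // cfRes_Fix // cfdotDr Alt2_point_dot1 // add0r.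
rewrite (cfFix_dot _ yAx) cfRes_Alt2 ?SymSD1 // cfResRes ?SymSD1 //.
Qed.

Lemma Alt2_Alt2Ref A x y (chi : 'CF(SymOn A)) :
    x \in A -> y \in A :\ x -> chi \in irr (SymOn A) ->
  '[cfAlt2 chi, cfAlt2 (cfRef A)] =
    '[cfAlt2 ('Res[SymOn (A :\ x :\ y)] chi), 1].
Proof.
move=> xA yAx chi_irr; rewrite -(Alt2_Alt2Fix xA yAx) // cfFix_Ref cfAlt2D1.
by rewrite cfdotDr (Alt2_Ref0 xA) // addr0.
Qed.

Lemma cfRef_char0 A x : x \in A -> cfRef A = 0 \/ cfRef A \in irr (SymOn A).
Proof.
move=> xA; have [A1|[y yAx]] := set_0Vmem (A :\ x); last first.
  by right; apply: cfRef_irr xA yAx.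
left; rewrite -(setD1K xA) A1 setU0; exact: cfRef_set1.
Qed.

Lemma Alt2Ref_dot1 A x : x \in A -> '[cfAlt2 (cfRef A), 1] = 0.
Proof.
move=> xA; have [->|Ri] := cfRef_char0 xA; first by rewrite cfAlt2_0 cfdot0l.
exact: Alt2_dot1.
Qed.

Lemma cfRes2_Ref A x y : x \in A -> y \in A :\ x ->
  'Res[SymOn (A :\ x :\ y)] (cfRef A) = 1 + cfFix (A :\ x :\ y).
Proof.
move=> xA yAx; rewrite -(cfResRes _ (SymSD1 _ y) (SymSD1 _ x)) cfRes_Ref //.
by rewrite -cfFix_Ref cfRes_Fix.
Qed.

(** The norm of A^2(rho) is given by [Alt2_Alt2Ref] with chi = rho, whose
    restriction to the stabilizer of two points is 1 + pi. *)
Lemma Alt2Ref_irr A x y z : x \in A -> y \in A :\ x -> z \in A :\ x :\ y ->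
  cfAlt2 (cfRef A) \in irr (SymOn A).
Proof.
move=> xA yAx zB; have Ri := cfRef_irr xA yAx.
rewrite irrEchar cfAlt2_char ?irrWchar //= (Alt2_Alt2Ref xA yAx) //.
rewrite cfRes2_Ref // cfAlt2D1 cfdotDl (cfFix_dot1 zB).
rewrite cfFix_Ref cfAlt2D1 cfdotDl (cfRef_dot1 zB).
by rewrite (Alt2Ref_dot1 zB) !add0r.
Qed.

End FixedPoints.

(** * Restriction to the stabilizers of one and two points *)

Lemma char_dot_ge0 (gT : finGroupType) (G : {group gT}) (phi psi : 'CF(G)) :
  phi \is a character -> psi \is a character -> 0 <= '[phi, psi].
Proof. by move=> Nphi Npsi; rewrite natr_ge0 ?Cnat_cfdot_char. Qed.

Section PointRestriction.

Variables (T : finType) (A : {set T}) (x y : T).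
Hypotheses (xA : x \in A) (yAx : y \in A :\ x).
Local Notation G := (SymOn A).
Local Notation H := (SymOn (A :\ x)).
Local Notation K := (SymOn (A :\ x :\ y)).

Let sHG : H \subset G := SymSD1 A x.
Let sKH : K \subset H := SymSD1 _ y.
Let yA : y \in A. Proof. by case/setD1P: yAx. Qed.
Let yx : y != x. Proof. by case/setD1P: yAx. Qed.
Let tG : tperm x y \in G. Proof. exact: tperm_Sym. Qed.

Lemma tperm_point_cent g : g \in K -> (g ^ tperm x y)%g = g.
Proof.
rewrite !SymD1 => /andP[/andP[_ /eqP gx] /eqP gy].
by apply/conjg_fixP/commgP/commute_sym/commgP/conjg_fixP; rewrite tpermJ gx gy.
Qed.

Lemma conj_tperm_point g : g \in H -> (g ^ tperm x y \in H)%g = (g \in K).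
Proof.
move=> Hg; have := Hg; rewrite !SymD1 => /andP[Ag gx].
have -> : (g ^ tperm x y)%g x = tperm x y (g y) by rewrite -permJ tpermR.
by rewrite groupJ // Ag gx /= (canF_eq (tpermK x y)) tpermL.
Qed.

(** A symmetric group has two double cosets of a point stabilizer. *)
Lemma double_coset_point u : u \in G -> u \notin H ->
  exists h1 h2, [/\ h1 \in H, h2 \in H & u = (h1 * tperm x y * h2)%g].
Proof.
move=> Gu; rewrite SymD1 Gu /= => ux; pose w := (u^-1)%g x.
have uw : u w = x by rewrite permKV.
have wx : w != x by apply: contraNneq ux => wx; rewrite -{1}wx uw.
have wA : w \in A by rewrite -(Sym_stab _ Gu) uw.
exists (tperm y w), (tperm x y * tperm y w * u)%g; split.
- by apply: tperm_Sym; rewrite !inE ?yx ?wx.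
- by rewrite SymD1 !groupM ?tperm_Sym //= !permM tpermL tpermL uw.
by rewrite !mulgA -[(tperm y w * _ * _)%g]mulgA tperm2 mulg1 tperm2 mul1g.
Qed.

(** Mackey's formula: the double cosets of H are represented by 1 and the
    transposition of x and y, which centralizes K, the intersection of H with
    its conjugate. *)
Lemma Ind_point_orthogonal (al be : 'CF(H)) :
    '[al, be] = 0 -> '['Res[K] al, 'Res[K] be] = 0 ->
  '['Ind[G] al, 'Ind[G] be] = 0.
Proof.
move=> ab0 abK0; pose F u := \sum_(g in H) al g * (be (g ^ u)%g)^*.
have sum0 (gT : finGroupType) (L : {group gT}) (a b : 'CF(L)) :
    '[a, b] = 0 -> \sum_(g in L) a g * (b g)^* = 0.
  rewrite cfdotE => /eqP; rewrite mulf_eq0 invr_eq0 (negPf (neq0CG L)) /=.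
  by move/eqP.
have FH u : u \in H -> F u = 0.
  by move=> Hu; rewrite -(sum0 _ _ _ _ ab0); apply: eq_bigr => g Hg; rewrite cfunJ.
have Ft : F (tperm x y) = 0.
  rewrite -(sum0 _ _ _ _ abK0) /F (big_setID K) /= [X in _ + X]big1 ?addr0.
    rewrite (setIidPr sKH); apply: eq_bigr => g Kg.
    by rewrite !cfResE // tperm_point_cent.
  move=> g /setDP[Hg Kg]; rewrite (cfun0 be) ?conjC0 ?mulr0 //.
  by rewrite conj_tperm_point.
have F0 u : u \in G -> F u = 0.
  move=> Gu; have [Hu|Hu] := boolP (u \in H); first exact: FH.
  have [h1 [h2 [Hh1 Hh2 ->]]] := double_coset_point Gu Hu.
  rewrite -Ft /F [RHS](reindex_inj (conjg_inj h1)) /=.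
  apply: eq_big => [g|g Hg]; first by rewrite groupJr.
  by rewrite (cfunJ al) // !conjgM (cfunJ be).
rewrite -Frobenius_reciprocity cfdotE.
under eq_bigr => g Hg do rewrite cfResE // cfIndE // rmorphM rmorph_sum mulrCA mulr_sumr.
by rewrite -mulr_sumr exchange_big /= [X in _ * (_ * X)]big1 ?mulr0.
Qed.

(** If two constituents of the restriction of chi to a point stabilizer had
    nothing in common on the stabilizer of two points, then their induced
    characters would be orthogonal; but both contain chi. *)
Lemma constt_Res_point_share (chi : 'CF(G)) i j :
    i \in irr_constt ('Res[H] chi) -> j \in irr_constt ('Res[H] chi) -> i != j ->
    chi \in irr G -> '['Res[K] 'chi_i, 'Res[K] 'chi_j] != 0.
Proof.
move=> chi_i chi_j ij chi_irr; apply/eqP=> dK0; have /irrP[k Ek] := chi_irr.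
have Nind l : 'Ind[G] 'chi[H]_l \is a character by rewrite cfInd_char ?irr_char.
have constt_k l : l \in irr_constt ('Res[H] chi) -> k \in irr_constt ('Ind[G] 'chi_l).
  by rewrite Ek constt_Ind_Res.
have d0 : '['Ind[G] 'chi_i, 'Ind[G] 'chi_j] = 0.
  by apply: Ind_point_orthogonal => //; rewrite cfdot_irr (negPf ij).
have := constt_ortho_char (Nind i) (Nind j) (constt_k _ chi_i) (constt_k _ chi_j) d0.
by rewrite cfdot_irr eqxx => /eqP; rewrite oner_eq0.
Qed.

Lemma Res_point_decomp (chi : 'CF(G)) : chi \in irr G ->
    '['Res[H] chi] != 1 ->
  exists i j phi, [/\ i != j, phi \is a character &
                     'Res[H] chi = 'chi_i + 'chi_j + phi].
Proof.
move=> chi_irr n1; have Nres := cfRes_char H (irrWchar chi_irr).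
have [i chi_i] : exists i, i \in irr_constt ('Res[H] chi).
  apply: neq0_has_constt; rewrite cfRes_eq0 ?irrWchar //.
  by have /irrP[k ->] := chi_irr; apply: irr_neq0.
have /constt_charP[//|phi Nphi E] := chi_i.
have phi0 : phi != 0.
  by apply: contraNneq n1 => phi0; rewrite E phi0 addr0 cfnorm_irr.
have [j phi_j] := neq0_has_constt phi0.
have /constt_charP[//|psi Npsi Ephi] := phi_j.
exists i, j, psi; split=> //; last by rewrite E Ephi addrA.
apply: contraTneq phi_j => <-; rewrite inE negbK.
have := Res_point_mult1 chi_irr chi_i; rewrite E cfdotDl cfnorm_irr => /eqP.
by rewrite -subr_eq0 addrC addKr.
Qed.

(** The alternating square of a sum contains the products of distinct summands,
    and the product of two restrictions that share a real constituent contains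
    the trivial character. *)
Lemma Alt2_Res2_gt0 (chi : 'CF(G)) : chi \in irr G ->
  '['Res[H] chi] != 1 -> 0 < '[cfAlt2 ('Res[K] chi), 1].
Proof.
move=> chi_irr n1; have Nres := cfRes_char H (irrWchar chi_irr).
have [i [j [phi [ij Nphi E]]]] := Res_point_decomp chi_irr n1.
have chi_i : i \in irr_constt ('Res[H] chi).
  by apply/constt_charP => //; exists ('chi_j + phi); rewrite ?addrA // rpredD ?irr_char.
have chi_j : j \in irr_constt ('Res[H] chi).
  apply/constt_charP => //; exists ('chi_i + phi); first by rewrite rpredD ?irr_char.
  by rewrite E addrCA addrA.
rewrite -(cfResRes _ sKH sHG) E -addrA raddfD /= cfAlt2D !cfdotDl cfdot_mul1.
have Nj := cfRes_char K (irr_char j); have Ni := cfRes_char K (irr_char i).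
have NK := cfRes_char K Nphi.
have Nr : 'Res[K] ('chi_j + phi) \is a character by rewrite cfRes_char ?rpredD ?irr_char.
rewrite char_Sym_real // ltr_wpDl ?addr_ge0 ?char_dot_ge0 ?cfAlt2_char ?cfun1_char //.
rewrite raddfD /= cfdotDr ltr_pwDl ?char_dot_ge0 // lt_neqAle char_dot_ge0 // andbT.
by rewrite eq_sym (constt_Res_point_share chi_i chi_j).
Qed.

End PointRestriction.

(** * Characters whose alternating square is that of the reflection character *)

Lemma irr_dot_eq (gT : finGroupType) (G : {group gT}) (chi psi : 'CF(G)) :
  chi \in irr G -> psi \in irr G -> '[chi, psi] != 0 -> chi = psi.
Proof.
case/irrP=> i -> /irrP[j ->]; rewrite cfdot_irr pnatr_eq0.
by have [->|] := eqVneq i j.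
Qed.

Lemma irr_dot_neq (gT : finGroupType) (G : {group gT}) (chi psi : 'CF(G)) :
  chi \in irr G -> psi \in irr G -> chi != psi -> '[chi, psi] = 0.
Proof. by move=> ci pi; apply: contra_neq_eq; apply: irr_dot_eq. Qed.

Section SignAndReflection.

Variable T : finType.
Implicit Types A : {set T}.

Lemma cfSgn_irr A : cfSgn (SymOn A) \in irr (SymOn A).
Proof. exact: lin_char_irr (cfSgn_lin _). Qed.

Lemma cfRes_SgnD1 A x : 'Res[SymOn (A :\ x)] (cfSgn (SymOn A)) = cfSgn (SymOn (A :\ x)).
Proof. exact: cfRes_Sgn (SymSD1 A x). Qed.

Lemma mul_Sgn_irr A chi :
  chi \in irr (SymOn A) -> chi * cfSgn (SymOn A) \in irr (SymOn A).
Proof. by rewrite mulrC; apply: mul_lin_irr (cfSgn_lin _). Qed.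

Lemma cfdot_mulSgn A (phi psi : 'CF(SymOn A)) :
  '[phi * cfSgn (SymOn A), psi] = '[phi, psi * cfSgn (SymOn A)].
Proof. by rewrite cfdot_mulA char_Sym_real ?cfSgn_char. Qed.

Lemma Sym_small A g : (#|A| <= 1)%N -> g \in SymOn A -> g = 1%g.
Proof. by move=> A1; rewrite inE => /perm_on_id->. Qed.

Lemma cfSgn_dot1 A : '[cfSgn (SymOn A), 1] = (#|A| <= 1)%N%:R.
Proof.
have [A1|] := leqP.
  rewrite (_ : cfSgn _ = 1) ?cfnorm1 //; apply/cfun_inP=> g Ag.
  by rewrite cfSgnE // cfun1E Ag (Sym_small A1 Ag) odd_perm1.
case/card_gt1P=> x [y [xA yA xy]]; apply: irr_dot_neq => //.
- exact: cfSgn_irr.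
- by rewrite cfun1_irr.
apply/eqP=> /cfunP/(_ (tperm x y)) /eqP; apply/negP.
rewrite cfSgnE ?tperm_Sym // cfun1E tperm_Sym // odd_tperm xy expr1.
by rewrite -subr_eq0 -opprD oppr_eq0 (pnatr_eq0 _ 2).
Qed.

Lemma cfSgn_dot_Fix A x : x \in A ->
  '[cfSgn (SymOn A), cfFix A] = (#|A :\ x| <= 1)%N%:R.
Proof. by move=> xA; rewrite (cfFix_dot _ xA) cfRes_SgnD1 cfSgn_dot1. Qed.

Lemma cfRef_set2 A x y : x \in A -> y \in A :\ x -> (#|A :\ x| <= 1)%N ->
  cfRef A = cfSgn (SymOn A).
Proof.
move=> xA yAx A2; apply: irr_dot_eq; rewrite ?cfSgn_irr ?(cfRef_irr xA yAx) //.
rewrite cfdotC cfdotBr (cfSgn_dot_Fix xA) A2 cfSgn_dot1.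
by rewrite (cardsD1 x) xA (cardsD1 y) yAx subr0 conjC1 oner_eq0.
Qed.

(** By reciprocity chi occurs in pi = 1 + rho. *)
Lemma irr_Res_point_triv A x (chi : 'CF(SymOn A)) :
    x \in A -> chi \in irr (SymOn A) -> '['Res[SymOn (A :\ x)] chi, 1] != 0 ->
  chi = 1 \/ chi = cfRef A.
Proof.
move=> xA chi_irr; rewrite -(cfFix_dot _ xA) cfFix_Ref cfdotDr.
have [-> | chi1] := eqVneq chi 1; first by left.
rewrite irr_dot_neq ?cfun1_irr // add0r => dR; right.
have [R0|Ri] := cfRef_char0 xA; last exact: irr_dot_eq dR.
by rewrite R0 cfdot0r eqxx in dR.
Qed.

Lemma irr_Res_point_sgn A x (chi : 'CF(SymOn A)) :
    x \in A -> chi \in irr (SymOn A) ->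
    '['Res[SymOn (A :\ x)] chi, cfSgn (SymOn (A :\ x))] != 0 ->
  chi = cfSgn (SymOn A) \/ chi = cfRef A * cfSgn (SymOn A).
Proof.
move=> xA chi_irr dS; have Ki := mul_Sgn_irr chi_irr.
have [|E|E] := irr_Res_point_triv xA Ki.
- by rewrite rmorphM /= cfRes_SgnD1 cfdot_mulSgn mul1r.
- by left; rewrite -[chi]mulr1 -(cfSgn_sqr (SymOn A)) mulrA E mul1r.
- by right; rewrite -E -mulrA cfSgn_sqr mulr1.
Qed.

Lemma cfRef1 A x : x \in A -> cfRef A 1%g = #|A :\ x|%:R.
Proof.
move=> xA; rewrite !cfunE cfun1E group1 nfix1 (cardsD1 x) xA.
by rewrite natrD addrAC subrr add0r.
Qed.

Lemma Alt2_lin0 A (chi : 'CF(SymOn A)) :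
  chi \is a character -> chi 1%g = 1 -> cfAlt2 chi = 0.
Proof.
move=> Nchi chi1; apply/eqP; rewrite -char1_eq0 ?cfAlt2_char //.
by rewrite cfAlt2_val // expg1n chi1 expr1n subrr mul0r.
Qed.

Lemma Alt2Ref_char0 A x : x \in A ->
  cfAlt2 (cfRef A) = 0 \/ cfAlt2 (cfRef A) \in irr (SymOn A).
Proof.
move=> xA; have [A1|[y yAx]] := set_0Vmem (A :\ x).
  by left; rewrite -(setD1K xA) A1 setU0 cfRef_set1 cfAlt2_0.
have [A2|[z zB]] := set_0Vmem (A :\ x :\ y); last by right; apply: Alt2Ref_irr zB.
left; apply: Alt2_lin0; first exact: cfRef_char xA.
by rewrite (cfRef1 xA) (cardsD1 y) yAx A2 cards0.
Qed.

Lemma cfRes_Alt2Ref A x : x \in A ->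
  'Res[SymOn (A :\ x)] (cfAlt2 (cfRef A)) = cfAlt2 (cfRef (A :\ x)) + cfRef (A :\ x).
Proof. by move=> xA; rewrite cfRes_Alt2 ?SymSD1 // cfRes_Ref // cfAlt2D1. Qed.

(** The character A^2('chi_j) is a part of the restriction of A^2(chi), which
    is a multiple of A^2(rho) + rho for the smaller set; and it does not
    contain rho. *)
Lemma Alt2_constt_point A x y (chi : 'CF(SymOn A)) c j :
    x \in A -> y \in A :\ x -> chi \in irr (SymOn A) ->
    cfAlt2 chi = c *: cfAlt2 (cfRef A) ->
    j \in irr_constt ('Res[SymOn (A :\ x)] chi) ->
  exists c', cfAlt2 'chi_j = c' *: cfAlt2 (cfRef (A :\ x)).
Proof.
move=> xA yAx chi_irr Ec chi_j; set B := A :\ x in chi_j *.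
have Nres := cfRes_char (SymOn B) (irrWchar chi_irr).
have /constt_charP[//|phi Nphi E] := chi_j.
have Nj : 'chi_j \is a character by apply: irr_char.
have ER : cfAlt2 'chi_j + (cfAlt2 phi + 'chi_j * phi) =
          c *: (cfAlt2 (cfRef B) + cfRef B).
  by rewrite addrA -cfAlt2D -E -cfRes_Alt2 ?SymSD1 // Ec linearZ /= cfRes_Alt2Ref.
(* Multiplicities are nonnegative, so only constituents of the multiple of
   A^2(rho) + rho occur. *)
have coef0 k : 'chi_k != cfAlt2 (cfRef B) -> '[cfAlt2 'chi_j, 'chi_k] = 0.
  move=> kA; have [->|kR] := eqVneq 'chi_k (cfRef B).
    by rewrite (Alt2_Ref0 yAx) ?mem_irr.
  have: '[cfAlt2 'chi_j, 'chi_k] + '[cfAlt2 phi + 'chi_j * phi, 'chi_k] = 0.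
    rewrite -cfdotDl ER cfdotZl cfdotDl.
    have -> : '[cfAlt2 (cfRef B), 'chi_k] = 0.
      have [->|Ai] := Alt2Ref_char0 yAx; first by rewrite cfdot0l.
      by rewrite irr_dot_neq ?mem_irr // eq_sym.
    have -> : '[cfRef B, 'chi_k] = 0.
      have [->|Ri] := cfRef_char0 yAx; first by rewrite cfdot0l.
      by rewrite irr_dot_neq ?mem_irr // eq_sym.
    by rewrite addr0 mulr0.
  move/eqP; rewrite paddr_eq0 ?char_dot_ge0 ?irr_char ?rpredD ?rpredM ?cfAlt2_char //.
  by case/andP=> /eqP.
have [A0|/irrP[m Em]] := Alt2Ref_char0 yAx.
  exists 0; rewrite A0 scale0r [cfAlt2 _]cfun_sum_cfdot big1 // => k _.
  by rewrite coef0 ?scale0r // A0 irr_neq0.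
exists '[cfAlt2 'chi_j, 'chi_m]; rewrite Em [LHS]cfun_sum_cfdot (bigD1 m) //=.
rewrite big1 ?addr0 // => k km; rewrite coef0 ?scale0r // Em.
by rewrite (inj_eq irr_inj).
Qed.

End SignAndReflection.

Section AltSquareReflection.

Variable T : finType.
Implicit Types A : {set T}.

Definition linear_or_reflection A (chi : 'CF(SymOn A)) : Prop :=
  [\/ chi = 1, chi = cfSgn (SymOn A), chi = cfRef A
    | chi = cfRef A * cfSgn (SymOn A)].

Lemma cfFix_sqr_dot_Sgn A x y : x \in A -> y \in A :\ x ->
  '[cfFix A ^+ 2, cfSgn (SymOn A)] =
    (#|A :\ x| <= 1)%N%:R + (#|A :\ x :\ y| <= 1)%N%:R.
Proof.
move=> xA yAx; rewrite cfdotC expr2 (cfFix_mul_dot _ _ xA) cfRes_Fix //.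
rewrite cfRes_SgnD1 cfdotDr cfSgn_dot1 (cfSgn_dot_Fix yAx) -natrD.
exact: conjC_nat.
Qed.

(** With four or more points, the restriction of chi to a point stabilizer
    cannot be the sum of both twists of the reflection character. For the
    multiplicity of A^2(rho) in A^2(chi) would be that of sgn in pi^2 on the
    stabilizer of two points, at most 1, and the degree of A^2(chi) is larger
    than that of A^2(rho). *)
Lemma Alt2_Ref_twists A x y z w (chi : 'CF(SymOn A)) c
    (S := cfSgn (SymOn (A :\ x))) :
    x \in A -> y \in A :\ x -> z \in A :\ x :\ y -> w \in A :\ x :\ y :\ z ->
    chi \in irr (SymOn A) -> cfAlt2 chi = c *: cfAlt2 (cfRef A) ->
    cfRef (A :\ x) != cfRef (A :\ x) * S ->
  'Res[SymOn (A :\ x)] chi <> cfRef (A :\ x) + cfRef (A :\ x) * S.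
Proof.
move=> xA yB zC wD chi_irr Ec RS ER.
set B := A :\ x in yB zC wD S RS ER *; set C := B :\ y in zC wD *.
have [n cD] : exists n, #|C :\ z| = n.+1 by exists #|C :\ z :\ w|; rewrite (cardsD1 w) wD.
have cC : #|C| = n.+2 by rewrite (cardsD1 z) zC cD.
have cB : #|B| = n.+3 by rewrite (cardsD1 y) yB cC.
have Ri := cfRef_irr yB zC.
have ResR : 'Res[SymOn C] (cfRef B) = cfFix C by rewrite cfRes_Ref // -cfFix_Ref.
have SF : '[S, cfFix B] = 0 by rewrite (cfSgn_dot_Fix yB) -/C cC.
have S1 : '[S, 1] = 0 by rewrite cfSgn_dot1 cB.
have n0 : n != 0%N.
  apply: contraNneq RS => n0; apply/eqP/irr_dot_eq => //; first exact: mul_Sgn_irr.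
  rewrite -cfdot_mulSgn {2}/cfRef cfdotBr (cfFix_dot _ yB) -/C rmorphM /= ResR.
  rewrite cfRes_SgnD1 -/C mulrC cfdot_mul1 char_Sym_real ?cfFix_char //.
  rewrite (cfSgn_dot_Fix zC) cD n0 mulrC cfdot_mul1 char_Sym_real ?(cfRef_char yB) //.
  by rewrite cfdotBr SF S1 !subr0 oner_eq0.
have cE : c = (n <= 1)%N%:R.
  have : '[cfAlt2 chi, cfAlt2 (cfRef A)] = c.
    by rewrite Ec cfdotZl irrWnorm ?mulr1 // (Alt2Ref_irr xA yB zC).
  rewrite (Alt2_Alt2Ref xA yB) // -(cfResRes _ (SymSD1 _ y) (SymSD1 _ x)) ER -/B -/C.
  rewrite raddfD /= rmorphM /= ResR cfRes_SgnD1 cfAlt2D cfAlt2_Sgn !cfdotDl.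
  have -> : '[cfAlt2 (cfFix C), 1] = 0.
    by rewrite cfFix_Ref cfAlt2D1 cfdotDl (Alt2Ref_dot1 zC) (cfRef_dot1 zC) addr0.
  rewrite mulrA cfdot_mul1 char_Sym_real ?cfSgn_char // -expr2.
  rewrite (cfFix_sqr_dot_Sgn zC wD) cD !add0r => <-.
  have -> : #|C :\ z :\ w| = n by move: cD; rewrite (cardsD1 w) wD => -[].
  by case: (n) n0 => // m _; rewrite add0r.
have f1 : chi 1%g = (n.+2).*2%:R.
  rewrite -(cfRes1 (SymOn B)) ER.
  have -> : (cfRef B + cfRef B * S) 1%g = cfRef B 1%g + cfRef B 1%g * S 1%g.
    by rewrite [LHS]cfunE; congr (_ + _); rewrite cfunE.
  by rewrite (lin_char1 (cfSgn_lin _)) mulr1 (cfRef1 yB) -/C cC -natrD addnn.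
have /(congr1 (fun phi : 'CF(SymOn A) => phi 1%g)) := Ec.
rewrite [RHS]cfunE !cfAlt2_val ?group1 // expg1n f1 (cfRef1 xA) -/B cB cE.
set F := n.+2.*2; set R := n.+3; set b : nat := (n <= 1)%N => E.
have /eqP : F%:R ^+ 2 + b%:R * R%:R = b%:R * R%:R ^+ 2 + F%:R :> algC.
  apply/eqP; rewrite -subr_eq0; set l := (X in X == 0).
  have -> : l = 2 * ((F%:R ^+ 2 - F%:R) / 2 - b%:R * ((R%:R ^+ 2 - R%:R) / 2)).
    by rewrite /l; field.
  by rewrite E subrr mulr0.
rewrite -!natrX -!natrM -!natrD eqr_nat /F /R /b.
by move=> /eqP; case: (n) n0 => [|[|m]] // _; rewrite /= -muln2; nia.
Qed.

Lemma irr_Sym_small A (chi : 'CF(SymOn A)) :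
  (#|A| <= 1)%N -> chi \in irr (SymOn A) -> chi = 1.
Proof.
move=> cA chi_irr; apply: irr_dot_eq; rewrite ?cfun1_irr //.
have /irrP[i Ei] := chi_irr.
rewrite cfdotE (eq_bigr (fun=> chi 1%g)) => [|g Ag].
  rewrite sumr_const mulf_neq0 ?invr_eq0 ?neq0CG // mulrn_eq0 negb_or -lt0n.
  by rewrite cardG_gt0 Ei irr1_neq0.
by rewrite (Sym_small cA Ag) cfun11 conjC1 mulr1.
Qed.

(** Restricting the hypothesis to a point stabilizer gives the same hypothesis
    for the constituents of the restriction, so these are known by induction; a
    linear constituent determines chi by reciprocity. *)
Lemma irr_Alt2_Ref A (chi : 'CF(SymOn A)) c :
    chi \in irr (SymOn A) -> cfAlt2 chi = c *: cfAlt2 (cfRef A) ->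
  linear_or_reflection chi.
Proof.
move: {2}#|A| (leqnn #|A|) => n; elim: n A chi c => [|n IHn] A chi c cA chi_irr Ec.
  by constructor 1; apply: irr_Sym_small; rewrite ?(leq_trans cA).
have [A0|[x xA]] := set_0Vmem A; first by apply: (IHn _ _ c) => //; rewrite A0 cards0.
have cB : (#|A :\ x| <= n)%N by move: cA; rewrite (cardsD1 x) xA.
pose S := cfSgn (SymOn (A :\ x)); pose R := cfRef (A :\ x).
have [j0 chi_j0] : exists j, j \in irr_constt ('Res[SymOn (A :\ x)] chi).
  have /irrP[i ->] := chi_irr.
  by have [j] := constt_cfRes_irr (SymOn (A :\ x)) i; exists j.
(* It suffices to find a linear constituent on a point stabilizer. *)
have triv j : j \in irr_constt ('Res[SymOn (A :\ x)] chi) -> 'chi_j = 1 ->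
    linear_or_reflection chi.
  rewrite inE => /[swap] -> /(irr_Res_point_triv xA chi_irr)[]->;
    by [constructor 1 | constructor 3].
have sgn j : j \in irr_constt ('Res[SymOn (A :\ x)] chi) -> 'chi_j = S ->
    linear_or_reflection chi.
  rewrite inE => /[swap] -> /(irr_Res_point_sgn xA chi_irr)[]->;
    by [constructor 2 | constructor 4].
have [B1|B2] := leqP #|A :\ x| 1.
  by apply: (triv _ chi_j0); apply: irr_Sym_small; rewrite ?mem_irr.
have /set0Pn[y yB] : A :\ x != set0 by rewrite -card_gt0 ltnW.
have /set0Pn[z zC] : A :\ x :\ y != set0.
  by rewrite -card_gt0 -ltnS; move: B2; rewrite (cardsD1 y) yB.
have IH j : j \in irr_constt ('Res[SymOn (A :\ x)] chi) -> linear_or_reflection 'chi_j.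
  move=> chi_j; have [c' Ec'] := Alt2_constt_point xA yB chi_irr Ec chi_j.
  by apply: (IHn _ _ c'); rewrite ?mem_irr.
have [D0|[w wD]] := set_0Vmem (A :\ x :\ y :\ z).
  have RS : R = S by apply: (cfRef_set2 yB zC); rewrite (cardsD1 z) zC D0 cards0.
  have [E|E|E|E] := IH _ chi_j0; [exact: triv E | exact: sgn E | |].
    by apply: (sgn _ chi_j0); rewrite -RS.
  by apply: (triv _ chi_j0); rewrite E -/R -/S RS cfSgn_sqr.
have [/existsP[j /andP[chi_j /orP[]/eqP]]|/existsPn nlin] :=
  boolP [exists j, (j \in irr_constt ('Res[SymOn (A :\ x)] chi))
                   && (('chi_j == 1) || ('chi_j == S))]; [exact: triv|exact: sgn|].
have twist j : j \in irr_constt ('Res[SymOn (A :\ x)] chi) ->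
    'chi_j = R \/ 'chi_j = R * S.
  move=> chi_j; have := nlin j; rewrite chi_j /= => /norP[/eqP j1 /eqP jS].
  by have [E|E|E|E] := IH _ chi_j; [case: j1 | case: jS | left | right].
have Alt2_twist j : j \in irr_constt ('Res[SymOn (A :\ x)] chi) ->
    cfAlt2 'chi_j = cfAlt2 R.
  by case/twist=> ->; rewrite ?cfAlt2_Sgn.
have Nres := cfRes_char (SymOn (A :\ x)) (irrWchar chi_irr).
have Ri : R \in irr _ := cfRef_irr yB zC.
have Ai := Alt2Ref_irr yB zC wD.
have [/eqP n1|n1] := boolP ('['Res[SymOn (A :\ x)] chi] == 1).
  have /irrP[k Ek] : 'Res[SymOn (A :\ x)] chi \in irr (SymOn (A :\ x)).
    by rewrite irrEchar Nres n1 eqxx.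
  have ER : cfAlt2 R = c *: (cfAlt2 R + R).
    rewrite -{1}(@Alt2_twist k) ?Ek ?constt_irr ?inE //.
    by rewrite -Ek -cfRes_Alt2 ?SymSD1 // Ec linearZ /= cfRes_Alt2Ref.
  have c0 : c = 0.
    have /= := congr1 (fun phi => '[phi, R]) ER.
    by rewrite cfdotZl cfdotDl (Alt2_Ref0 yB) // add0r irrWnorm // mulr1 => <-.
  have := irrWnorm Ai; rewrite -/R ER c0 scale0r cfdot0l => /eqP.
  by rewrite eq_sym oner_eq0.
have [i [j [phi [ij Nphi E]]]] := Res_point_decomp chi_irr n1.
have chi_i : i \in irr_constt ('Res[SymOn (A :\ x)] chi).
  by apply/constt_charP => //; exists ('chi_j + phi); rewrite ?addrA // rpredD ?irr_char.
have chi_j : j \in irr_constt ('Res[SymOn (A :\ x)] chi).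
  apply/constt_charP => //; exists ('chi_i + phi); first by rewrite rpredD ?irr_char.
  by rewrite E addrCA addrA.
have mult1 k : k \in irr_constt ('Res[SymOn (A :\ x)] chi) ->
    (i == k)%:R + (j == k)%:R + '[phi, 'chi_k] = 1.
  by move/(Res_point_mult1 chi_irr); rewrite E !cfdotDl !cfdot_irr.
have RSi : R * S \in irr _ by apply: mul_Sgn_irr.
have RS : R != R * S.
  apply: contraNneq ij => RS; rewrite -(inj_eq irr_inj).
  by case: (twist _ chi_i) => ->; case: (twist _ chi_j) => ->; rewrite -?RS.
have ijE : 'chi_i + 'chi_j = R + R * S.
  have : 'chi_i != 'chi_j by rewrite (inj_eq irr_inj).
  by case: (twist _ chi_i) => ->; case: (twist _ chi_j) => ->; rewrite ?eqxx // addrC.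
have phi0 : phi = 0.
  apply/eqP; rewrite -[_ == _]negbK; apply/negP=> /neq0_has_constt[k phi_k].
  have chi_k : k \in irr_constt ('Res[SymOn (A :\ x)] chi).
    apply/constt_charP => //; have /constt_charP[//|psi Npsi Ek] := phi_k.
    by exists ('chi_i + 'chi_j + psi); rewrite ?rpredD ?irr_char // E Ek addrCA.
  have : (i == k) || (j == k).
    rewrite -!(inj_eq irr_inj).
    have := ij; rewrite -(inj_eq irr_inj).
    by case: (twist _ chi_i) => ->; case: (twist _ chi_j) => ->;
       case: (twist _ chi_k) => ->; rewrite ?eqxx ?orbT.
  have := mult1 _ chi_k; rewrite inE in phi_k.
  have [ik|_] := eqVneq i k.
    subst k; rewrite eq_sym (negPf ij) addr0 => /eqP.
    by rewrite -subr_eq0 addrAC subrr add0r (negPf phi_k).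
  case: (j == k) => //; rewrite add0r => /eqP.
  by rewrite -subr_eq0 addrAC subrr add0r (negPf phi_k).
by case: (Alt2_Ref_twists xA yB zC wD chi_irr Ec RS); rewrite E phi0 addr0.
Qed.

End AltSquareReflection.

(** * The alternating cube of the reflection character *)

Lemma char_dotD0 (gT : finGroupType) (G : {group gT}) (theta phi psi : 'CF(G)) :
    theta \is a character -> phi \is a character -> psi \is a character ->
  '[theta, phi + psi] = 0 -> '[theta, phi] = 0 /\ '[theta, psi] = 0.
Proof.
move=> Nt Np Ns /eqP; rewrite cfdotDr paddr_eq0 ?char_dot_ge0 //.
by case/andP=> /eqP-> /eqP->.
Qed.

Section AltCube.

Variable T : finType.
Implicit Types A : {set T}.

Lemma cfRes_Alt3Ref A x : x \in A ->
  'Res[SymOn (A :\ x)] (cfAlt3 (cfRef A)) =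
    cfAlt3 (cfRef (A :\ x)) + cfAlt2 (cfRef (A :\ x)).
Proof. by move=> xA; rewrite cfRes_Alt3 ?SymSD1 // cfRes_Ref // cfAlt3D1. Qed.

Lemma cfRes_Alt2Fix A x : x \in A ->
  'Res[SymOn (A :\ x)] (cfAlt2 (cfFix A)) = cfAlt2 (cfFix (A :\ x)) + cfFix (A :\ x).
Proof. by move=> xA; rewrite cfRes_Alt2 ?SymSD1 // cfRes_Fix // cfAlt2D1. Qed.

Lemma cfRes_Sym2Fix A x : x \in A ->
  'Res[SymOn (A :\ x)] (cfSym2 (cfFix A)) =
    cfSym2 (cfFix (A :\ x)) + cfFix (A :\ x) + 1.
Proof. by move=> xA; rewrite cfRes_Sym2 ?SymSD1 // cfRes_Fix // cfSym2D1. Qed.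

Lemma Alt2Ref_char A x : x \in A -> cfAlt2 (cfRef A) \is a character.
Proof. by move=> xA; rewrite cfAlt2_char // (cfRef_char xA). Qed.

Lemma Alt3Ref_char A x : x \in A -> cfAlt3 (cfRef A) \is a character.
Proof. by move=> xA; rewrite cfAlt3_char // (cfRef_char xA). Qed.

(** On a point stabilizer, A^3(rho) becomes A^3(rho) + A^2(rho), without
    trivial constituent by induction; so A^3(rho) is orthogonal to pi. *)
Lemma Alt3Ref_dot1 A x : x \in A -> '[cfAlt3 (cfRef A), 1] = 0.
Proof.
move: {2}#|A| (erefl #|A|) => n; elim: n A x => [|n IHn] A x cA xA.
  by move: cA; rewrite (cardsD1 x) xA.
have [A1|[y yB]] := set_0Vmem (A :\ x).
  by rewrite -(setD1K xA) A1 setU0 cfRef_set1 cfAlt3_0 cfdot0l.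
have cB : #|A :\ x| = n by move: cA; rewrite (cardsD1 x) xA => -[].
have : '[cfAlt3 (cfRef A), 1 + cfRef A] = 0.
  rewrite -cfFix_Ref (cfFix_dot _ xA) cfRes_Alt3Ref // cfdotDl (IHn _ _ cB yB).
  by rewrite (Alt2Ref_dot1 yB) addr0.
by case/char_dotD0=> //; rewrite ?cfun1_char ?(Alt3Ref_char xA) ?(cfRef_char xA).
Qed.

Lemma Alt3Ref_Fix_sqr0 A x y z : x \in A -> y \in A :\ x -> z \in A :\ x :\ y ->
  '[cfAlt3 (cfRef A), cfFix A ^+ 2] = 0.
Proof.
move=> xA yB zC; rewrite expr2 (cfFix_mul_dot _ _ xA) cfRes_Fix // cfdotDr.
rewrite (cfFix_dot _ yB) cfRes_Alt3Ref // raddfD /= cfRes_Alt3Ref //.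
rewrite cfRes_Alt2Ref // 4!cfdotDl (Alt3Ref_dot1 yB) (Alt3Ref_dot1 zC).
by rewrite (Alt2Ref_dot1 yB) (Alt2Ref_dot1 zC) (cfRef_dot1 zC) !addr0.
Qed.

Lemma Alt3Ref_orthogonal A x y z : x \in A -> y \in A :\ x -> z \in A :\ x :\ y ->
  [/\ '[cfAlt3 (cfRef A), cfSym2 (cfFix A)] = 0,
      '[cfAlt3 (cfRef A), cfFix A] = 0,
      '[cfAlt3 (cfRef A), cfAlt2 (cfFix A)] = 0 &
      '[cfAlt3 (cfRef A), cfAlt2 (cfRef A)] = 0].
Proof.
move=> xA yB zC; have := Alt3Ref_Fix_sqr0 xA yB zC.
have N3 := Alt3Ref_char xA; have N2 := Alt2Ref_char xA; have NR := cfRef_char xA.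
have NF := cfFix_char A.
rewrite -cfSym2_Alt2 => /char_dotD0[]; rewrite ?cfSym2_char ?cfAlt2_char //.
move=> -> dA; rewrite dA; have := dA; rewrite {1}cfFix_Ref cfAlt2D1.
case/char_dotD0=> // -> dR; split=> //.
by rewrite cfFix_Ref cfdotDr dR (Alt3Ref_dot1 xA) addr0.
Qed.

(** Pairing A^3(rho) with S^2(pi) pi gives 0, so that A^3(rho) does not meet
    the (2, 1) functor of pi. Hence the pairing with A^2(pi) pi, which is 1, is
    the pairing with A^3(pi) = A^3(rho) + A^2(rho), and A^2(rho) contributes
    nothing. *)
Lemma Alt3Ref_irr A x y z w :
    x \in A -> y \in A :\ x -> z \in A :\ x :\ y -> w \in A :\ x :\ y :\ z ->
  cfAlt3 (cfRef A) \in irr (SymOn A).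
Proof.
move=> xA yB zC wD; have N3 := Alt3Ref_char xA; have NF := cfFix_char A.
have [dS dF dA dAR] := Alt3Ref_orthogonal yB zC wD.
have [_ _ _ dAR0] := Alt3Ref_orthogonal xA yB zC.
have Ri := cfRef_irr yB zC.
have dSF : '[cfAlt3 (cfRef A), cfSym2 (cfFix A) * cfFix A] = 0.
  rewrite (cfFix_mul_dot _ _ xA) cfRes_Alt3Ref // cfRes_Sym2Fix // !cfdotDr !cfdotDl.
  rewrite dS dF (Alt3Ref_dot1 yB) (Alt2_Sym2Fix0 yB zC Ri) (Alt2_Fix0 yB Ri).
  by rewrite (Alt2Ref_dot1 yB) !addr0.
have dAF : '[cfAlt3 (cfRef A), cfAlt2 (cfFix A) * cfFix A] = 1.
  rewrite (cfFix_mul_dot _ _ xA) cfRes_Alt3Ref // cfRes_Alt2Fix // !cfdotDr !cfdotDl.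
  rewrite dF dA (Alt2_Fix0 yB Ri) cfFix_Ref cfAlt2D1 cfdotDr (Alt2_Ref0 yB Ri).
  by rewrite irrWnorm ?(Alt2Ref_irr yB zC wD) // !addr0 add0r.
rewrite irrEchar N3 /=.
have : '[cfAlt3 (cfRef A), cfSym3 (cfFix A) + cfHook3 (cfFix A)] = 0.
  by rewrite -cfSym2_mul.
case/char_dotD0=> //; rewrite ?cfSym3_char ?cfHook3_char // => _ dH.
move: dAF; rewrite cfAlt2_mul cfdotDr dH addr0 cfFix_Ref cfAlt3D1 cfdotDr dAR0.
by rewrite addr0 => ->.
Qed.

(** As in [Alt3Ref_irr], the products of A^2(chi) with A^2(pi) pi and with
    A^3(rho) agree: the irreducible restriction makes A^2(chi) orthogonal to
    S^2(pi) pi and to A^2(rho). The first product is positive by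
    [Alt2_Res2_gt0] on the point stabilizer. *)
Lemma Alt2_Alt3Ref_gt0 A x y z (chi : 'CF(SymOn A)) :
    x \in A -> y \in A :\ x -> z \in A :\ x :\ y -> chi \in irr (SymOn A) ->
    'Res[SymOn (A :\ x)] chi \in irr (SymOn (A :\ x)) ->
    '['Res[SymOn (A :\ x :\ y)] chi] != 1 ->
  0 < '[cfAlt2 chi, cfAlt3 (cfRef A)].
Proof.
move=> xA yB zC chi_irr al_irr k1; set al := 'Res _ in al_irr.
have NF := cfFix_char A; have NA : cfAlt2 chi \is a character.
  by rewrite cfAlt2_char ?irrWchar.
have resK : 'Res[SymOn (A :\ x :\ y)] chi = 'Res al by rewrite cfResRes ?SymSD1.
have dAR : '[cfAlt2 chi, cfAlt2 (cfRef A)] = 0.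
  by rewrite (Alt2_Alt2Ref xA yB) // resK Alt2_point_dot1.
have : '[cfAlt2 chi, cfSym2 (cfFix A) * cfFix A] = 0.
  rewrite (cfFix_mul_dot _ _ xA) cfRes_Alt2 ?SymSD1 // cfRes_Sym2Fix // !cfdotDr.
  by rewrite (Alt2_Sym2Fix0 yB zC) // (Alt2_Fix0 yB) // Alt2_dot1 // !addr0.
rewrite cfSym2_mul => /char_dotD0[]; rewrite ?cfSym3_char ?cfHook3_char // => _ dH.
have : 0 < '[cfAlt2 chi, cfAlt2 (cfFix A) * cfFix A].
  rewrite (cfFix_mul_dot _ _ xA) cfRes_Alt2 ?SymSD1 // cfRes_Alt2Fix // cfdotDr.
  rewrite (Alt2_Fix0 yB) // addr0 (Alt2_Alt2Fix yB zC) //.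
  by apply: (Alt2_Res2_gt0 yB zC); rewrite // -resK.
by rewrite cfAlt2_mul cfFix_Ref cfAlt3D1 !cfdotDr -cfFix_Ref dH dAR !addr0.
Qed.

End AltCube.

Section ScalarClassSum.

Variables (gT : finGroupType) (G L : {group gT}) (chi : 'CF(G)).
Hypotheses (sLG : L \subset G) (chi_irr : chi \in irr G).
Hypothesis res_irr : 'Res[L] chi \in irr L.

(** If the restriction of a representation to L is irreducible, then, by
    Schur's lemma, it sends the sum of an orbit of L to a scalar. *)
Lemma scalar_orbit_sum g k : g \in G -> k \in G ->
  chi 1%g * \sum_(h in L) chi (g * k ^ h)%g = #|L|%:R * chi g * chi k.
Proof.
move=> Gg Gk; have /irr_reprP[[d rG] _ /= Echi] := chi_irr.
have /irr_reprP[[e rL] /= irrL EL] := res_irr.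
have irr_sub : mx_irreducible (subg_repr rG sLG).
  apply: mx_rsim_irr irrL; apply/cfRepr_rsimP; rewrite -EL Echi.
  by apply/eqP; rewrite cfRepr_sub.
pose M := \sum_(h in L) rG (k ^ h)%g.
have GJ h : h \in L -> (k ^ h)%g \in G by move=> Lh; rewrite groupJ // (subsetP sLG).
have centM : centgmx (subg_repr rG sLG) M.
  apply/centgmxP=> l Ll; rewrite /= /M mulmx_suml mulmx_sumr.
  rewrite [RHS](reindex_inj (mulIg l)) /=.
  apply: eq_big => [h|h Lh]; first by rewrite groupMr.
  have [Gl Gh] := (subsetP sLG _ Ll, subsetP sLG _ Lh).
  by rewrite conjgM -!repr_mxM ?groupJ // conjgC.
have abs_irr : mx_absolutely_irreducible (subg_repr rG sLG).
  exact: (groupC irr_sub).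
have /is_scalar_mxP[a Ea] := mx_abs_irr_cent_scalar abs_irr centM.
have trE u : u \in G -> chi u = \tr (rG u) by move=> Gu; rewrite Echi cfunE Gu.
have -> : \sum_(h in L) chi (g * k ^ h)%g = a * chi g.
  transitivity (\tr (rG g *m M)); last by rewrite Ea mul_mx_scalar mxtraceZ trE.
  rewrite /M mulmx_sumr raddf_sum; apply: eq_bigr => h Lh.
  by have Gkh := GJ _ Lh; rewrite (trE _ (groupM Gg Gkh)) repr_mxM.
have : \tr M = #|L|%:R * chi k.
  rewrite raddf_sum /= -sum1_card natr_sum mulr_suml; apply: eq_bigr => h Lh.
  by rewrite mul1r -(trE _ (GJ _ Lh)) cfunJ // (subsetP sLG).
have -> : chi 1%g = d%:R by rewrite trE // repr_mx1 mxtrace1.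
by rewrite Ea mxtrace_scalar mulrA (mulr_natl a) => ->; rewrite mulrAC.
Qed.

End ScalarClassSum.

(** * Irreducible restriction to a point stabilizer *)

Section IrreducibleRestriction.

Variables (T : finType) (A : {set T}).
Implicit Types (g : {perm T}) (chi : 'CF(SymOn A)).

Lemma char_SymV chi g : chi \is a character -> chi (g^-1)%g = chi g.
Proof. by move=> Nchi; rewrite char_inv // -{2}(char_Sym_real Nchi) cfunE. Qed.

Variables (x y : T).
Hypotheses (xA : x \in A) (yB : y \in A :\ x).
Local Notation G := (SymOn A).
Local Notation H := (SymOn (A :\ x)).
Local Notation K := (SymOn (A :\ x :\ y)).
Local Notation t := (tperm x y).

Let yA : y \in A. Proof. by case/setD1P: yB. Qed.
Let yx : y != x. Proof. by case/setD1P: yB. Qed.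
Let sHG : H \subset G := SymSD1 A x.
Let sKH : K \subset H := SymSD1 _ y.
Let sKG : K \subset G := subset_trans sKH sHG.
Let tG : t \in G. Proof. exact: tperm_Sym. Qed.

Lemma tperm_conj_Sym a b : a \in A -> b \in A -> a != b ->
  exists2 u, u \in G & tperm a b = (t ^ u)%g.
Proof.
move=> aA bA ab; pose u1 := tperm x a.
have u1b : (u1^-1)%g b != x.
  by rewrite tpermV (canF_eq (tpermK x a)) tpermL eq_sym.
exists (tperm y (u1^-1 b) * u1)%g.
  by rewrite groupM ?tperm_Sym // Sym_stab ?groupV ?tperm_Sym.
rewrite tpermJ !permM tpermL permKV (@tpermD _ y) ?tpermL //.
Qed.

(** If the restriction to the stabilizer of two points is irreducible, then the
    transposition of these points, which centralizes it, is a scalar, and so is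
    every transposition. The squares of the values of chi are then all equal. *)
Lemma irr_Res2_linear chi : chi \in irr G -> 'Res[K] chi \in irr K -> chi 1%g = 1.
Proof.
move=> chi_irr res_irr; have Nchi := irrWchar chi_irr.
have f0 : chi 1%g != 0 by have /irrP[i ->] := chi_irr; apply: irr1_neq0.
have mulT g : g \in G -> chi 1%g * chi (g * t)%g = chi g * chi t.
  move=> Gg; have := scalar_orbit_sum sKG chi_irr res_irr Gg tG.
  rewrite (eq_bigr (fun=> chi (g * t)%g)) => [|h Kh]; last first.
    congr (chi (_ * _)%g); apply/conjg_fixP/commgP/commute_sym/commgP/conjg_fixP.
    exact: tperm_point_cent Kh.
  rewrite sumr_const -(mulr_natl (chi _)) mulrCA -mulrA => /mulfI-> //.
  exact: neq0CG.
have t2 : chi t ^+ 2 = chi 1%g ^+ 2 by rewrite !expr2 -mulT // tperm2.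
have mulS g a b : g \in G -> a \in A -> b \in A -> a != b ->
    chi (g * tperm a b)%g ^+ 2 = chi g ^+ 2.
  move=> Gg aA bA ab; have [u Gu ->] := tperm_conj_Sym aA bA ab.
  have -> : (g * t ^ u = ((g ^ u^-1) * t) ^ u)%g by rewrite conjMg conjgKV.
  rewrite cfunJ //; have := mulT _ (groupJ Gg (groupVr Gu)).
  rewrite cfunJ ?groupV // => /(congr1 (fun a => a ^+ 2)).
  rewrite !exprMn t2 mulrC => /mulIf-> //; by rewrite expf_neq0.
(* Multiplying by a transposition, g fixes one point more. *)
have sqr (B : {set T}) g : B \subset A -> g \in SymOn B -> chi g ^+ 2 = chi 1%g ^+ 2.
  move: {2}#|B| (erefl #|B|) => n; elim: n B g => [|n IHn] B g cB sBA Bg.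
    by rewrite (@Sym_small _ B g) ?cB.
  have /set0Pn[b bB] : B != set0 by rewrite -card_gt0 cB.
  have cBb : #|B :\ b| = n by move: cB; rewrite (cardsD1 b) bB => -[].
  have sBb : B :\ b \subset A := subset_trans (subD1set _ _) sBA.
  have [gb|gb] := eqVneq (g b) b.
    by apply: (IHn (B :\ b)) => //; rewrite SymD1 Bg gb eqxx.
  have gbB : g b \in B by rewrite Sym_stab.
  have Gg := subsetP (SymS sBA) g Bg.
  rewrite -(mulS g b (g b)) ?(subsetP sBA) // 1?eq_sym //.
  apply: (IHn (B :\ b)) => //.
  by rewrite SymD1 groupM ?tperm_Sym //= permM tpermR.
have := irrWnorm chi_irr; rewrite cfdotE (eq_bigr (fun=> chi 1%g ^+ 2)).
  rewrite sumr_const -(mulr_natl (_ ^+ 2)) mulKf ?neq0CG // => /eqP.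
  rewrite sqrf_eq1 => /orP[/eqP //|/eqP E].
  by have := char1_ge0 Nchi; rewrite E oppr_ge0 ler10.
move=> g Gg; rewrite -{2}(char_Sym_real Nchi) cfunE conjCK -expr2.
exact: (sqr A).
Qed.

End IrreducibleRestriction.

Lemma cycle3_sqr (T : finType) (x y z : T) : x != y -> x != z -> y != z ->
  ((tperm x y * tperm x z) ^+ 2 = (tperm x y * tperm x z)^-1)%g.
Proof.
move=> xy xz yz; rewrite expgS expg1 invMg !tpermV.
have e1 : (tperm x z ^ tperm x y = tperm y z)%g.
  by rewrite tpermJ tpermL tpermD // eq_sym.
have e2 : (tperm y z ^ tperm x z = tperm x y)%g.
  by rewrite tpermJ tpermR tpermD // 1?tpermC // eq_sym.
have -> : (tperm x y * tperm x z * (tperm x y * tperm x z) =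
           (tperm x z ^ tperm x y) * tperm x z)%g.
  by rewrite conjgE tpermV !mulgA.
by rewrite e1 conjgC e2.
Qed.

Section RectangularDegree.

Variables (T : finType) (A : {set T}) (x y z : T).
Hypotheses (xA : x \in A) (yB : y \in A :\ x) (zC : z \in A :\ x :\ y).
Local Notation G := (SymOn A).
Local Notation H := (SymOn (A :\ x)).
Local Notation K := (SymOn (A :\ x :\ y)).
Local Notation t := (tperm x y).
Local Notation c3 := (tperm x y * tperm x z)%g.

Let yA : y \in A. Proof. by case/setD1P: yB. Qed.
Let zB : z \in A :\ x. Proof. by case/setD1P: zC. Qed.
Let zA : z \in A. Proof. by case/setD1P: zB. Qed.
Let xy : x != y. Proof. by case/setD1P: yB; rewrite eq_sym. Qed.
Let xz : x != z. Proof. by case/setD1P: zB; rewrite eq_sym. Qed.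
Let yz : y != z. Proof. by case/setD1P: zC; rewrite eq_sym. Qed.
Let tG : t \in G. Proof. exact: tperm_Sym. Qed.

Lemma nfix_tperm : nfix A t = #|A :\ x :\ y|.
Proof.
rewrite /nfix (big_setD1 x) // (big_setD1 y) //= tpermL tpermR (negPf xy).
rewrite eq_sym (negPf xy) !add0n -sum1_card; apply: eq_bigr => a.
by rewrite !inE => /and3P[ay ax _]; rewrite tpermD ?eqxx // eq_sym.
Qed.

Lemma nfix_cycle3 : nfix A c3 = #|A :\ x :\ y :\ z|.
Proof.
have c3x : c3 x = y by rewrite permM tpermL tpermD // eq_sym.
have c3y : c3 y = z by rewrite permM tpermR tpermL.
have c3z : c3 z = x by rewrite permM (@tpermD _ x y z) // tpermR.
rewrite /nfix (big_setD1 x) // (big_setD1 y) // (big_setD1 z) //= c3x c3y c3z.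
rewrite (eq_sym y) (negPf xy) (eq_sym z) (negPf yz) (negPf xz) !add0n -sum1_card.
apply: eq_bigr => a; rewrite !inE => /and4P[az ay ax _].
by rewrite permM !tpermD ?eqxx // eq_sym.
Qed.

(** The sum of the transpositions moving x acts as a scalar; take the trace of
    its square. *)
Lemma irr_Res_transposition_sum (chi : 'CF(G)) :
    chi \in irr G -> 'Res[H] chi \in irr H ->
  chi 1%g * (chi 1%g + #|A :\ x :\ y|%:R * chi c3) = #|A :\ x|%:R * chi t ^+ 2.
Proof.
move=> chi_irr res_irr.
have := scalar_orbit_sum (SymSD1 A x) chi_irr res_irr tG tG.
have HE (h : {perm T}) : h \in H -> chi (t * t ^ h)%g = if h \in K then chi 1%g else chi c3.
  move=> Hh; rewrite SymD1 Hh /=.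
  have hx : h x = x by move: Hh; rewrite SymD1 => /andP[_ /eqP].
  rewrite tpermJ hx; have [->|hy] := eqVneq; first by rewrite tperm2.
  have hyB : h y \in A :\ x by rewrite Sym_stab.
  have [hyx hyA] := setD1P hyB.
  have ux : tperm z (h y) x = x by rewrite tpermD // eq_sym.
  have uy : tperm z (h y) y = y by rewrite tpermD // eq_sym.
  by rewrite -(cfunJ chi c3 (tperm_Sym zA hyA)) conjMg !tpermJ tpermL ux uy.
have sKH := SymSD1 (A :\ x) y.
have cH : #|H|%:R = #|A :\ x|%:R * #|K|%:R :> algC by rewrite (card_SymD1 yB) natrM.
have cHK : #|H :\: K|%:R = #|A :\ x :\ y|%:R * #|K|%:R :> algC.
  by rewrite cardsDS // (card_SymD1 yB) (cardsD1 y) yB mulSn addKn natrM.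
rewrite (eq_bigr _ HE) (big_setID K) /= (setIidPr sKH).
rewrite (eq_bigr (fun=> chi 1%g)) => [|h ->] //.
rewrite sumr_const (eq_bigr (fun=> chi c3)) => [|h]; last first.
  by case/setDP=> _ /negPf->.
rewrite sumr_const -(mulr_natl (chi 1%g)) -(mulr_natl (chi c3)) cHK cH => E.
apply: (mulfI (neq0CG K)).
transitivity (chi 1%g * (#|K|%:R * chi 1%g
                + #|A :\ x :\ y|%:R * #|K|%:R * chi c3)); first by ring.
by rewrite E; ring.
Qed.

End RectangularDegree.

(** * The degree equations *)

Section Numerology.

(** For n = Q + 3 points, the first three equations are A^2(chi) = c A^3(rho)
    at 1, at a transposition, where chi has the value u, and at a 3-cycle,
    where it has the value v; the fourth is [irr_Res_transposition_sum].
    Eliminating c gives u, then v, and finally f in terms of Q. *)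
Lemma rect_algebra (Q f c u v : algC) :
    Q != 0 -> f != 0 -> f - 1 != 0 ->
    (f ^+ 2 - f) / 2
      = c * (((Q + 2) ^+ 3 - 3 * (Q + 2) * (Q + 2) + 2 * (Q + 2)) / 6) ->
    (u ^+ 2 - f) / 2 = c * ((Q ^+ 3 - 3 * Q * (Q + 2) + 2 * Q) / 6) ->
    (v ^+ 2 - v) / 2
      = c * (((Q - 1) ^+ 3 - 3 * (Q - 1) * (Q - 1) + 2 * (Q + 2)) / 6) ->
    f * (f + (Q + 1) * v) = (Q + 2) * u ^+ 2 ->
  [/\ (Q ^+ 2 - 13) * f = 2 * (Q - 5) * (Q + 2),
      (Q + 2) * u ^+ 2 = (Q + 2) * f ^+ 2 - 6 * (f ^+ 2 - f)
    & (Q + 1) * v = (Q - 5) * f + 6].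
Proof.
move=> q0 f0 f1 E1 E2 E3 E4.
have cE : c * (Q * (Q + 1) * (Q + 2)) = 3 * (f ^+ 2 - f).
  have -> : 3 * (f ^+ 2 - f) = 6 * ((f ^+ 2 - f) / 2) by field.
  by rewrite E1; field.
have uE : (Q + 2) * u ^+ 2 = (Q + 2) * f ^+ 2 - 6 * (f ^+ 2 - f).
  have -> : u ^+ 2 = 2 * ((u ^+ 2 - f) / 2) + f by field.
  rewrite E2.
  have -> : 6 * (f ^+ 2 - f) = 2 * (c * (Q * (Q + 1) * (Q + 2))) by rewrite cE; ring.
  have -> : (Q + 2) * f ^+ 2 = (Q + 2) * (2 * ((f ^+ 2 - f) / 2) + f) by field.
  by rewrite E1; field.
have vE : (Q + 1) * v = (Q - 5) * f + 6.
  apply: (mulfI f0).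
  have -> : f * ((Q + 1) * v) = f * (f + (Q + 1) * v) - f ^+ 2 by ring.
  by rewrite E4 uE; ring.
have key : (Q ^+ 2 - 13) * f = 2 * (Q - 5) * (Q + 2).
  have e3 : (Q + 1) ^+ 2 * (v ^+ 2 - v) * (Q + 2) = (Q + 1) * (f ^+ 2 - f) * (Q ^+ 2 - 6 * Q + 11).
    have -> : v ^+ 2 - v = 2 * ((v ^+ 2 - v) / 2) by field.
    rewrite E3; apply: (mulfI q0).
    transitivity ((Q + 1) * (Q ^+ 2 - 6 * Q + 11) / 3 * Q * (c * (Q * (Q + 1) * (Q + 2)))).
      by field.
    by rewrite cE; field.
  have e4 : (Q + 1) ^+ 2 * (v ^+ 2 - v) = (f - 1) * ((Q - 5) * f + 6) * (Q - 5).
    have -> : (Q + 1) ^+ 2 * (v ^+ 2 - v) = ((Q + 1) * v) * ((Q + 1) * v - (Q + 1)) by ring.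
    by rewrite vE; ring.
  have e5 : (Q - 5) * ((Q - 5) * f + 6) * (Q + 2) = (Q + 1) * f * (Q ^+ 2 - 6 * Q + 11).
    apply: (mulfI f1); transitivity ((Q + 1) ^+ 2 * (v ^+ 2 - v) * (Q + 2)).
      by rewrite e4; ring.
    by rewrite e3; ring.
  apply: (mulfI (x := 3)); first by rewrite pnatr_eq0.
  apply/eqP; rewrite -subr_eq0; apply/eqP.
  transitivity ((Q + 1) * f * (Q ^+ 2 - 6 * Q + 11) - (Q - 5) * ((Q - 5) * f + 6) * (Q + 2)).
    by ring.
  by rewrite e5 subrr.
by [].
Qed.

(** In [rect_algebra] the degree F is 2 (m - 5) (m + 2) / (m^2 - 13), which is
    below 2 for m > 3. *)
Lemma rect_numerology (m F : nat) (c u v : algC) (q := m%:R : algC) :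
    (0 < m)%N -> (1 < F)%N ->
    (F%:R ^+ 2 - F%:R) / 2
      = c * (((q + 2) ^+ 3 - 3 * (q + 2) * (q + 2) + 2 * (q + 2)) / 6) ->
    (u ^+ 2 - F%:R) / 2 = c * ((q ^+ 3 - 3 * q * (q + 2) + 2 * q) / 6) ->
    (v ^+ 2 - v) / 2
      = c * (((q - 1) ^+ 3 - 3 * (q - 1) * (q - 1) + 2 * (q + 2)) / 6) ->
    F%:R * (F%:R + (q + 1) * v) = (q + 2) * u ^+ 2 ->
  m = 1%N \/ [/\ m = 3, F = 5, u ^+ 2 = 1 & v = -1].
Proof.
move=> m0 F1 E1 E2 E3 E4.
have q0 : q != 0 by rewrite pnatr_eq0 -lt0n.
have f0 : F%:R != 0 :> algC by rewrite pnatr_eq0 -lt0n ltnW.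
have f1 : F%:R - 1 != 0 :> algC by rewrite subr_eq0 (eqr_nat _ F 1) gtn_eqF.
have [key uE vE] := rect_algebra q0 f0 f1 E1 E2 E3 E4.
(* The equation of the degree in natural numbers, with terms moved so that no
   subtraction is left. *)
have kN : (m * m * F + 6 * m + 20 = 2 * m * m + 13 * F)%N.
  apply/eqP; rewrite -(eqr_nat algC) !natrD !natrM -/q -subr_eq0; apply/eqP.
  transitivity ((q ^+ 2 - 13) * F%:R - 2 * (q - 5) * (q + 2)); first by ring.
  by rewrite key subrr.
have [m1|[m3 F5]] : m = 1%N \/ m = 3 /\ F = 5.
  case: m m0 kN {q q0 key uE vE E1 E2 E3 E4} => [//|[|[|[|m]]]] _ kN.
  - by left.
  - by lia.
  - by right; lia.
  by nia.
- by left.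
right; split=> //.
  apply: (mulfI (x := 5)); first by rewrite pnatr_eq0.
  by move: uE; rewrite /q m3 F5 => uE; transitivity ((3 + 2) * u ^+ 2); [ring | rewrite uE; ring].
apply: (mulfI (x := 4)); first by rewrite pnatr_eq0.
by move: vE; rewrite /q m3 F5 => vE; transitivity ((3 + 1) * v); [ring | rewrite vE; ring].
Qed.

End Numerology.

(** * Homogeneous squares of irreducible characters *)

Section Inhomogeneous.

Variables (gT : finGroupType) (G : {group gT}).

Lemma inhomogeneous_or_multiple (phi psi : 'CF(G)) : psi \in irr G -> '[phi, psi] != 0 ->
  inhomogeneous phi \/ phi = '[phi, psi] *: psi.
Proof.
case/irrP=> i -> phi_i.
have [/existsP[j /andP[phi_j ij]]|/existsPn no] :=
  boolP [exists j, (j \in irr_constt phi) && (j != i)].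
  by left; exists j, i.
right; rewrite {1}[phi]cfun_sum_constt (big_pred1 i) // => j; rewrite inE.
have [->|ji] := eqVneq j i; first by rewrite phi_i /= eqxx.
by have := no j; rewrite ji andbT inE /= (negPf ji) => /negPf.
Qed.

Lemma inhomogeneous_reducible (phi : 'CF(G)) : inhomogeneous phi -> reducible phi.
Proof.
case=> i [j [phi_i phi_j ij]]; apply/negP => /irrP[k Ek].
move: phi_i phi_j ij; rewrite Ek !constt_irr => /eqP-> /eqP->.
by rewrite eqxx.
Qed.

End Inhomogeneous.

Section HomogeneousSquares.

Variables (T : finType) (A : {set T}).
Local Notation G := (SymOn A).
Implicit Type chi : 'CF(G).

(** The trivial character occurs exactly once in S^2(chi); if nothing else
    occurs, then f (f + 1) / 2 = 1 for the degree f of chi. *)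
Lemma Sym2_inhomogeneous chi :
  chi \in irr G -> chi 1%g != 1 -> inhomogeneous (cfSym2 chi).
Proof.
move=> chi_irr f1; have dS := Sym2_dot1 chi_irr.
have [||//|E] := @inhomogeneous_or_multiple _ _ (cfSym2 chi) 1; rewrite ?cfun1_irr ?dS ?oner_eq0 //.
case/negP: f1; have /natrP[F EF] := Cnat_char1 (irrWchar chi_irr).
have := congr1 (fun phi : 'CF(G) => phi 1%g) E.
rewrite dS scale1r cfun11 cfSym2_val ?group1 // expg1n EF.
move/(congr1 (fun a => a * 2)); rewrite mulfVK ?pnatr_eq0 // mul1r -natrX -natrD.
by move/eqP; rewrite eqr_nat => /eqP FE; rewrite (_ : F = 1%N) //; nia.
Qed.

Variables (x y z : T).
Hypotheses (xA : x \in A) (yB : y \in A :\ x) (zC : z \in A :\ x :\ y).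
Local Notation H := (SymOn (A :\ x)).
Local Notation t := (tperm x y).
Local Notation c3 := (tperm x y * tperm x z)%g.

Let yA : y \in A. Proof. by case/setD1P: yB. Qed.
Let zB : z \in A :\ x. Proof. by case/setD1P: zC. Qed.
Let zA : z \in A. Proof. by case/setD1P: zB. Qed.
Let xy : x != y. Proof. by case/setD1P: yB; rewrite eq_sym. Qed.
Let xz : x != z. Proof. by case/setD1P: zB; rewrite eq_sym. Qed.
Let yz : y != z. Proof. by case/setD1P: zC; rewrite eq_sym. Qed.
Let tG : t \in G. Proof. exact: tperm_Sym. Qed.
Let c3G : c3 \in G. Proof. by rewrite groupM ?tperm_Sym. Qed.

Lemma Alt2_eq_Alt3Ref chi c :
    (0 < #|A :\ x :\ y :\ z|)%N -> chi \in irr G -> 'Res[H] chi \in irr H ->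
    chi 1%g != 1 -> cfAlt2 chi = c *: cfAlt3 (cfRef A) ->
  #|A| = 4 \/ [/\ #|A| = 6, chi 1%g = 5, chi t ^+ 2 = 1 & chi c3 = -1].
Proof.
move=> m0 chi_irr res_irr f1 Ec; have Nchi := irrWchar chi_irr.
have Hsum := irr_Res_transposition_sum xA yB zC chi_irr res_irr.
have c3sq : (c3 ^+ 2 = c3^-1)%g by apply: cycle3_sqr.
have c3cb : (c3 ^+ 3 = 1)%g by rewrite expgS c3sq mulgV.
have tsq : (t ^+ 2 = 1)%g by rewrite expgS expg1 tperm2.
have tcb : (t ^+ 3 = t)%g by rewrite expgS tsq mulg1.
have NR := cfRef_char xA.
have cD := cardsD1 z (A :\ x :\ y); have cC := cardsD1 y (A :\ x).
have cB := cardsD1 x A; rewrite xA in cB; rewrite yB in cC; rewrite zC in cD.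
set m := #|A :\ x :\ y :\ z| in m0 cD.
rewrite cD in cC; rewrite cC in cB.
have R1 : cfRef A 1%g = m%:R + 2 by rewrite (cfRef1 xA) cC -natrD addn2.
have Rt : cfRef A t = m%:R.
  by rewrite !cfunE cfun1E tG (nfix_tperm xA yB) cD -natrB ?addn1 ?subn1.
have Rc : cfRef A c3 = m%:R - 1.
  by rewrite !cfunE cfun1E c3G (nfix_cycle3 xA yB zC).
have Ev g : cfAlt2 chi g = c * cfAlt3 (cfRef A) g by rewrite Ec cfunE.
have E1 := Ev 1%g; have Et := Ev t; have E3 := Ev c3.
rewrite cfAlt2_val // cfAlt3_val // !expg1n R1 in E1.
rewrite cfAlt2_val // cfAlt3_val // tsq tcb R1 Rt in Et.
rewrite cfAlt2_val // cfAlt3_val // c3sq c3cb !char_SymV // R1 Rc in E3.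
have /natrP[F EF] := Cnat_char1 Nchi; rewrite EF in f1 E1 Et Hsum *.
have F1 : (1 < F)%N.
  case: F EF f1 {E1 Et Hsum} => [|[|F]] // EF; last by rewrite eqxx.
  by have /irrP[i Ei] := chi_irr; move/eqP: EF; rewrite Ei (negPf (irr1_neq0 i)).
rewrite cD cC !add1n -!natr1 in Hsum.
have [|m1|[m3 F5 t1 c31]] := rect_numerology m0 F1 E1 Et E3.
- by rewrite Hsum; ring.
- by left; rewrite cB m1.
by right; rewrite cB m3 F5.
Qed.

End HomogeneousSquares.

Section HomogeneousAlt2.

Variables (T : finType) (A : {set T}) (x y z : T).
Hypotheses (xA : x \in A) (yB : y \in A :\ x) (zC : z \in A :\ x :\ y).
Local Notation G := (SymOn A).
Local Notation H := (SymOn (A :\ x)).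
Local Notation K := (SymOn (A :\ x :\ y)).
Local Notation t := (tperm x y).
Local Notation c3 := (tperm x y * tperm x z)%g.

(** The alternating square of chi contains the alternating square of the
    reflection character if the restriction of chi to a point stabilizer is
    reducible, and its alternating cube otherwise; a homogeneous A^2(chi) is a
    multiple of this one. *)
Theorem homogeneous_Alt2 (chi : 'CF(G)) : chi \in irr G -> chi 1%g != 1 ->
  [\/ inhomogeneous (cfAlt2 chi), linear_or_reflection chi, #|A| = 4
    | 'Res[H] chi \in irr H /\
      [/\ #|A| = 6, chi 1%g = 5, chi t ^+ 2 = 1 & chi c3 = -1]].
Proof.
move=> chi_irr f1; have Nchi := irrWchar chi_irr.
have [/eqP n1|n1] := boolP ('['Res[H] chi] == 1); last first.
  have d2 : '[cfAlt2 chi, cfAlt2 (cfRef A)] != 0.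
    by rewrite (Alt2_Alt2Ref xA yB) // gt_eqF // (Alt2_Res2_gt0 xA yB).
  have [A0|Ai] := Alt2Ref_char0 xA; first by rewrite A0 cfdot0r eqxx in d2.
  have [inh|E] := inhomogeneous_or_multiple Ai d2; first by constructor 1.
  by constructor 2; apply: irr_Alt2_Ref E.
have res_irr : 'Res[H] chi \in irr H by rewrite irrEchar cfRes_char // n1 eqxx.
have k1 : '['Res[K] chi] != 1.
  apply: contraNneq f1 => k1; apply/eqP; apply: (irr_Res2_linear xA yB) => //.
  by rewrite irrEchar cfRes_char // k1 eqxx.
have d3 : '[cfAlt2 chi, cfAlt3 (cfRef A)] != 0.
  by rewrite gt_eqF // (Alt2_Alt3Ref_gt0 xA yB zC).
have [D0|[w wD]] := set_0Vmem (A :\ x :\ y :\ z).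
  case/eqP: d3; rewrite (_ : cfAlt3 _ = 0) ?cfdot0r //; apply/eqP.
  rewrite -char1_eq0 ?(Alt3Ref_char xA) // cfAlt3_val // !expg1n (cfRef1 xA).
  rewrite (cardsD1 y) yB (cardsD1 z) zC D0 cards0; apply/eqP.
  by rewrite (_ : (true + (true + 0))%N = 2) //; field.
have [inh|E] := inhomogeneous_or_multiple (Alt3Ref_irr xA yB zC wD) d3; first by constructor 1.
have m0 : (0 < #|A :\ x :\ y :\ z|)%N by rewrite (cardsD1 w) wD.
have [A4|A6] := Alt2_eq_Alt3Ref xA yB zC m0 chi_irr res_irr f1 E.
  by constructor 3.
by constructor 4.
Qed.

End HomogeneousAlt2.

Section SmallRestrictions.

Variables (T : finType) (A : {set T}).
Local Notation G := (SymOn A).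
Implicit Type chi : 'CF(G).

(** Otherwise the restriction to the stabilizer of a point is one of 1, sgn,
    rho and rho * sgn, and has degree 1 or 4. *)
Lemma deg5_no_Sym4 x y chi (xi : 'CF(SymOn (A :\ x :\ y))) :
    x \in A -> y \in A :\ x -> #|A| = 6 -> chi \in irr G ->
    'Res[SymOn (A :\ x)] chi \in irr (SymOn (A :\ x)) -> chi 1%g = 5 ->
    xi = 1 \/ xi = cfSgn (SymOn (A :\ x :\ y)) ->
  '['Res[SymOn (A :\ x :\ y)] chi, xi] = 0.
Proof.
move=> xA yB A6 chi_irr res_irr f5 xiE; apply: contra_eq f5 => dxi.
have cB : #|A :\ x| = 5 by move: A6; rewrite (cardsD1 x) xA => -[].
have cC : #|A :\ x :\ y| = 4 by move: cB; rewrite (cardsD1 y) yB => -[].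
have R4 : cfRef (A :\ x) 1%g = 4 by rewrite (cfRef1 yB) cC.
rewrite -(cfResRes _ (SymSD1 _ y) (SymSD1 _ x)) in dxi.
rewrite -(cfRes1 (SymOn (A :\ x))); set al := 'Res[SymOn (A :\ x)] chi in dxi res_irr *.
suff [-> | ->] : al 1%g = 1 \/ al 1%g = 4 by rewrite ?(eqr_nat _ 1 5) ?(eqr_nat _ 4 5).
have S1 := lin_char1 (cfSgn_lin (SymOn (A :\ x))).
case: xiE dxi => ->.
  by case/(irr_Res_point_triv yB res_irr) => ->; rewrite ?cfun11; auto.
case/(irr_Res_point_sgn yB res_irr) => ->; first by left.
by right; rewrite cfunE R4 S1 mulr1.
Qed.

Lemma sum_Sym3 (R : nmodType) (a b c : T) (F : {perm T} -> R) :
    a != b -> a != c -> b != c ->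
  \sum_(s in SymOn [set a; b; c]) F s =
    F 1%g + F (tperm a b) + F (tperm a c) + F (tperm b c)
      + F (tperm a b * tperm a c)%g + F ((tperm a b * tperm a c)^-1)%g.
Proof.
move=> ab ac bc.
pose L := [:: 1%g; tperm a b; tperm a c; tperm b c;
  (tperm a b * tperm a c)%g; ((tperm a b * tperm a c)^-1)%g].
have E : (a == b = false) * (a == c = false) * (b == c = false) * (b == a = false)
         * (c == a = false) * (c == b = false).
  by rewrite (eq_sym b a) (eq_sym c a) (eq_sym c b) (negPf ab) (negPf ac) (negPf bc).
have tE : (tperm a b c = c) * (tperm a c b = b) * (tperm b c a = a).
  by rewrite !tpermD // ?E.
have uL : uniq L.
  apply: (@map_uniq _ _ (fun s : {perm T} => (s a, s b))).
  rewrite /= !inE invMg !tpermV !permM !perm1 !(tpermL, tpermR, tE).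
  by rewrite !xpair_eqE !eqxx !E.
have cL : #|L| = #|SymOn [set a; b; c]|.
  rewrite (card_uniqP uL) perm.card_Sym -setUA cardsU1 cards2 !inE.
  by rewrite (negPf ab) (negPf ac) bc.
have memL s : s \in L = (s \in SymOn [set a; b; c]).
  suff sub : L \subset SymOn [set a; b; c] by exact: (subset_cardP cL sub).
  have [aB bB cB] : [/\ a \in [set a; b; c], b \in [set a; b; c] & c \in [set a; b; c]].
    by rewrite !inE !eqxx !orbT.
  apply/subsetP; apply/allP; rewrite /= group1 groupV !groupM ?tperm_Sym //.
rewrite -(eq_bigl _ _ memL) -big_uniq //= !big_cons big_nil addr0 !addrA //.
Qed.

Lemma Res_Sym3_dot (x y z : T) chi :
    x \in A -> y \in A :\ x -> z \in A :\ x :\ y -> chi \in irr G ->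
    chi 1%g = 5 -> chi (tperm x y * tperm x z)%g = -1 ->
  '['Res[SymOn [set x; y; z]] chi, 1] = (1 + chi (tperm x y)) / 2
  /\ '['Res[SymOn [set x; y; z]] chi, cfSgn (SymOn [set x; y; z])]
       = (1 - chi (tperm x y)) / 2.
Proof.
move=> xA yB zC chi_irr f5 z1; set J := [set x; y; z].
have [yx yA] := setD1P yB; have [zy zB] := setD1P zC; have [zx zA] := setD1P zB.
have [xy xz yz] : [/\ x != y, x != z & y != z] by rewrite (eq_sym x y) (eq_sym x z) (eq_sym y z).
have [xJ yJ zJ] : [/\ x \in J, y \in J & z \in J] by rewrite !inE !eqxx !orbT.
have sJA : SymOn J \subset G.
  by apply: SymS; apply/subsetP=> a; rewrite !inE => /orP[/pred2P[]|/eqP]->.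
have cJ : #|SymOn J| = 6.
  by rewrite perm.card_Sym /J -setUA cardsU1 cards2 !inE (negPf xy) (negPf xz) yz.
have Nchi := irrWchar chi_irr.
have conj_t a b : a \in J -> b \in J -> a != b -> chi (tperm a b) = chi (tperm x y).
  move=> aJ bJ ab; have sJ : J \subset A.
    by apply/subsetP=> u; rewrite !inE => /orP[/pred2P[]|/eqP]->.
  have [u Gu ->] := tperm_conj_Sym xA yB (subsetP sJ _ aJ) (subsetP sJ _ bJ) ab.
  exact: cfunJ.
have dotE (xi : 'CF(SymOn J)) : '['Res chi, xi] = 6^-1 *
   (\sum_(s in SymOn J) chi s * (xi s)^*).
  rewrite cfdotE cJ; congr (_ * _); apply: eq_bigr => s Js.
  by rewrite cfResE.
rewrite !dotE !sum_Sym3 // (conj_t x z) // (conj_t y z) // char_SymV // z1 f5.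
rewrite !cfun1E !cfSgnE ?groupV ?groupM ?group1 ?tperm_Sym //.
rewrite !odd_permV !odd_permM !odd_tperm odd_perm1 xy xz yz /= !expr1 !expr0.
by rewrite !rmorphN !rmorph1; split; field.
Qed.

End SmallRestrictions.

(** * The Specht module *)

Lemma mxtrace_idem (F : fieldType) n (M : 'M[F]_n) :
  M *m M = M -> \tr M = (\rank M)%:R.
Proof.
move=> MM; move: (col_base_full M) (row_base_free M) (mulmx_base M).
move: (col_base M) (row_base M) => C R fullC freeR CR.
have RC : R *m C = 1%:M.
  apply: (row_full_inj fullC); apply: (row_free_inj freeR) => /=.
  by rewrite mulmx1 !mulmxA CR -mulmxA CR MM.
by rewrite -{1}CR mxtrace_mulC RC mxtrace1.
Qed.

(** The projection onto the isotypic part of xi has trace the multiplicity of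
    xi, and fixes v. *)
Lemma eigenvector_Res_dot (gT : finGroupType) (G Y : {group gT}) n
    (rG : mx_representation algC G n) (xi : 'CF(Y)) (v : 'rV_n) :
    Y \subset G -> xi \is a linear_char -> v != 0 ->
    (forall y, y \in Y -> v *m rG y = xi y *: v) ->
  '['Res[Y] (cfRepr rG), xi] != 0.
Proof.
move=> sYG lin_xi v0 vY; pose M := #|Y|%:R^-1 *: \sum_(y in Y) (xi y)^* *: rG y.
have normY y : y \in Y -> (xi y)^* * xi y = 1.
  by move=> Yy; rewrite mulrC -normCK normC_lin_char // expr1n.
have vM : v *m M = v.
  rewrite -scalemxAr mulmx_sumr (eq_bigr (fun=> v)) => [|y Yy].
    by rewrite sumr_const -scaler_nat scalerA mulVf ?neq0CG // scale1r.
  by rewrite -scalemxAr vY // scalerA normY // scale1r.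
have rM y : y \in Y -> rG y *m M = xi y *: M.
  move=> Yy; rewrite -scalemxAr scalerA mulrC -scalerA; congr (_ *: _).
  rewrite mulmx_sumr scaler_sumr [RHS](reindex_inj (mulgI y)) /=.
  apply: eq_big => [z|z Yz]; first by rewrite groupMl.
  rewrite -scalemxAr scalerA lin_charM // rmorphM /= mulrA [xi y * _]mulrC.
  by rewrite normY // mul1r repr_mxM ?(subsetP sYG).
have MM : M *m M = M.
  rewrite {1}/M -scalemxAl mulmx_suml (eq_bigr (fun=> M)) => [|y Yy].
    by rewrite sumr_const -scaler_nat scalerA mulVf ?neq0CG // scale1r.
  by rewrite -scalemxAl rM // scalerA normY // scale1r.
have <- : \tr M = '['Res[Y] (cfRepr rG), xi].
  rewrite cfdotE mxtraceZ raddf_sum; congr (_ * _); apply: eq_bigr => y Yy /=.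
  by rewrite cfResE // cfunE (subsetP sYG) // mxtraceZ mulrC.
rewrite mxtrace_idem // pnatr_eq0 mxrank_eq0; apply: contraNneq v0 => M0.
by rewrite -vM M0 mulmx0.
Qed.

Section DoubleTransversal.

Variables (T : finType) (u v : T -> nat).
Hypothesis left_just : forall i q, (q <= v i)%N -> exists j, u j = u i /\ v j = q.

(** If g puts the cells of each row in different columns, then each of these
    columns meets that row. For consider the cells in the first k columns, with
    k the column of g i: no row has fewer of them than cells that g sends into
    the first k columns. The totals agree, so equality holds in every row. But
    if the row of i does not meet the column k, it lies in the first k columns,
    and g sends its cell i to the column k, outside of them. *)
Lemma row_meets_column (g : {perm T}) :
    (forall i j, u i = u j -> v (g i) = v (g j) -> i = j) ->
  forall i, exists j, u j = u i /\ v j = v (g i).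
Proof.
move=> g_inj i0; set k := v (g i0).
have [/existsP[j /andP[/eqP uj /eqP vj]]|/existsPn no] :=
  boolP [exists j, (u j == u i0) && (v j == k)]; first by exists j.
pose row r := [set i | u i == r].
pose M r := [set i | (u i == r) && (v i < k)%N].
pose N r := [set i | (u i == r) && (v (g i) < k)%N].
have short r : ~~ [exists j, (u j == r) && (k <= v j)%N] -> M r = row r.
  move=> /existsPn nr; apply/setP=> j; rewrite !inE; have := nr j.
  by case: (u j == r) => //=; rewrite -ltnNge => ->.
have le_row r : (#|N r| <= #|M r|)%N.
  have [/existsP[j /andP[/eqP uj kj]]|/short->] :=
    boolP [exists j, (u j == r) && (k <= v j)%N]; last first.
    by apply: subset_leq_card; apply/subsetP=> j; rewrite !inE => /andP[].
  apply: (@leq_trans k).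
    rewrite cardE -(size_map (fun i => v (g i))) -[X in (_ <= X)%N](size_iota 0 k).
    apply: uniq_leq_size.
      rewrite map_inj_in_uniq ?enum_uniq // => a b; rewrite !mem_enum !inE.
      by move=> /andP[/eqP ua _] /andP[/eqP ub _]; apply: g_inj; rewrite ua ub.
    by move=> q /mapP[i]; rewrite mem_enum inE => /andP[_ ik] ->; rewrite mem_iota.
  rewrite cardE -(size_map v) -[X in (X <= _)%N](size_iota 0 k).
  apply: uniq_leq_size; first exact: iota_uniq.
  move=> q; rewrite mem_iota /= add0n => qk.
  have [i [ui vi]] := left_just (leq_trans (ltnW qk) kj).
  by apply/mapP; exists i; rewrite // mem_enum inE ui uj eqxx vi.
have lt_row : (#|N (u i0)| < #|M (u i0)|)%N.
  rewrite short; last first.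
    apply/existsPn=> j; apply/negP=> /andP[/eqP uj kj].
    have [i [ui vi]] := left_just kj.
    by have /negP[] := no i; rewrite ui uj vi !eqxx.
  apply: proper_card; apply/properP; split.
    by apply/subsetP=> j; rewrite !inE => /andP[].
  by exists i0; rewrite !inE ?eqxx //= ltnn.
have tot (P : pred T) : #|[set i | P i]| =
    (\sum_(r < (\max_i u i).+1) #|[set i | (u i == r) && P i]|)%N.
  rewrite -sum1dep_card (partition_big (fun i => inord (u i) : 'I_(\max_i u i).+1) xpredT) //=.
  apply: eq_bigr => r _; rewrite sum1dep_card; apply: eq_card => i; rewrite !inE andbC.
  by rewrite -val_eqE /= inordK // ltnS; apply: leq_bigmax.
have : (#|[set i | v (g i) < k]| < #|[set i | v i < k]|)%N.
  rewrite !tot (bigD1 (inord (u i0))) //= [X in (_ < X)%N](bigD1 (inord (u i0))) //=.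
  rewrite inordK ?ltnS ?leq_bigmax // -addSn leq_add //.
  by apply: leq_sum => r _; apply: le_row.
rewrite ltnNge (_ : [set i | v i < k]%N = g @: [set i | v (g i) < k]%N).
  by rewrite leq_imset_card.
apply/setP=> i; rewrite inE; apply/idP/imsetP => [vi|[j]].
  by exists (g^-1 i)%g; rewrite ?inE ?permKV.
by rewrite inE => vj ->.
Qed.

(** Move each cell i within its row to the column of g i. *)
Lemma row_column_factor (g : {perm T}) :
    (forall i j, u i = u j -> v (g i) = v (g j) -> i = j) ->
  exists (r c : {perm T}), [/\ forall i, u (r i) = u i, forall i, v (c i) = v i & g = (r * c)%g].
Proof.
move=> g_inj; have ex i : exists j, (u j == u i) && (v j == v (g i)).
  by have [j [uj vj]] := row_meets_column g_inj i; exists j; rewrite uj vj !eqxx.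
pose h i := xchoose (ex i).
have hP i : u (h i) = u i /\ v (h i) = v (g i).
  by have /andP[/eqP-> /eqP->] := xchooseP (ex i).
have hinj : injective h.
  move=> i j hij; have [[ui vi] [uj vj]] := (hP i, hP j).
  by apply: g_inj; rewrite -?ui -?vi hij.
pose r := perm hinj; exists r, (r^-1 * g)%g; split.
- by move=> i; rewrite permE; case: (hP i).
- move=> i; rewrite permM; have [_ <-] := hP (r^-1 i)%g.
  by rewrite -[h _](permE hinj) permKV.
by rewrite mulKVg.
Qed.

End DoubleTransversal.

Section YoungSymmetrizer.

Variables (n : nat) (la : seq nat).
Hypothesis la_n : sumn la = n.

Local Notation G := [set: 'S_n]%G.
Local Notation aG := (regular_repr algC G).
Local Notation row := (fun i : 'I_n => reshape_index la i).
Local Notation col := (fun i : 'I_n => reshape_offset la i).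
Local Notation R := (row_stab n la).
Local Notation C := (col_stab n la).
Local Notation e := (young_symmetrizer n la).

Lemma row_stabP (s : 'S_n) : reflect (forall i, row (s i) = row i) (s \in R).
Proof. by rewrite inE; apply: (iffP forallP) => E i; apply/eqP. Qed.

Lemma col_stabP (s : 'S_n) : reflect (forall i, col (s i) = col i) (s \in C).
Proof. by rewrite inE; apply: (iffP forallP) => E i; apply/eqP. Qed.

Lemma cell_inj (i j : 'I_n) : row i = row j -> col i = col j -> i = j.
Proof.
move=> ij ij'; apply: val_inj.
by rewrite /= -(reshape_indexK la i) -(reshape_indexK la j) ij ij'.
Qed.

Lemma cell_exists r c : (c < nth 0 la r)%N ->
  exists i : 'I_n, row i = r /\ col i = c.
Proof.
move=> cr; have lt_n := flatten_indexP cr; rewrite la_n in lt_n.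
by exists (Ordinal lt_n); rewrite /= flatten_indexKl // flatten_indexKr.
Qed.

Lemma col_lt_row (i : 'I_n) : (col i < nth 0 la (row i))%N.
Proof. by apply: reshape_offsetP; rewrite la_n. Qed.

Lemma cells_left_just (i : 'I_n) q : (q <= col i)%N ->
  exists j : 'I_n, row j = row i /\ col j = q.
Proof. by move=> qi; apply/cell_exists/(leq_ltn_trans qi)/col_lt_row. Qed.

Definition row_sum : 'M[algC]_#|G| := \sum_(r in R) aG r.
Definition col_sum : 'M[algC]_#|G| := \sum_(c in C) (-1) ^+ c *: aG c.

Lemma aG_M (s s' : 'S_n) : aG (s * s')%g = aG s *m aG s'.
Proof. by rewrite repr_mxM ?inE. Qed.

Lemma row_sumM s : s \in R -> row_sum *m aG s = row_sum.
Proof.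
move=> /row_stabP Rs; rewrite mulmx_suml [RHS](reindex_inj (mulIg s)) /=.
apply: eq_big => [r|r _]; last by rewrite aG_M.
apply/row_stabP/row_stabP => Rr i; first by rewrite permM Rs.
by rewrite -(Rs (r i)) -permM Rr.
Qed.

Lemma col_sumM s : s \in C -> aG s *m col_sum = (-1) ^+ s *: col_sum.
Proof.
move=> /col_stabP Cs; rewrite mulmx_sumr scaler_sumr [RHS](reindex_inj (mulgI s)) /=.
apply: eq_big => [c|c _].
  apply/col_stabP/col_stabP => Cc i; first by rewrite permM Cc Cs.
  by rewrite -(permKV s i) -permM Cc Cs.
by rewrite -scalemxAr aG_M scalerA odd_permM signr_addb mulrA -signr_addb addbb mul1r.
Qed.

Lemma col_sum_right s : s \in C -> col_sum *m aG s = (-1) ^+ s *: col_sum.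
Proof.
move=> /col_stabP Cs; rewrite mulmx_suml scaler_sumr [RHS](reindex_inj (mulIg s)) /=.
apply: eq_big => [c|c _].
  apply/col_stabP/col_stabP => Cc i; first by rewrite permM Cs Cc.
  by rewrite -(Cs (c i)) -permM Cc.
rewrite -scalemxAl aG_M scalerA odd_permM addbC signr_addb mulrA -signr_addb.
by rewrite addbb mul1r.
Qed.

(** Unless g is the product of a row and a column permutation, some
    transposition is a row permutation conjugated by g to a column permutation,
    and the sign makes the product vanish. *)
Lemma row_mul_col g : exists a, row_sum *m aG g *m col_sum = a *: (row_sum *m col_sum).
Proof.
have [/existsP[i /existsP[j /and3P[ij /eqP rij /eqP cij]]]|/existsPn no] :=
  boolP [exists i : 'I_n, exists j : 'I_n,
           [&& i != j, row i == row j & col (g i) == col (g j)]].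
  exists 0; rewrite scale0r.
  have Rt : tperm i j \in R.
    by apply/row_stabP => k; case: tpermP => [->|->|].
  have Ct : (tperm i j ^ g)%g \in C.
    by rewrite tpermJ; apply/col_stabP => k; case: tpermP => [->|->|].
  (* The row sum absorbs the transposition, and the column sum its conjugate, with
     a sign. *)
  have E : row_sum *m aG g *m col_sum = - (row_sum *m aG g *m col_sum).
    transitivity (row_sum *m aG (tperm i j * g)%g *m col_sum).
      by rewrite aG_M (mulmxA row_sum) (row_sumM Rt).
    rewrite conjgC aG_M -!mulmxA (col_sumM Ct) odd_permJ odd_tperm ij expr1.
    by rewrite scaleN1r !mulmxN.
  have : 2%:R *: (row_sum *m aG g *m col_sum) = 0.
    by rewrite scaler_nat mulr2n {1}E addNr.
  by move/eqP; rewrite scaler_eq0 pnatr_eq0 => /eqP.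
have g_inj (i j : 'I_n) : row i = row j -> col (g i) = col (g j) -> i = j.
  move=> rij cij; apply/eqP; apply: contraT => ij.
  by have /existsPn/(_ j) := no i; rewrite ij rij cij !eqxx.
have [r [c [Rr Cc ->]]] := row_column_factor cells_left_just g_inj.
exists ((-1) ^+ c); rewrite aG_M mulmxA row_sumM; last exact/row_stabP.
by rewrite -mulmxA col_sumM -?scalemxAr //; apply/col_stabP.
Qed.

Lemma row_mul_mx_col (X : 'M[algC]_#|G|) : (X \in group_ring algC G)%MS ->
  exists a, row_sum *m X *m col_sum = a *: (row_sum *m col_sum).
Proof.
move=> /envelop_mxP[x ->].
have /fin_all_exists[a aP] : forall g : 'S_n,
    exists a, row_sum *m aG g *m col_sum = a *: (row_sum *m col_sum).
  exact: row_mul_col.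
exists (\sum_(g in G) x g * a g).
move: (row_sum) (col_sum) aP => R' C' aP.
rewrite mulmx_sumr mulmx_suml scaler_suml; apply: eq_bigr => g _.
by rewrite -scalemxAr -scalemxAl aP scalerA.
Qed.

Local Notation E := (row_sum *m col_sum).

Lemma group_ring_sym : (E \in group_ring algC G)%MS.
Proof.
rewrite /row_sum mulmx_suml linear_sum summx_sub // => r _.
rewrite /col_sum mulmx_sumr linear_sum summx_sub // => c _.
by rewrite -scalemxAr linearZ scalemx_sub // -aG_M envelop_mx_id ?inE.
Qed.

Lemma gring_row_aG (s : 'S_n) : gring_row (aG s) = delta_mx 0 (gring_index G s).
Proof. by rewrite /gring_row /= rowK gring_indexK ?inE // mul1g. Qed.

Lemma gring_row_sym : gring_row E = e.
Proof.
rewrite /row_sum mulmx_suml linear_sum; apply: eq_bigr => r _.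
rewrite /col_sum mulmx_sumr linear_sum; apply: eq_bigr => c _.
by rewrite -scalemxAr linearZ -aG_M /= gring_row_aG.
Qed.

Lemma sym_neq0 : e != 0.
Proof.
have index_inj (s s' : 'S_n) : (gring_index G s == gring_index G s') = (s == s').
  by rewrite (inj_in_eq (can_in_inj (@gring_indexK _ G))) ?inE.
have RC1 r c : r \in R -> c \in C -> (r * c)%g = 1%g -> r = 1%g /\ c = 1%g.
  move=> /row_stabP Rr /col_stabP Cc rc1.
  have r1 : r = 1%g.
    apply/permP=> i; rewrite perm1; apply: cell_inj; first exact: Rr.
    by rewrite -Cc -permM rc1 perm1.
  by split=> //; rewrite r1 mul1g in rc1.
have [R1 C1] : (1%g \in R) /\ (1%g \in C).
  by split; [apply/row_stabP | apply/col_stabP] => i; rewrite perm1.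
apply/eqP => /matrixP/(_ 0 (gring_index G 1)) /eqP; apply/negP.
rewrite mxE summxE (bigD1 1%g) //= [X in _ + X]big1 => [|r /andP[Rr r1]]; last first.
  rewrite summxE big1 // => c Cc; rewrite !mxE eqxx index_inj eq_sym.
  have [/(RC1 _ _ Rr Cc)[r1' _]|_] := eqVneq (r * c)%g 1%g; last by rewrite mulr0.
  by rewrite r1' eqxx in r1.
rewrite addr0 summxE (bigD1 1%g) //= [X in _ + X]big1 => [|c /andP[Cc c1]]; last first.
  by rewrite !mxE eqxx index_inj mul1g eq_sym (negPf c1) mulr0.
by rewrite !mxE mul1g !eqxx odd_perm1 mulr1 addr0 oner_eq0.
Qed.

Local Notation V := (cyclic_mx aG e).

(** By Maschke's theorem a submodule U is generated by an idempotent p = e X,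
    and e X e = a e by [row_mul_col]. If a vanished, then so would all products
    of two elements of U; but p u = u for u in U. *)
Lemma sub_specht_sym (U : 'M[algC]_#|G|) :
    mxmodule aG U -> (U <= V)%MS -> U != 0 ->
  exists X a, [/\ (X \in group_ring algC G)%MS, (e *m X <= U)%MS, a != 0 &
                 e *m X *m E = a *: e].
Proof.
move=> modU sUV U0.
have [W modW defV dxUW] := mx_Maschke_pchar aG (algC'G_pchar G) modU (submx1 _).
have /sub_addsmxP[[p' w'] /= E1] : (gring_row 1%:M <= U + W)%MS.
  by rewrite defV submx1.
set p := p' *m U in E1; set w := w' *m W in E1.
have pU : (p <= U)%MS by rewrite submxMl.
have wW : (w <= W)%MS by rewrite submxMl.
have /cyclic_mxP[X gX pE] := submx_trans pU sUV.
have fixU u : (u <= U)%MS -> u = p *m gring_mx aG u.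
  move=> uU; have uE : u = p *m gring_mx aG u + w *m gring_mx aG u.
    by rewrite -mulmxDl -E1 -gring_row_mul mul1mx gring_mxK.
  have pu : (p *m gring_mx aG u <= U)%MS by apply: mxmodule_envelop (gring_mxP _ _) pU.
  have wu : (w *m gring_mx aG u <= W)%MS by apply: mxmodule_envelop (gring_mxP _ _) wW.
  suff w0 : w *m gring_mx aG u = 0 by rewrite {1}uE w0 addr0.
  apply/eqP; rewrite -submx0 -(mxdirect_addsP dxUW) sub_capmx wu andbT.
  have -> : w *m gring_mx aG u = u - p *m gring_mx aG u by rewrite {2}uE addrC addKr.
  by rewrite addmx_sub // eqmx_opp.
have gR : (row_sum \in group_ring algC G)%MS.
  by rewrite linear_sum summx_sub // => r _; rewrite envelop_mx_id ?inE.
have gC : (col_sum \in group_ring algC G)%MS.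
  by rewrite linear_sum summx_sub // => c _; rewrite linearZ scalemx_sub // envelop_mx_id ?inE.
have [a Ea] := row_mul_mx_col (envelop_mxM gC (envelop_mxM gX gR)).
have {}Ea : e *m X *m E = a *: e.
  rewrite -gring_row_sym -!gring_row_mul -linearZ /= -Ea; congr (gring_row _).
  by rewrite !mulmxA.
exists X, a; split=> //; first by rewrite -pE.
apply: contraNneq U0 => a0; rewrite -submx0; apply/row_subP => i.
have uU : (matrix.row i U <= U)%MS by apply: row_sub.
have /cyclic_mxP[Y gY uE] := submx_trans uU sUV.
rewrite (fixU _ uU) uE -gring_row_sym -gring_row_mul gring_rowK ?envelop_mxM ?group_ring_sym //.
by rewrite mulmxA pE Ea a0 scale0r mul0mx sub0mx.
Qed.

(** A nonzero submodule contains e X e, a nonzero multiple of the generator e. *)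
Lemma specht_simple : mxsimple aG V.
Proof.
split=> [||U modU sUV U0]; first exact: cyclic_mx_module.
  by rewrite cyclic_mx_eq0 sym_neq0.
have [X [a [gX eXU a0 Ea]]] := sub_specht_sym modU sUV U0.
rewrite cyclic_mx_sub // -(scalerK a0 e) scalemx_sub // -Ea.
by apply: mxmodule_envelop (group_ring_sym) eXU.
Qed.

Local Notation rV := (submod_repr (cyclic_mx_module aG e)).

Lemma specht_irr : specht_char n la \in irr G.
Proof.
apply/irr_reprP; exists (Representation rV) => //.
exact/submod_mx_irr/specht_simple.
Qed.

Lemma specht_Res_dot (Y : {group 'S_n}) (xi : 'CF(Y)) (v : 'rV_#|G|) :
    xi \is a linear_char -> (v <= V)%MS -> v != 0 ->
    (forall y, y \in Y -> v *m aG y = xi y *: v) ->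
  '['Res[Y] (specht_char n la), xi] != 0.
Proof.
move=> lin_xi vV v0 vY; apply: (@eigenvector_Res_dot _ _ _ _ rV _ (in_submod V v)) => //.
- exact: subsetT.
- by apply: contraNneq v0 => vi0; rewrite -(in_submodK vV) vi0 linear0.
by move=> y Yy; rewrite -in_submodJ // vY // linearZ.
Qed.

(** The vector e X r, with r the row sum and X as in [sub_specht_sym], is fixed
    by row permutations, and not zero because e X r c is a nonzero multiple of
    e for the signed column sum c. *)
Lemma specht_Res_row (Y : {group 'S_n}) : Y \subset R ->
  '['Res[Y] (specht_char n la), 1] != 0.
Proof.
move=> sYR; have V0 : V != 0 by rewrite cyclic_mx_eq0 sym_neq0.
have [X [a [gX eXV a0 Ea]]] := sub_specht_sym (cyclic_mx_module _ _) (submx_refl _) V0.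
have gR : (row_sum \in group_ring algC G)%MS.
  by rewrite linear_sum summx_sub // => r _; rewrite envelop_mx_id ?inE.
apply: (@specht_Res_dot _ _ (e *m X *m row_sum)); first exact: cfun1_lin_char.
- exact: mxmodule_envelop (cyclic_mx_module _ _) gR eXV.
- apply: contraNneq a0 => v0; move: Ea; rewrite mulmxA v0 mul0mx => /esym/eqP.
  by rewrite scaler_eq0 (negPf sym_neq0) orbF.
move=> y Yy; rewrite -(mulmxA _ row_sum) row_sumM ?(subsetP sYR) //.
by rewrite cfun1E Yy scale1r.
Qed.

Lemma specht_Res_col (Y : {group 'S_n}) : Y \subset C ->
  '['Res[Y] (specht_char n la), cfSgn Y] != 0.
Proof.
move=> sYC; apply: (@specht_Res_dot _ _ e); first exact: cfSgn_lin.
- exact: cyclic_mx_id.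
- exact: sym_neq0.
move=> y Yy; rewrite -gring_row_sym -gring_row_mul -mulmxA.
by rewrite col_sum_right ?(subsetP sYC) // -scalemxAr linearZ /= cfSgnE.
Qed.

End YoungSymmetrizer.

(** * Characters with invariants of rows and columns *)

Section Identification.

Variable T : finType.
Local Notation A := [set: T].
Local Notation G := (SymOn A).
Implicit Types (chi : 'CF(G)) (u : T -> nat).

Lemma in_SymT g : g \in G.
Proof. by apply/SymP=> z; rewrite in_setT. Qed.

(** For u the row or the column of a cell, the row or the column stabilizer. *)
Definition fiber_stab u : {set {perm T}} := [set s : {perm T} | [forall i, u (s i) == u i]].

Lemma fiber_stabP u (s : {perm T}) : reflect (forall i, u (s i) = u i) (s \in fiber_stab u).
Proof. by rewrite inE; apply: (iffP forallP) => E i; apply/eqP. Qed.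

Lemma fiber_stab_group_set u : group_set (fiber_stab u).
Proof.
apply/group_setP; split=> [|s s' /fiber_stabP us /fiber_stabP us'].
  by apply/fiber_stabP => i; rewrite perm1.
by apply/fiber_stabP => i; rewrite permM us' us.
Qed.
Canonical fiber_stab_group u := Group (fiber_stab_group_set u).

Lemma Sym_sub_fiber_stab u (B : {set T}) :
  {in B &, forall a b, u a = u b} -> SymOn B \subset fiber_stab u.
Proof.
move=> uB; apply/subsetP=> s Bs; apply/fiber_stabP=> i.
have [iB|iB] := boolP (i \in B); first by apply: uB; rewrite ?Sym_stab.
by have /SymP-> := Bs.
Qed.

Lemma tperm_fiber_stab u a b : u a = u b -> tperm a b \in fiber_stab u.
Proof. by move=> uab; apply/fiber_stabP=> i; case: tpermP => [->|->|]. Qed.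

(** Exchanging the points of a transposition that avoids p reverses the sign
    and keeps the stabilizer of p, so the signs on this stabilizer cancel. *)
Lemma Fix_dot_Sgn0 (Y : {group {perm T}}) :
    (forall p, exists a b, [/\ tperm a b \in Y, a != b, p != a & p != b]) ->
  '['Res[Y] (cfFix A), cfSgn Y] = 0.
Proof.
move=> avoid; have sYG : Y \subset G by apply/subsetP=> s _; apply: in_SymT.
rewrite cfdotE (eq_bigr (fun s : {perm T} => \sum_(p : T) (s p == p)%:R * (-1) ^+ s)).
  rewrite exchange_big big1 ?mulr0 // => p _.
  have [a [b [Yt ab pa pb]]] := avoid p.
  have tp : tperm a b p = p by rewrite tpermD // eq_sym.
  set S := \sum_(s in Y) _; suff E : S = - S.
    have : 2%:R * S = 0 by rewrite mulr_natl mulr2n {1}E addNr.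
    by move/eqP; rewrite mulf_eq0 pnatr_eq0 => /eqP.
  rewrite {1}/S (reindex_inj (mulgI (tperm a b))) /= -sumrN.
  apply: eq_big => [s|s _]; first by rewrite groupMl.
  by rewrite permM tp odd_permM odd_tperm ab signr_addb expr1 mulN1r mulrN.
move=> s Ys; rewrite cfResE // cfFixE ?in_SymT // cfSgnE // natr_sum mulr_suml.
rewrite rmorph_sign; apply: eq_bigl => p; exact: in_setT.
Qed.

(** By [Fix_dot_Sgn0] the sign does not occur in pi if every point is avoided
    by a pair in a fiber. *)
Lemma pair_meets_point u (p0 : T) :
    '['Res[fiber_stab_group u] (cfRef A), cfSgn (fiber_stab_group u)] != 0 ->
  exists p, forall a b, u a = u b -> a != b -> p = a \/ p = b.
Proof.
move=> dS; set Y := fiber_stab_group u in dS.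
have [/existsP[p /forallP pP]|/existsPn no] := boolP [exists p, forall a, forall b,
    (u a == u b) && (a != b) ==> (p == a) || (p == b)].
  exists p => a b uab ab; have /forallP/(_ b) := pP a.
  by rewrite uab eqxx ab => /pred2P[]; auto.
have avoid p : exists a b, [/\ tperm a b \in Y, a != b, p != a & p != b].
  have := no p; rewrite negb_forall => /existsP[a].
  rewrite negb_forall => /existsP[b]; rewrite negb_imply negb_or.
  case/andP=> /andP[/eqP uab ab] /andP[pa pb]; exists a, b; split=> //.
  exact: tperm_fiber_stab.
case/eqP: dS; rewrite rmorphB rmorph1 cfdotBl Fix_dot_Sgn0 // sub0r.
have [a [b [Yt ab _ _]]] := avoid p0.
rewrite irr_dot_neq ?oppr0 ?cfun1_irr ?(lin_char_irr (cfSgn_lin _)) //.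
apply/eqP=> /cfunP/(_ (tperm a b)) /eqP; apply/negP.
rewrite cfSgnE // cfun1E Yt odd_tperm ab expr1 -subr_eq0 opprK.
by rewrite (pnatr_eq0 _ 2).
Qed.

(** Stated for all subgroups of the stabilizer, to be applied to the stabilizer
    and to the symmetric groups of a few cells of a row. *)
Definition row_invariant chi u : Prop :=
  forall Y : {group {perm T}}, Y \subset fiber_stab u -> '['Res[Y] chi, 1] != 0.
Definition col_invariant chi u : Prop :=
  forall Y : {group {perm T}}, Y \subset fiber_stab u -> '['Res[Y] chi, cfSgn Y] != 0.

Variables (u v : T -> nat) (chi : 'CF(G)).
Hypotheses (chi_irr : chi \in irr G).
Hypotheses (chi_row : row_invariant chi u) (chi_col : col_invariant chi v).

(** A linear character would be 1 on a transposition in a row and -1 on one in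
    a column, but transpositions are conjugate. *)
Lemma degree1_rows_or_cols a b c d :
  u a = u b -> a != b -> v c = v d -> c != d -> chi 1%g != 1.
Proof.
move=> uab ab vcd cd; apply/eqP=> f1.
have lin (Y : {group {perm T}}) : 'Res[Y] chi \is a linear_char.
  by apply: cfRes_lin_char; rewrite qualifE /= irrWchar // f1 eqxx.
have lin_eq (Y : {group {perm T}}) (xi : 'CF(Y)) : xi \is a linear_char ->
    '['Res[Y] chi, xi] != 0 -> {in Y, forall s, chi s = xi s}.
  move=> lxi d0 s Ys; rewrite -(irr_dot_eq (lin_char_irr (lin Y)) (lin_char_irr lxi) d0).
  by rewrite cfResE //; apply/subsetP=> s' _; apply: in_SymT.
have pair_sub w x y : w x = w y -> SymOn [set x; y] \subset fiber_stab w.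
  move=> wxy; apply: Sym_sub_fiber_stab => x' y'.
  by rewrite !inE => /pred2P[]-> /pred2P[]->.
have tin (x y : T) : tperm x y \in SymOn [set x; y] by rewrite tperm_Sym ?set21 ?set22.
have t1 : chi (tperm a b) = 1.
  rewrite (lin_eq _ _ (cfun1_lin_char _) (chi_row (pair_sub _ _ _ uab)) _ (tin a b)).
  by rewrite cfun1E tin.
have tN1 : chi (tperm c d) = -1.
  rewrite (lin_eq _ _ (cfSgn_lin _) (chi_col (pair_sub _ _ _ vcd)) _ (tin c d)).
  by rewrite cfSgnE ?tin // odd_tperm cd expr1.
have bA : b \in A :\ a by rewrite !inE eq_sym ab.
have [s Gs E] := tperm_conj_Sym (in_setT a) bA (in_setT c) (in_setT d) cd.
move/eqP: tN1; rewrite E cfunJ // t1 -subr_eq0 opprK.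
by rewrite (pnatr_eq0 _ 2).
Qed.

Lemma reflection_col (p0 : T) : chi = cfRef A ->
  exists p, forall a b, v a = v b -> a != b -> p = a \/ p = b.
Proof.
move=> E; apply: pair_meets_point => //.
by rewrite -E; apply: chi_col.
Qed.

(** Multiplication by the sign turns the invariants of the row stabilizer into
    sign vectors, which occur in rho and so in pi. *)
Lemma reflection_row (p0 : T) : chi = cfRef A * cfSgn G ->
  exists p, forall a b, u a = u b -> a != b -> p = a \/ p = b.
Proof.
move=> E; apply: pair_meets_point => //.
set Y := fiber_stab_group u; have sYG : Y \subset G by apply/subsetP=> s _; apply: in_SymT.
have ES : cfRef A = chi * cfSgn G by rewrite E -mulrA cfSgn_sqr mulr1.
rewrite ES rmorphM /= cfRes_Sgn // cfdot_mulA.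
have -> : cfSgn Y * (cfSgn Y)^*%CF = 1 by rewrite mul_conjC_lin_char ?cfSgn_lin.
exact: chi_row.
Qed.

Lemma deg5_4_in_row x y : #|T| = 6 -> x != y -> chi 1%g = 5 ->
    'Res[SymOn (A :\ x)] chi \in irr (SymOn (A :\ x)) ->
  ~ {in A :\ x :\ y &, forall a b, u a = u b}.
Proof.
move=> T6 xy f5 res_irr uxy; have yB : y \in A :\ x by rewrite !inE eq_sym xy.
have := chi_row (Sym_sub_fiber_stab uxy).
rewrite (deg5_no_Sym4 (in_setT x) yB) ?cardsT ?eqxx //; by left.
Qed.

Lemma deg5_4_in_col x y : #|T| = 6 -> x != y -> chi 1%g = 5 ->
    'Res[SymOn (A :\ x)] chi \in irr (SymOn (A :\ x)) ->
  ~ {in A :\ x :\ y &, forall a b, v a = v b}.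
Proof.
move=> T6 xy f5 res_irr uxy; have yB : y \in A :\ x by rewrite !inE eq_sym xy.
have := chi_col (Sym_sub_fiber_stab uxy).
rewrite (deg5_no_Sym4 (in_setT x) yB) ?cardsT ?eqxx //; by right.
Qed.

(** The value of chi at a transposition is 1 or -1. By [Res_Sym3_dot] it is not
    -1 if the symmetric group of three points has an invariant, and not 1 if it
    has a sign vector. *)
Lemma deg5_3_in_row_and_col x y z x' y' z' :
    uniq [:: x; y; z] -> uniq [:: x'; y'; z'] -> chi 1%g = 5 ->
    chi (tperm x y) ^+ 2 = 1 ->
    chi (tperm x y * tperm x z)%g = -1 -> chi (tperm x' y' * tperm x' z')%g = -1 ->
    {in [set x; y; z] &, forall a b, u a = u b} ->
  ~ {in [set x'; y'; z'] &, forall a b, v a = v b}.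
Proof.
have in3 a b c : uniq [:: a; b; c] -> [/\ a \in A, b \in A :\ a & c \in A :\ a :\ b].
  rewrite /= !inE andbT negb_or => /andP[/andP[ab ac] bc].
  by rewrite (eq_sym b a) (eq_sym c a) (eq_sym c b) ab ac bc.
move=> /in3[xA yB zC] /in3[xA' yB' zC'] f5 t1 c1 c1' uJ vJ.
have [d1 _] := Res_Sym3_dot xA yB zC chi_irr f5 c1.
have [_ d2] := Res_Sym3_dot xA' yB' zC' chi_irr f5 c1'.
have [yx' yA'] := setD1P yB'.
have xy' : x' != y' by rewrite eq_sym.
have [s Gs E] := tperm_conj_Sym xA yB xA' yA' xy'.
have := chi_col (Sym_sub_fiber_stab vJ); rewrite d2 E cfunJ //.
have := chi_row (Sym_sub_fiber_stab uJ); rewrite d1.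
move/eqP: t1; rewrite sqrf_eq1 => /pred2P[]->; first by rewrite subrr mul0r eqxx.
by rewrite subrr mul0r eqxx.
Qed.

End Identification.

(** * Shapes of partitions *)

Section PartitionShapes.

Implicit Types (la l : seq nat).

Lemma path_geq_ones k l : path geq 1 l -> 0%N \notin l -> sumn l = k -> l = nseq k 1%N.
Proof.
elim: l k => [|p l IHl] k /=; first by move=> _ _ <-.
case/andP=> p1 pl; rewrite inE negb_or eq_sym => /andP[p0 l0] <-.
have p1' : p = 1%N by apply/eqP; rewrite eqn_leq p1 lt0n p0.
by rewrite p1' /= in pl *; rewrite -(IHl (sumn l)) // p1'.
Qed.

(** The partitions of n with parts at most m, for n at most the fuel. *)
Fixpoint partitions (fuel n m : nat) : seq (seq nat) :=
  if n is 0 then [:: [::]]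
  else if fuel is fuel'.+1 then
    flatten [seq [seq p :: l | l <- partitions fuel' (n - p) p] | p <- iota 1 (minn n m)]
  else [::].

Lemma mem_partitions fuel n m l : (n <= fuel)%N ->
  path geq m l -> 0%N \notin l -> sumn l = n -> l \in partitions fuel n m.
Proof.
elim: fuel n m l => [|fuel IHf] n m [|p l] //=.
- by rewrite leqn0 => /eqP->; rewrite inE.
- by rewrite leqn0 inE negb_or => /eqP-> _ /andP[p0 _] /eqP; rewrite addn_eq0 eq_sym (negPf p0).
- by move=> _ _ _ <-; rewrite inE.
move=> nf /andP[pm pl]; rewrite inE negb_or eq_sym => /andP[p0 l0] sl.
case: n sl nf => [/eqP|n sl nf]; first by rewrite addn_eq0 (negPf p0).
apply/flatten_mapP; exists p; first by rewrite mem_iota lt0n p0 add1n ltnS leq_min pm -sl leq_addr.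
apply/mapP; exists l => //; apply: IHf => //; last by rewrite -sl addKn.
by lia.
Qed.

Lemma partition_list n la : is_partition n la -> la \in partitions n n n.
Proof.
case/and3P=> srt la0 /eqP sla; apply: mem_partitions => //.
case: la srt la0 sla => //= p l -> _ <-; rewrite andbT; exact: leq_addr.
Qed.

Variables (n : nat) (la : seq nat).
Hypotheses (n_gt0 : (0 < n)%N) (la_part : is_partition n la).
Local Notation row := (fun i : 'I_n => reshape_index la i).
Local Notation col := (fun i : 'I_n => reshape_offset la i).

Lemma partition_sum : sumn la = n.
Proof. by case/and3P: la_part => _ _ /eqP. Qed.

Local Notation cell := (cell_exists partition_sum).

Lemma partition_two_rows : la != [:: n] ->
  exists x y l, [/\ la = [:: x, y & l], (0 < y)%N & (y <= x)%N].
Proof.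
have := partition_sum; case/and3P: la_part => srt la0 _ sla.
case: la srt la0 sla => [|x [|y l]] /=.
- by move=> _ _ n0; move: n_gt0; rewrite -n0.
- by rewrite addn0 => _ _ ->; rewrite eqxx.
rewrite !inE !negb_or => /andP[yx _] /and3P[_ y0 _] _ _.
by exists x, y, l; rewrite lt0n eq_sym y0.
Qed.

Lemma conj_ones : conj_part (nseq n 1%N) = [:: n].
Proof.
have [m ->] : exists m, n = m.+1 by exists n.-1; rewrite prednK.
by rewrite /conj_part /= count_nseq /= mul1n.
Qed.

Lemma partition_nonlinear : la \notin [:: [:: n]; nseq n 1%N] ->
  exists (a b c d : 'I_n), [/\ row a = row b, a != b, col c = col d & c != d].
Proof.
rewrite !inE negb_or => /andP[/partition_two_rows[x [y [l [Ela y0 yx]]]] ones].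
have x1 : (1 < x)%N.
  rewrite ltn_neqAle (leq_trans y0 yx) andbT eq_sym; apply: contra ones => /eqP x1.
  have := partition_sum; case/and3P: la_part; rewrite Ela x1 => srt la0 _ sla.
  by apply/eqP/path_geq_ones.
have [a [ra ca]] : exists i : 'I_n, row i = 0%N /\ col i = 0%N.
  by apply: cell; rewrite Ela /= ltnW.
have [b [rb cb]] : exists i : 'I_n, row i = 0%N /\ col i = 1%N by apply: cell; rewrite Ela.
have [d [rd cd]] : exists i : 'I_n, row i = 1%N /\ col i = 0%N by apply: cell; rewrite Ela.
exists a, b, a, d; split; rewrite /= ?ra ?ca //.
  by apply/eqP=> ab; rewrite ab cb in ca.
by apply/eqP=> ad; rewrite ad rd in ra.
Qed.

(** All pairs of cells in a common column contain p, so that only one column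
    has two cells, and none has three. *)
Lemma partition_hook_col (p : 'I_n) : la != [:: n] ->
    (forall a b : 'I_n, col a = col b -> a != b -> p = a \/ p = b) ->
  la = [:: n.-1; 1%N].
Proof.
move=> /partition_two_rows[x [y [l [Ela y0 yx]]]] pP.
have pC r r' c : r != r' -> (c < nth 0 la r)%N -> (c < nth 0 la r')%N ->
    col p = c /\ (row p = r \/ row p = r').
  move=> rr' /cell[a [ra ca]] /cell[b [rb cb]].
  have ab : a != b by apply: contraNneq rr' => ab; rewrite -ra -rb ab.
  by case: (pP a b _ ab) => [|->|->]; rewrite /= ?ra ?ca ?rb ?cb; auto.
have x0 := leq_trans y0 yx; have sla := partition_sum; rewrite Ela in pC sla.
have y1 : y = 1%N.
  apply/eqP; rewrite eqn_leq y0 andbT leqNgt; apply/negP=> y1.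
  have [c0 _] := pC 0%N 1%N 0%N isT x0 y0.
  have [c1 _] := pC 0%N 1%N 1%N isT (leq_trans y1 yx) y1.
  by rewrite c0 in c1.
case: l => [|z l] in Ela pC sla *; first by rewrite Ela y1 -sla y1 /= addn0 addn1.
have z0 : (0 < z)%N.
  case/and3P: la_part => _ la0 _; rewrite lt0n; apply: contra la0 => /eqP z0.
  by rewrite Ela z0 !inE eqxx !orbT.
have [_ r01] := pC 0%N 1%N 0%N isT x0 y0.
have [_ r02] := pC 0%N 2 0%N isT x0 z0.
have [_ r12] := pC 1%N 2 0%N isT y0 z0.
by case: r01 r02 r12 => -> [] // _ [].
Qed.

(** As in [partition_hook_col], only one row has two cells, and none has three. *)
Lemma partition_hook_row (p : 'I_n) : la != nseq n 1%N ->
    (forall a b : 'I_n, row a = row b -> a != b -> p = a \/ p = b) ->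
  conj_part la = [:: n.-1; 1%N].
Proof.
move=> ones pP; have sla := partition_sum.
have pC r c c' : c != c' -> (c < nth 0 la r)%N -> (c' < nth 0 la r)%N ->
    row p = r /\ (col p = c \/ col p = c').
  move=> cc' /cell[a [ra ca]] /cell[b [rb cb]].
  have ab : a != b by apply: contraNneq cc' => ab; rewrite -ca -cb ab.
  by case: (pP a b _ ab) => [|->|->]; rewrite /= ?ra ?ca ?rb ?cb; auto.
case Ela: la => [|x l]; first by move: n_gt0; rewrite -sla Ela.
rewrite Ela in pC sla; case/and3P: la_part; rewrite Ela => srt la0 _.
have l0 : 0%N \notin l by move: la0; rewrite inE negb_or => /andP[].
have x0 : (0 < x)%N by move: la0; rewrite inE negb_or eq_sym lt0n => /andP[].
have x1 : (1 < x)%N.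
  rewrite ltn_neqAle x0 andbT eq_sym; apply: contra ones => /eqP x1.
  rewrite Ela; apply/eqP/path_geq_ones => //.
  by move: srt; rewrite /= x1.
have x2 : x = 2.
  apply/eqP; rewrite eqn_leq x1 andbT leqNgt; apply/negP=> x2.
  have [_ c01] := pC 0%N 0%N 1%N isT x0 x1.
  have [_ c02] := pC 0%N 0%N 2 isT x0 x2.
  have [_ c12] := pC 0%N 1%N 2 isT x1 x2.
  by case: c01 c02 c12 => -> [] // _ [].
have El : l = nseq n.-2 1%N.
  apply: path_geq_ones => //; last by rewrite -sla /= x2.
  case: l => [|y l] //= in Ela pC srt la0 l0 sla *; case/andP: srt => _ ->; rewrite andbT.
  rewrite leqNgt; apply/negP=> y1.
  have [r0 _] := pC 0%N 0%N 1%N isT x0 x1.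
  have [r1 _] := pC 1%N 0%N 1%N isT (ltnW y1) y1.
  by rewrite r0 in r1.
rewrite /conj_part /= x2 /= El !count_nseq /= mul1n mul0n addn0.
have n2 : (2 <= n)%N by rewrite -sla /= x2.
by congr [:: _; _]; lia.
Qed.

End PartitionShapes.

(** * Squares of Specht characters *)

Section Conclusion.

Variables (n : nat) (la : seq nat).
Hypotheses (n_gt0 : (0 < n)%N) (la_part : is_partition n la).
Local Notation A := [set: 'I_n].
Local Notation G := (SymOn A).
Local Notation row := (fun i : 'I_n => reshape_index la i).
Local Notation col := (fun i : 'I_n => reshape_offset la i).

Variable chi : 'CF(G).
Hypotheses (chi_irr : chi \in irr G).
Hypotheses (chi_row : row_invariant chi row) (chi_col : col_invariant chi col).

Lemma nonlinear_degree : la \notin [:: [:: n]; nseq n 1%N] -> chi 1%g != 1.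
Proof.
case/(partition_nonlinear n_gt0 la_part) => a [b [c [d [ab ab' cd cd']]]].
exact: (degree1_rows_or_cols chi_irr chi_row chi_col ab ab' cd cd').
Qed.

Definition exceptional (l : seq nat) : bool :=
  l \in [:: [:: n]; [:: n.-1; 1%N]; [:: 2; 2]; [:: 3; 3]].

Hypotheses (la_ok : ~~ exceptional la) (conj_ok : ~~ exceptional (conj_part la)).

Lemma ok_nonlinear : la \notin [:: [:: n]; nseq n 1%N].
Proof.
rewrite !inE; apply/norP; split.
  by apply: contra la_ok => /eqP->; rewrite /exceptional inE eqxx.
by apply: contra conj_ok => /eqP->; rewrite conj_ones // /exceptional inE eqxx.
Qed.

Let f1 : chi 1%g != 1 := nonlinear_degree ok_nonlinear.

Lemma not_linear_or_reflection (p0 : 'I_n) : ~ linear_or_reflection chi.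
Proof.
have := ok_nonlinear; rewrite !inE => /norP[la_n la_1].
case=> E.
- by move: f1; rewrite E cfun11 eqxx.
- by move: f1; rewrite E (lin_char1 (cfSgn_lin _)) eqxx.
- have [p pP] := reflection_col chi_col p0 E.
  have El := partition_hook_col n_gt0 la_part la_n pP.
  by case/negP: la_ok; rewrite El /exceptional !inE eqxx orbT.
have [p pP] := reflection_row chi_row p0 E.
have El := partition_hook_row n_gt0 la_part la_1 pP.
by case/negP: conj_ok; rewrite El /exceptional !inE eqxx orbT.
Qed.

Lemma homogeneous_cases (x y z : 'I_n) : uniq [:: x; y; z] ->
  [\/ inhomogeneous (cfAlt2 chi), n = 4
    | 'Res[SymOn (A :\ x)] chi \in irr (SymOn (A :\ x)) /\
      [/\ n = 6, chi 1%g = 5, chi (tperm x y) ^+ 2 = 1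
        & chi (tperm x y * tperm x z)%g = -1]].
Proof.
rewrite /= !inE andbT negb_or => /andP[/andP[xy xz] yz].
have [xA yB zC] : [/\ x \in A, y \in A :\ x & z \in A :\ x :\ y].
  by rewrite !inE (eq_sym y x) (eq_sym z x) (eq_sym z y) xy xz yz.
have [inh|lr|n4|[res [n6 f5 t1 c1]]] := homogeneous_Alt2 xA yB zC chi_irr f1.
- by constructor 1.
- by case: (not_linear_or_reflection x lr).
- by constructor 2; rewrite -n4 cardsT card_ord.
by constructor 3; split; rewrite // -n6 cardsT card_ord.
Qed.

End Conclusion.

Section Degree6.

Variables (la : seq nat) (chi : 'CF(SymOn [set: 'I_6])).
Local Notation A := [set: 'I_6].
Local Notation row := (fun i : 'I_6 => reshape_index la i).
Local Notation col := (fun i : 'I_6 => reshape_offset la i).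
Hypotheses (chi_irr : chi \in irr (SymOn A)).
Hypotheses (chi_row : row_invariant chi row) (chi_col : col_invariant chi col).
Hypotheses (la_part : is_partition 6 la).
Hypotheses (la_ok : ~~ exceptional 6 la) (conj_ok : ~~ exceptional 6 (conj_part la)).
Hypothesis hom5 : forall x y z : 'I_6, uniq [:: x; y; z] ->
  inhomogeneous (cfAlt2 chi) \/
  [/\ 'Res[SymOn (A :\ x)] chi \in irr (SymOn (A :\ x)), chi 1%g = 5,
      chi (tperm x y) ^+ 2 = 1 & chi (tperm x y * tperm x z)%g = -1].

Lemma in_const (B : {set 'I_6}) (u : nat -> nat) :
    (forall i : 'I_6, i \in B -> u i = 0%N) ->
  {in B &, forall a b : 'I_6, u a = u b}.
Proof. by move=> uB a b /uB-> /uB->. Qed.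

(** Cells are numbered from 0, row by row. For (2, 2, 1, 1) the cells other
    than 1 and 3, and for (3, 1, 1, 1) those other than 1 and 2, form the first
    column; for (4, 1, 1) and (4, 2) those other than 4 and 5 form the first
    row. For (3, 2, 1) the first row is 0, 1, 2 and the first column 0, 3, 5. *)
Lemma Alt2_inhomogeneous_deg6 : inhomogeneous (cfAlt2 chi).
Proof.
have : la \in [seq l <- partitions 6 6 6 |
    ~~ exceptional 6 l && ~~ exceptional 6 (conj_part l)].
  by rewrite mem_filter la_ok conj_ok partition_list.
rewrite [filter _ _]/=.
pose p k (lt_k6 : (k < 6)%N) := Ordinal lt_k6.
pose p0 := p 0%N isT; pose p1 := p 1%N isT; pose p2 := p 2%N isT.
pose p3 := p 3%N isT; pose p4 := p 4%N isT; pose p5 := p 5%N isT.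
have T6 : #|'I_6| = 6 by rewrite card_ord.
have [rowP colP] := (chi_row, chi_col).
rewrite !inE => /or4P[||| /orP[]] /eqP Ela; rewrite Ela in rowP colP.
- have [//|[res f5 _ _]] := hom5 (isT : uniq [:: p1; p3; p0]).
  case: (deg5_4_in_col chi_irr colP T6 (isT : p1 != p3) f5 res).
  by apply: in_const; case=> [[|[|[|[|[|[]]]]]]] //= lt6; rewrite !inE.
- have [//|[res f5 _ _]] := hom5 (isT : uniq [:: p1; p2; p0]).
  case: (deg5_4_in_col chi_irr colP T6 (isT : p1 != p2) f5 res).
  by apply: in_const; case=> [[|[|[|[|[|[]]]]]]] //= lt6; rewrite !inE.
- have u012 : uniq [:: p0; p1; p2] by [].
  have u035 : uniq [:: p0; p3; p5] by [].
  have [//|[_ f5 t1 c1]] := hom5 u012; have [//|[_ _ _ c1']] := hom5 u035.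
  case: (deg5_3_in_row_and_col chi_irr rowP colP u012 u035 f5 t1 c1 c1').
    by apply: in_const; case=> [[|[|[|[|[|[]]]]]]] //= lt6; rewrite !inE.
  by apply: in_const; case=> [[|[|[|[|[|[]]]]]]] //= lt6; rewrite !inE.
- have [//|[res f5 _ _]] := hom5 (isT : uniq [:: p4; p5; p0]).
  case: (deg5_4_in_row chi_irr rowP T6 (isT : p4 != p5) f5 res).
  by apply: in_const; case=> [[|[|[|[|[|[]]]]]]] //= lt6; rewrite !inE.
have [//|[res f5 _ _]] := hom5 (isT : uniq [:: p4; p5; p0]).
case: (deg5_4_in_row chi_irr rowP T6 (isT : p4 != p5) f5 res).
by apply: in_const; case=> [[|[|[|[|[|[]]]]]]] //= lt6; rewrite !inE.
Qed.

End Degree6.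

Lemma Alt2_inhomogeneous n la (chi : 'CF(SymOn [set: 'I_n])) :
    (0 < n)%N -> is_partition n la -> chi \in irr (SymOn [set: 'I_n]) ->
    row_invariant chi (fun i : 'I_n => reshape_index la i) ->
    col_invariant chi (fun i : 'I_n => reshape_offset la i) ->
    ~~ exceptional n la -> ~~ exceptional n (conj_part la) ->
  inhomogeneous (cfAlt2 chi).
Proof.
move=> n_gt0 la_part chi_irr chi_row chi_col la_ok conj_ok.
have cases := homogeneous_cases n_gt0 la_part chi_irr chi_row chi_col la_ok conj_ok.
(* All partitions of 1, 2 and 4 are excluded, or their conjugates are. *)
have small : n \notin [:: 1; 2; 4]%N.
  apply/negP=> n124; move: n124 la_ok (partition_list la_part) conj_ok.
  by rewrite !inE => /or3P[]/eqP-> la_ok; rewrite !inE;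
    repeat (case/orP; [|]); move/eqP=> Ela; rewrite Ela in la_ok *.
have n3 : (2 < n)%N by move: n_gt0 small; case: (n) => [|[|[]]].
pose x := Ordinal (ltn_trans (isT : 0 < 2)%N n3).
pose y := Ordinal (ltn_trans (isT : 1 < 2)%N n3).
have xyz : uniq [:: x; y; Ordinal n3] by [].
have [//|n4|[_ [n6 _ _ _]]] := cases _ _ _ xyz.
  by rewrite n4 in small.
subst n; apply: (Alt2_inhomogeneous_deg6 chi_irr chi_row chi_col) => // a b c abc.
by have [|//|[res [_ f5 t1 c1]]] := cases a b c abc; [left | right].
Qed.

Section Specht.

Variables (n : nat) (la : seq nat).
Hypotheses (n_gt0 : (0 < n)%N) (la_part : is_partition n la).
Local Notation chi := (specht_char n la).

(** The groups ['S_n] and SymOn [set: 'I_n] are equal but not convertible, and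
    the type of chi depends on them; so the property P has to be stated for a
    variable group. *)
Lemma specht_transfer (P : forall G : {group 'S_n}, 'CF(G) -> Prop) :
    (forall chi' : 'CF(SymOn [set: 'I_n]), chi' \in irr (SymOn [set: 'I_n]) ->
       row_invariant chi' (fun i : 'I_n => reshape_index la i) ->
       col_invariant chi' (fun i : 'I_n => reshape_offset la i) -> P _ chi') ->
  P [set: 'S_n]%G chi.
Proof.
have la_n := partition_sum la_part => P_Sym.
suff transfer (G : {group 'S_n}) (phi : 'CF(G)) : SymOn [set: 'I_n] = G ->
    phi \in irr G ->
    (forall Y : {group 'S_n}, Y \subset row_stab n la -> '['Res[Y] phi, 1] != 0) ->
    (forall Y : {group 'S_n}, Y \subset col_stab n la -> '['Res[Y] phi, cfSgn Y] != 0) ->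
    P G phi.
  apply: transfer; last exact: specht_Res_col.
  - by apply/val_inj/setP=> s; rewrite /= in_SymT inE.
  - exact: specht_irr.
  exact: specht_Res_row.
by move=> EG; case: G / EG phi => phi irr_phi row_phi col_phi; apply: P_Sym.
Qed.

Lemma specht_Sym2_inhomogeneous :
  la \notin [:: [:: n]; nseq n 1%N] -> inhomogeneous (cfSym2 chi).
Proof.
move=> nonlin; apply: (@specht_transfer (fun _ phi => inhomogeneous (cfSym2 phi))).
move=> phi irr_phi row_phi col_phi; apply: Sym2_inhomogeneous => //.
exact: nonlinear_degree row_phi col_phi nonlin.
Qed.

Lemma specht_Alt2_inhomogeneous :
  ~~ exceptional n la -> ~~ exceptional n (conj_part la) ->
  inhomogeneous (cfAlt2 chi).
Proof.
move=> la_ok conj_ok.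
apply: (@specht_transfer (fun _ phi => inhomogeneous (cfAlt2 phi))) => phi irr_phi row_phi col_phi.
exact: Alt2_inhomogeneous row_phi col_phi la_ok conj_ok.
Qed.

End Specht.

End SpechtSquares.

Theorem theoremA (n : nat) (la : seq nat) (n_gt0 : 0 < n)
    (la_part : is_partition n la) :
  (la \notin [:: [:: n]; nseq n 1] ->
     inhomogeneous (cfSym2 (specht_char n la)) /\
     reducible (cfSym2 (specht_char n la))) /\
  (la \notin [:: [:: n]; [:: n.-1; 1]; [:: 2; 2]; [:: 3; 3]] ->
   conj_part la \notin [:: [:: n]; [:: n.-1; 1]; [:: 2; 2]; [:: 3; 3]] ->
     inhomogeneous (cfAlt2 (specht_char n la)) /\
     reducible (cfAlt2 (specht_char n la))).
Proof.
split=> [nonlinear | la_ok conj_ok].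
  have inh := SpechtSquares.specht_Sym2_inhomogeneous n_gt0 la_part nonlinear.
  exact: conj inh (SpechtSquares.inhomogeneous_reducible inh).
have inh := SpechtSquares.specht_Alt2_inhomogeneous n_gt0 la_part la_ok conj_ok.
exact: conj inh (SpechtSquares.inhomogeneous_reducible inh).
Qed.
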